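(* Let $\mathcal{H}$ be a tree-to-tree Hennie machine from $\Sigma$ to $\Gamma$ and $\mathcal{N}$ an unrestricted tree-to-tree Hennie machine from $\Gamma$ to $\Xi$ that is narrow-visit on the range of $[\![\mathcal{H}]\!]$. Then $[\![\mathcal{N}]\!]\circ[\![\mathcal{H}]\!]$ is computed by some tree-to-tree Hennie machine.
   Context: Trees: ranked alphabets are finite sets with a rank function to $\mathbb{N}$; $T_\Sigma$ is the set of finite ordered $\Sigma$-labeled trees where a node labeled $\sigma$ has $\mathrm{rank}(\sigma)$ children (nodes are words over positive integers, root $\varepsilon$, $i$-th child of $u$ is $ui$); $T_\Sigma[Y]$ allows extra rank-$0$ leaves labeled in $Y$. The ancestor order on nodes is the prefix order; an antichain is a set of pairwise incomparable nodes. Hennie machines: a uTHM is $(Q,M,\top,\Sigma,\Gamma,q_{init},\delta)$ with finite states $Q$, finite memory symbols $M\ni\top$, $q_{init}\in Q$, partial $\delta:Q\times\Sigma\times M\rightharpoonup T_\Gamma[Q\times M\times D]$, $D=\{\uparrow,1,..,\max\mathrm{rank}\Sigma\}$, leaves $(q',m',d)$ of $\delta(q,\sigma,m)$ having $d\in\{\uparrow,1,..,\mathrm{rank}\sigma\}$. Configurations on $t$ are $(u,q,\mu)$, $\mu:$ nodes$\to M$, initially $(\varepsilon,q_{init},\text{constant }\top)$; the step of $(u,q,\mu)$ is $\delta(q,\mathrm{lab}_t(u),\mu(u))$ with each leaf $(q',m',d)$ replaced by $(ud,q',\mu[u\mapsto m'])$ ($ud$ the parent if $d=\uparrow$, else the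 $d$-th child; undefined if nonexistent). Confluent rewriting of configuration leaves by steps from the initial configuration yields the output $[\![\mathcal{H}]\!](t)\in T_\Gamma$, if any. A branch-outputting run is $C_0,..,C_n$ with $C_0$ initial and $C_{i+1}$ a leaf label of the step of $C_i$; its number of visits at a node set $S$ is $|\{i:\text{position of }C_i\in S\}|$. A uTHM is bounded-visit on $L$ if some $N$ bounds visits at every single node for all $t\in L$ and all runs on $t$; a THM is a uTHM bounded-visit on all inputs. A uTHM is narrow-visit on $L$ if some $N$ bounds visits at every antichain $S$ of $t$, for all $t\in L$ and all runs on $t$. *)

(* Defs.v *)
From mathcomp Require Import all_boot.
From Stdlib Require List.
Set Implicit Arguments.
Unset Strict Implicit.
Unset Printing Implicit Defensive.

Record ranked_alphabet := RankedAlphabet {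
  ra_sym : finType;
  ra_rank : ra_sym -> nat }.
Arguments ra_rank : clear implicits.

(* Finite ordered labeled trees (well-rankedness imposed separately). *)
Inductive tree (A : Type) : Type := Node : A -> seq (tree A) -> tree A.
Arguments Node {A} _ _.

Fixpoint wf_tree (A : Type) (rk : A -> nat) (t : tree A) : bool :=
  let 'Node a ch := t in (size ch == rk a) && all (wf_tree rk) ch.

(* Nodes are words over positive integers; root = [::], i-th child of u
   is rcons u i (children numbered from 1). subt t u is the subtree at u. *)
Fixpoint subt (A : Type) (t : tree A) (u : seq nat) : option (tree A) :=
  match u with
  | [::] => Some t
  | i :: u' =>
      let 'Node _ ch := t in
      if i is 0 then None
      else match List.nth_error ch i.-1 with
           | Some c => subt c u'
           | None => None
           end
  end.

Definition is_node (A : Type) (t : tree A) (u : seq nat) : bool :=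
  isSome (subt t u).

Definition lab (A : Type) (t : tree A) (u : seq nat) : option A :=
  match subt t u with Some (Node a _) => Some a | None => None end.

Definition antichain (S : seq (seq nat)) : Prop :=
  forall u v, u \in S -> v \in S -> u != v -> ~~ prefix u v.

Fixpoint tmap_opt (A B : Type) (f : A -> option B) (t : tree A)
  : option (tree B) :=
  let 'Node a ch := t in
  let fix go (l : seq (tree A)) : option (seq (tree B)) :=
    match l with
    | [::] => Some [::]
    | x :: r => match tmap_opt f x, go r with
                | Some y, Some r' => Some (y :: r')
                | _, _ => None
                end
    end in
  match f a, go ch with
  | Some b, Some ch' => Some (Node b ch')
  | _, _ => None
  end.

Fixpoint leaves (A B : Type) (t : tree (A + B)) : list B :=
  let 'Node a ch := t in
  match a with
  | inr b => [:: b]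
  | inl _ => List.flat_map (@leaves A B) ch
  end.

(* Directions D = {up, 1, .., max rank}: None = up, Some i = i-th child. *)
Definition dir := option nat.

(* Well-formedness of a transition output delta(q, sigma, m) in
   T_Gamma[Q x M x D]: Gamma-nodes are well-ranked, (q',m',d) are leaves,
   and d in {up, 1, .., rank sigma}. *)
Fixpoint out_wf (G X : Type) (rkG : G -> nat) (r : nat)
    (t : tree (G + (X * dir))) : bool :=
  let 'Node a ch := t in
  match a with
  | inl g => (size ch == rkG g) && all (out_wf rkG r) ch
  | inr (_, d) =>
      (size ch == 0) &&
      (match d with None => true | Some i => (0 < i) && (i <= r) end)
  end.

Record uTHM (Sigma Gamma : ranked_alphabet) := UTHM {
  hQ : finType;
  hM : finType;
  htop : hM;
  hqinit : hQ;
  hdelta : hQ -> ra_sym Sigma -> hM ->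
           option (tree (ra_sym Gamma + ((hQ * hM) * dir)));
  hdelta_wf : forall q s m tau, hdelta q s m = Some tau ->
      out_wf (ra_rank Gamma) (ra_rank Sigma s) tau }.
Arguments hdelta {Sigma Gamma} u _ _ _.

Section Semantics.
Variables (Sigma Gamma : ranked_alphabet) (H : uTHM Sigma Gamma).

Definition config : Type := ((seq nat * hQ H) * (seq nat -> hM H))%type.
Definition cpos (C : config) : seq nat := C.1.1.

Definition init_config : config := ([::], hqinit H, fun _ => htop H).

Definition upd (mu : seq nat -> hM H) (u : seq nat) (m : hM H) :=
  fun v => if v == u then m else mu v.

Definition move (t : tree (ra_sym Sigma)) (u : seq nat) (d : dir)
  : option (seq nat) :=
  match d with
  | None => if u is [::] then None else Some (take (size u).-1 u)
  | Some i => if is_node t (rcons u i) then Some (rcons u i) else None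
  end.

Definition step (t : tree (ra_sym Sigma)) (C : config)
  : option (tree (ra_sym Gamma + config)) :=
  let '(u, q, mu) := C in
  match lab t u with
  | None => None
  | Some s =>
    match hdelta H q s (mu u) with
    | None => None
    | Some tau =>
      tmap_opt (fun x => match x with
                 | inl g => Some (inl g)
                 | inr (q', m', d) =>
                     option_map (fun v => inr (v, q', upd mu u m')) (move t u d)
                 end) tau
    end
  end.

Inductive yields (t : tree (ra_sym Sigma))
  : tree (ra_sym Gamma + config) -> tree (ra_sym Gamma) -> Prop :=
| YOut g ch ch' : List.Forall2 (yields t) ch ch' ->
    yields t (Node (inl g) ch) (Node g ch')
| YConf C tau s : step t C = Some tau -> yields t tau s ->
    yields t (Node (inr C) [::]) s.

Definition sem (t : tree (ra_sym Sigma)) (s : tree (ra_sym Gamma)) : Prop :=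
  yields t (Node (inr init_config) [::]) s.

Fixpoint chain (t : tree (ra_sym Sigma)) (C : config) (rest : seq config)
  : Prop :=
  match rest with
  | [::] => True
  | C' :: r =>
      (exists tau, step t C = Some tau /\ List.In C' (leaves tau))
      /\ chain t C' r
  end.

Definition is_run (t : tree (ra_sym Sigma)) (cs : seq config) : Prop :=
  match cs with
  | [::] => False
  | C0 :: rest => C0 = init_config /\ chain t C0 rest
  end.

Definition visits (cs : seq config) (S : seq (seq nat)) : nat :=
  count (fun C => cpos C \in S) cs.

Definition bounded_visit_on (L : tree (ra_sym Sigma) -> Prop) : Prop :=
  exists N, forall t, L t -> forall cs, is_run t cs ->
    forall u, visits cs [:: u] <= N.

Definition narrow_visit_on (L : tree (ra_sym Sigma) -> Prop) : Prop :=
  exists N, forall t, L t -> forall cs, is_run t cs ->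
    forall S : seq (seq nat), antichain S -> all (is_node t) S ->
      visits cs S <= N.

Definition is_THM : Prop := bounded_visit_on (fun t => wf_tree (ra_rank Sigma) t).

Definition sem_range (s : tree (ra_sym Gamma)) : Prop :=
  exists t, wf_tree (ra_rank Sigma) t /\ sem t s.

End Semantics.

(* Main.v *)
(** A branch of the output [s] of H is the trace of a single run of H, so K can keep, distributed
over the nodes of [t], a log of the part of the computation tree of H that N has already seen.
A record of the log, stored at the node where H stood, holds the state of H, the memory of H
there before the step, the memory of N at the produced node of [s], and a pointer to the
record of the preceding step.  When N goes down, K runs H forwards, finding or creating the
record of the child; when N goes up, K undoes the step of H.  Since H visits a node [u] of [t]
boundedly often on each branch, the nodes of [s] produced at [u] split into boundedly many
antichains, according to the number of their ancestors produced at [u]; as N is narrow-visit,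
K visits [u] boundedly often, and boundedly many records are stored there.

Several normalizations make this a step-by-step simulation.  H is cut into steps that output
exactly one symbol, where a unary symbol [None] stands for a step without output, and N is made to
walk through the [None] nodes.  K may first stay at its node; sequences of stays are then
contracted.  Finally K must be undefined when H is: the domain of H is recognized by a finite
bottom-up device, whose states record, to a bounded depth, in which ways an excursion into a
subtree can end, and K evaluates this device in an initial traversal. *)
Require Import Defs.
From HB Require Import structures.
From mathcomp Require Import all_boot.
From mathcomp Require Import boolp zify.
From Stdlib Require List.
Set Implicit Arguments.
Unset Strict Implicit.
Unset Printing Implicit Defensive.

(** The domain needs a test of its own because the composition is undefined as soon as one branch of
    H fails, whereas N may never look at the part of the output that this branch would produce; a
    simulation that creates the output on demand cannot notice the failure. The difficulty of the
    test is that a branch of H leaves changed memory in a subtree and may come back to it, so one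
    has to know how the subtree will react to later visits. Each visit uses up part of a fixed
    allowance at the visited node; descriptions of reactions to reactions, nested to the depth of
    that allowance, therefore suffice, and with finitely many states there are finitely many of
    them.

    Narrowness enters through the capacity of the log. Nodes of the intermediate tree that lie on
    different branches may be produced at the same node of the input in unbounded number, and their
    records compete for the memory of that one node. A bound on the visits of N to single nodes
    would leave the number of such records unbounded. *)

Notation Forall2 := List.Forall2.

(** * Induction on trees, and lists related position by position *)

Lemma tree_nested_ind (A : Type) (P : tree A -> Prop) :
  (forall a ch, List.Forall P ch -> P (Node a ch)) -> forall t, P t.
Proof.
move=> IH; fix F 1; case=> a ch; apply: IH.
by elim: ch => [|c ch IHch]; constructor.
Qed.

Lemma Forall2_nth (A B : Type) (R : A -> B -> Prop) s s' i a :
  Forall2 R s s' -> List.nth_error s i = Some a ->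
  exists2 b, List.nth_error s' i = Some b & R a b.
Proof.
move=> H; elim: H i => [|x y s0 s0' Rxy _ IH] [|i] //=.
  by case=> <-; exists y.
by move=> /IH.
Qed.

Lemma Forall2_sym (A B : Type) (R : A -> B -> Prop) s s' :
  Forall2 R s s' -> Forall2 (fun b a => R a b) s' s.
Proof. by elim=> *; constructor. Qed.

Lemma Forall2_size (A B : Type) (R : A -> B -> Prop) s s' :
  Forall2 R s s' -> size s = size s'.
Proof. by elim=> //= x y s0 s0' _ _ ->. Qed.

Lemma Forall2_imp_in (A B : Type) (R R' : A -> B -> Prop) s s' :
  (forall a b, List.In a s -> List.In b s' -> R a b -> R' a b) ->
  Forall2 R s s' -> Forall2 R' s s'.
Proof.
move=> H H2; elim: H2 H => [|a b l l' Rab _ IH] H; constructor.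
  by apply: H => //; left.
by apply: IH => a' b' ia ib; apply: H; right.
Qed.

Lemma Forall2_comp (A B C : Type) (R : A -> B -> Prop) (R' : A -> C -> Prop)
    s s' s'' :
  Forall2 R s s' -> Forall2 R' s s'' ->
  Forall2 (fun b c => exists a, [/\ List.In a s, R a b & R' a c]) s' s''.
Proof.
move=> H; elim: H s'' => [|a b l l' Rab _ IH] s'' H'; inversion H'; subst.
  by constructor.
constructor; first by exists a; split=> //; left.
apply: Forall2_imp_in (IH _ H3) => b' c _ _ [a' [ia ? ?]].
by exists a'; split=> //; right.
Qed.

Lemma Forall2_ex (A B : Type) (R : A -> B -> Prop) s :
  (forall a, List.In a s -> exists b, R a b) -> exists s', Forall2 R s s'.
Proof.
elim: s => [|a s IH] H; first by exists [::].
have [b Rb] := H a (or_introl erefl).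
have [|s' Hs'] := IH; first by move=> a' ia; apply: H; right.
by exists (b :: s'); constructor.
Qed.

Lemma Forall2_in_l (A B : Type) (R : A -> B -> Prop) s s' a :
  Forall2 R s s' -> List.In a s -> exists2 b, List.In b s' & R a b.
Proof.
elim=> //= x y l l' Rxy _ IH [<-|/IH [b ib Rab]].
  by exists y; [left|].
by exists b; [right|].
Qed.

Lemma all_In (A : Type) (p : pred A) s : all p s -> forall a, List.In a s -> p a.
Proof.
elim: s => //= x s IH /andP[px ps] a [<-//|]; exact: IH.
Qed.

(** With [f] kept outside the recursion, the local fixpoint inside [tmap_opt] is convertible to
    [mapo (tmap_opt F)], which gives that fixpoint a name and a specification. *)
Definition mapo (X Y : Type) (f : X -> option Y) :=
  fix mapo (l : seq X) : option (seq Y) :=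
  if l is x :: r then
    match f x, mapo r with Some y, Some r' => Some (y :: r') | _, _ => None end
  else Some [::].

Lemma mapoP (X Y : Type) (f : X -> option Y) l l' :
  mapo f l = Some l' <-> Forall2 (fun x y => f x = Some y) l l'.
Proof.
elim: l l' => [|x l IH] l' /=.
  by split=> [[<-]|H]; [constructor|inversion H].
case E: (f x) => [y|]; last by split=> // H; inversion H; congruence.
case E': (mapo f l) => [r|].
  split=> [[<-]|H]; first by constructor=> //; apply/IH.
  inversion H; subst; move: H4 => /IH; rewrite E' => -[->]; congruence.
by split=> // H; inversion H; subst; move: H4 => /IH; rewrite E'.
Qed.

(** * Trees with configuration leaves *)

(** Same output nodes, configuration leaves related pairwise. Steps are compared in this form
    because all branches of a step have to be matched at once. *)
Inductive srel (G A B : Type) (R : A -> B -> Prop) :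
    tree (G + A) -> tree (G + B) -> Prop :=
| SOut g ch ch' : Forall2 (srel R) ch ch' ->
    srel R (Node (inl g) ch) (Node (inl g) ch')
| SLeaf a b : R a b -> srel R (Node (inr a) [::]) (Node (inr b) [::]).

Fixpoint wf_leaves (G A : Type) (t : tree (G + A)) : bool :=
  let 'Node a ch := t in
  match a with
  | inl _ => all (@wf_leaves G A) ch
  | inr _ => size ch == 0
  end.

Section Srel.
Variables (G A B : Type).
Implicit Types (R : A -> B -> Prop).

Lemma srel_ind2 R (P : tree (G + A) -> tree (G + B) -> Prop) :
  (forall g ch ch', Forall2 (srel R) ch ch' -> Forall2 P ch ch' ->
     P (Node (inl g) ch) (Node (inl g) ch')) ->
  (forall a b, R a b -> P (Node (inr a) [::]) (Node (inr b) [::])) ->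
  forall t t', srel R t t' -> P t t'.
Proof.
move=> HO HL; fix F 3 => t t' [g ch ch' H|a b Rab]; last exact: HL.
by apply: (HO _ _ _ H); elim: H => *; constructor; auto.
Qed.

Lemma srel_imp_in R (R' : A -> B -> Prop) (t : tree (G + A)) t' :
  (forall a b, List.In a (leaves t) -> List.In b (leaves t') -> R a b -> R' a b) ->
  srel R t t' -> srel R' t t'.
Proof.
move=> H H2; move: H; elim/srel_ind2: t t' / H2 => [g ch ch' _ IH H|a b Rab H].
  constructor; apply: Forall2_imp_in IH => a b ia ib; apply=> a' b' ia' ib'.
  by apply: H; apply/List.in_flat_map; [exists a | exists b].
by constructor; apply: H => //=; left.
Qed.

Lemma srel_leaf_l R (t : tree (G + A)) t' a : srel R t t' ->
  List.In a (leaves t) -> exists2 b, List.In b (leaves t') & R a b.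
Proof.
elim/srel_ind2: t t' / => [g ch ch' _ IH|a' b Rab]; last first.
  by case=> // <-; exists b; first left.
move=> /List.in_flat_map [c [ic ia]].
have [c' ic' /(_ ia) [b ib Rab]] := Forall2_in_l IH ic.
by exists b => //; apply/List.in_flat_map; exists c'.
Qed.

Lemma srel_wf_leaves R (t : tree (G + A)) t' : srel R t t' -> wf_leaves t.
Proof.
elim/srel_ind2: t t' / => [g ch ch' _ IH|//] /=.
by elim: IH => //= x y l l' ->.
Qed.

Lemma srel_ex R (t : tree (G + A)) : wf_leaves t ->
  (forall a, List.In a (leaves t) -> exists b, R a b) ->
  exists t', srel R t t'.
Proof.
elim/tree_nested_ind: t => [[g|a] ch] IH /=; last first.
  case: ch {IH} => // _ /(_ a) [|b Rab]; first by left.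
  by exists (Node (inr b) [::]); constructor.
move=> sh H; have [|ch' Hch] := @Forall2_ex _ _ (srel R) ch.
  move=> c ic; move/List.Forall_forall: IH => /(_ c ic); apply.
    exact: all_In ic.
  by move=> a ia; apply: H; apply/List.in_flat_map; exists c.
by exists (Node (inl g) ch'); constructor.
Qed.

Lemma tmap_opt_node (X Y : Type) (F : X -> option Y) a ch t' :
  tmap_opt F (Node a ch) = Some t' <->
  exists b ch', [/\ F a = Some b, Forall2 (fun c c' => tmap_opt F c = Some c') ch ch'
     & t' = Node b ch'].
Proof.
have -> : tmap_opt F (Node a ch) =
  match F a, mapo (tmap_opt F) ch with
  | Some b, Some ch' => Some (Node b ch') | _, _ => None end by [].
case E: (F a) => [b|]; last by split=> // -[? [? []]].
case E': (mapo (tmap_opt F) ch) => [ch'|].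
  split=> [[<-]|[? [? [[<-]]]]]; first by exists b, ch'; split=> //; apply/mapoP.
  by move=> /mapoP; rewrite E' => -[->] ->.
by split=> // -[? [? [_ /mapoP]]]; rewrite E'.
Qed.

Lemma tmap_optP (F : G + A -> option (G + B)) (f : A -> option B) t t' :
  (forall g, F (inl g) = Some (inl g)) ->
  (forall a, F (inr a) = omap inr (f a)) -> wf_leaves t ->
  tmap_opt F t = Some t' <-> srel (fun a b => f a = Some b) t t'.
Proof.
move=> F1 F2 sh; split.
  elim/tree_nested_ind: t t' sh => [[g|a] ch] IH t' /= sh
    /tmap_opt_node [b [ch' [Fb Hch ->]]].
    move: Fb; rewrite F1 => -[<-]; constructor.
    apply: Forall2_imp_in Hch => c c' ic _.
    by move/List.Forall_forall: IH => /(_ c ic); apply; exact: all_In ic.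
  case: ch sh Hch {IH} => // _ Hch; inversion Hch; subst.
  move: Fb; rewrite F2; case E: (f a) => [b'|] //= [<-].
  by constructor.
move=> H; elim/srel_ind2: t t' / H {sh} => [g ch ch' _ IH|a b Rab].
  by apply/tmap_opt_node; exists (inl g), ch'.
by apply/tmap_opt_node; exists (inr b), [::]; rewrite F2 Rab; split=> //; constructor.
Qed.

End Srel.

Lemma srel_sym (G A B : Type) (R : A -> B -> Prop) (t : tree (G + A)) t' :
  srel R t t' -> srel (fun b a => R a b) t' t.
Proof.
elim/srel_ind2: t t' / => [g ch ch' _ IH|*]; constructor=> //.
exact: Forall2_sym IH.
Qed.

Lemma srel_comp (G A B C : Type) (R : A -> B -> Prop) (R' : A -> C -> Prop)
    (t : tree (G + A)) t' t'' :
  srel R t t' -> srel R' t t'' ->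
  srel (fun b c => exists a, [/\ List.In a (leaves t), R a b & R' a c]) t' t''.
Proof.
move=> H; elim/srel_ind2: t t' / H t'' => [g ch ch' _ IH|a b Rab] t'' H';
  inversion H' as [? ? ? HF|? ? HR]; subst; constructor;
  last by exists a; split=> //; left.
apply: Forall2_imp_in (Forall2_comp IH HF) => b c _ _ [a [ia Hab Hac]].
apply: srel_imp_in (Hab _ Hac) => b' c' _ _ [a' [ia' ? ?]].
by exists a'; split=> //; apply/List.in_flat_map; exists a.
Qed.

Lemma srel_trans (G A B C : Type) (R : A -> B -> Prop) (R' : B -> C -> Prop)
    (t : tree (G + A)) t' t'' :
  srel R t t' -> srel R' t' t'' ->
  srel (fun a c => exists b, [/\ List.In b (leaves t'), R a b & R' b c]) t t''.
Proof. by move=> /srel_sym; exact: srel_comp. Qed.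

Lemma out_wf_leaves (G X : Type) (rk : G -> nat) r (t : tree (G + X * dir)) :
  out_wf rk r t -> wf_leaves t.
Proof.
elim/tree_nested_ind: t => [[g|[x d]] ch] IH /= /andP[H1 H2] //.
elim: IH H2 => //= c l Hc _ IHl /andP[/Hc -> /IHl ->] //.
Qed.

Lemma out_wf_dir (G X : Type) (rk : G -> nat) r (t : tree (G + X * dir)) x i :
  out_wf rk r t -> List.In (x, Some i) (leaves t) -> 0 < i <= r.
Proof.
elim/tree_nested_ind: t => [[g|[y d]] ch] IH /= /andP[H1 H2]; last first.
  by case=> // -[_ E]; move: H2; rewrite E.
move=> /List.in_flat_map [c [ic]].
by move/List.Forall_forall: IH => /(_ c ic); apply; exact: all_In ic.
Qed.

(** * Deterministic branching systems *)

Section Gy.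
Variables (A G : Type) (st : A -> option (tree (G + A))).

(** The index bounds the number of rewriting steps on every branch. Simulations recurse on it, which
    also covers the case that a step of one system is answered by none or by several steps of the
    other. *)
Inductive gyh : nat -> tree (G + A) -> tree G -> Prop :=
| GOut n g ch ch' : Forall2 (gyh n) ch ch' -> gyh n (Node (inl g) ch) (Node g ch')
| GConf n c tau s : st c = Some tau -> gyh n tau s ->
    gyh n.+1 (Node (inr c) [::]) s.

Definition gy t s := exists n, gyh n t s.

Lemma gyh_ind2 (P : nat -> tree (G + A) -> tree G -> Prop) :
  (forall n g ch ch', Forall2 (gyh n) ch ch' -> Forall2 (P n) ch ch' ->
     P n (Node (inl g) ch) (Node g ch')) ->
  (forall n c tau s, st c = Some tau -> gyh n tau s -> P n tau s ->
     P n.+1 (Node (inr c) [::]) s) ->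
  forall n t s, gyh n t s -> P n t s.
Proof.
move=> HO HL; fix F 4 => n t s [n' g ch ch' H|n' c tau s' E H].
  by apply: (HO _ _ _ _ H); elim: H => *; constructor; auto.
by apply: (HL _ _ _ _ E H); exact: F.
Qed.

Lemma gyh_leq n n' t s : n <= n' -> gyh n t s -> gyh n' t s.
Proof.
move=> le H; elim/gyh_ind2: n t s / H n' le => [n g ch ch' _ IH n' le|n c tau s E _ IH [//|n'] le].
  by constructor; apply: Forall2_imp_in IH => a b _ _; apply.
by apply: (GConf E); exact: IH.
Qed.

Lemma gy_out g ch ch' : Forall2 gy ch ch' -> gy (Node (inl g) ch) (Node g ch').
Proof.
move=> H; suff [n Hn] : exists n, Forall2 (gyh n) ch ch' by exists n; constructor.
elim: H => [|a b l l' [n Hn] _ [n' Hn']]; first by exists 0.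
exists (maxn n n'); constructor; first by apply: gyh_leq Hn; exact: leq_maxl.
by apply: Forall2_imp_in Hn' => ? ? _ _; apply: gyh_leq; exact: leq_maxr.
Qed.

Lemma gy_conf c tau s : st c = Some tau -> gy tau s -> gy (Node (inr c) [::]) s.
Proof. by move=> E [n Hn]; exists n.+1; apply: GConf E Hn. Qed.

Fixpoint gchain (c : A) (rest : seq A) : Prop :=
  match rest with
  | [::] => True
  | c' :: r =>
      (exists tau, st c = Some tau /\ List.In c' (leaves tau)) /\ gchain c' r
  end.

Lemma gchain_rcons c rest c' : gchain c (rcons rest c') <->
  gchain c rest /\ exists tau, st (last c rest) = Some tau /\ List.In c' (leaves tau).
Proof. by elim: rest c => [|d r IH] c /=; [tauto|rewrite IH; tauto]. Qed.

End Gy.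

Section Sim.
Variables (A A' G : Type) (st : A -> option (tree (G + A)))
  (st' : A' -> option (tree (G + A'))) (R : A -> A' -> Prop).

Lemma sim_tree n tau tau' s :
  (forall c d s, R c d -> gyh st n (Node (inr c) [::]) s -> gy st' (Node (inr d) [::]) s) ->
  srel R tau tau' -> gyh st n tau s -> gy st' tau' s.
Proof.
move=> H Hr; elim/srel_ind2: tau tau' / Hr s => [g ch ch' _ IH s Hs|a b Rab s]; last exact: H.
inversion Hs as [? ? ? ? HF|]; subst; apply: gy_out.
apply: Forall2_imp_in (Forall2_comp IH HF) => b c _ _ [a [_ Ha]]; exact: Ha.
Qed.

(* A step of the target may be preceded by silent steps of either side: the source
   tree [tau] only has to yield [s] within a smaller height. *)
Lemma sim :
  (forall c d n s, R c d -> gyh st n.+1 (Node (inr c) [::]) s ->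
     exists tau tau', [/\ gyh st n tau s,
       forall s', gy st' tau' s' -> gy st' (Node (inr d) [::]) s' & srel R tau tau']) ->
  forall c d s, R c d -> gy st (Node (inr c) [::]) s -> gy st' (Node (inr d) [::]) s.
Proof.
move=> H c d s Rcd [n Hn]; elim: n c d s Rcd Hn => [|n IH] c d s Rcd Hn.
  by inversion Hn.
have [tau [tau' [H1 H2 H3]]] := H _ _ _ _ Rcd Hn.
by apply: H2; apply: sim_tree H3 H1.
Qed.

Lemma sim_lock :
  (forall c d tau, R c d -> st c = Some tau ->
     exists tau', st' d = Some tau' /\ srel R tau tau') ->
  forall c d s, R c d -> gy st (Node (inr c) [::]) s -> gy st' (Node (inr d) [::]) s.
Proof.
move=> H; apply: sim => c d n s Rcd Hc; inversion Hc as [|? ? tau ? E Ht]; subst.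
have [tau' [E' Hr]] := H _ _ _ Rcd E.
by exists tau, tau'; split=> // s'; exact: gy_conf.
Qed.

Lemma sim_chain :
  (forall c d tau, R c d -> st c = Some tau ->
     exists tau', st' d = Some tau' /\ srel R tau tau') ->
  forall rest c d, R c d -> gchain st c rest ->
  exists rest', gchain st' d rest' /\ Forall2 R rest rest'.
Proof.
move=> H; elim=> [|c' r IH] c d Rcd /=; first by exists [::]; split=> //; constructor.
case=> -[tau [E ic]] Hch; have [tau' [E' Hr]] := H _ _ _ Rcd E.
have [d' id Rcd'] := srel_leaf_l Hr ic.
have [r' [Hr' HF]] := IH _ _ Rcd' Hch.
by exists (d' :: r'); split; [split=> //; exists tau'|constructor].
Qed.

End Sim.

Lemma yieldsP (Sigma Gamma : ranked_alphabet) (H : uTHM Sigma Gamma) t tau s :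
  @yields _ _ H t tau s <-> gy (@step _ _ H t) tau s.
Proof.
split.
  move: tau s; fix F 3 => tau s [g ch ch' HF|C tau' s' E Hy].
    by apply: gy_out; elim: HF => *; constructor; auto.
  by apply: gy_conf E _; exact: F.
case=> n; elim/gyh_ind2: n tau s / => [n g ch ch' _ IH|n c tau s E _ IH].
  by constructor.
exact: YConf E IH.
Qed.

Lemma chainP (Sigma Gamma : ranked_alphabet) (H : uTHM Sigma Gamma) t C rest :
  @chain _ _ H t C rest <-> gchain (@step _ _ H t) C rest.
Proof. by elim: rest C => [|C' r IH] C //=; rewrite IH. Qed.

(** * Nodes and moves *)

Definition setm (M : Type) (mu : seq nat -> M) (u : seq nat) (m : M) :=
  fun v => if v == u then m else mu v.

Lemma setm_id (M : Type) (mu : seq nat -> M) u : setm mu u (mu u) = mu.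
Proof. by apply/funext => v; rewrite /setm; case: eqP => // ->. Qed.

Lemma setm_eq (M : Type) (mu : seq nat -> M) u m : setm mu u m u = m.
Proof. by rewrite /setm eqxx. Qed.

Section Nodes.
Variable A : Type.
Implicit Types t : tree A.

Lemma subt_cat t u v :
  subt t (u ++ v) = if subt t u is Some t' then subt t' v else None.
Proof.
elim: u t => [|i u IH] [a ch] //=; case: i => // i.
by case: (List.nth_error ch i).
Qed.

Lemma is_node_rcons t u i : is_node t (rcons u i) -> is_node t u.
Proof. by rewrite /is_node -cats1 subt_cat; case: (subt t u). Qed.

Lemma labP t u : is_node t u <-> exists a, lab t u = Some a.
Proof.
rewrite /is_node /lab; case: (subt t u) => [[a ch]|]; split=> //; last by case.
by move=> _; exists a.
Qed.

Lemma subt_rcons t u i a ch : subt t u = Some (Node a ch) ->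
  subt t (rcons u i) = if i is j.+1 then List.nth_error ch j else None.
Proof.
move=> E; rewrite -cats1 subt_cat E /=; case: i => // j.
by case: (List.nth_error ch j).
Qed.

Lemma lab_subt t u a : lab t u = Some a -> exists ch, subt t u = Some (Node a ch).
Proof. by rewrite /lab; case: (subt t u) => [[b ch]|] // [->]; exists ch. Qed.

Lemma nth_error_size (T : Type) (s : seq T) i : isSome (List.nth_error s i) = (i < size s).
Proof. by elim: s i => [|x s IH] [|i] //=. Qed.

Variable rk : A -> nat.

Lemma wf_subt t u t' : wf_tree rk t -> subt t u = Some t' -> wf_tree rk t'.
Proof.
elim: u t => [|i u IH] [a ch] //=; first by move=> W [<-].
case: i => // i /andP[_ W]; case E: (List.nth_error ch i) => [c|] //.
by apply: IH; apply: (all_In W); exact: List.nth_error_In E.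
Qed.

Lemma wf_child t u a i : wf_tree rk t -> lab t u = Some a ->
  is_node t (rcons u i) = (0 < i <= rk a).
Proof.
move=> W /lab_subt [ch E]; have /= /andP[/eqP sz _] := wf_subt W E.
rewrite /is_node (subt_rcons _ E); case: i => //= i.
by rewrite nth_error_size sz.
Qed.

End Nodes.

Section Moves.
Variable Sigma : ranked_alphabet.
Implicit Types t : tree (ra_sym Sigma).

Lemma move_up t u i : move t (rcons u i) None = Some u.
Proof.
rewrite /= size_rcons /= -cats1 take_size_cat //.
by case: u.
Qed.

Lemma move_upP t u v : move t u None = Some v -> exists i, u = rcons v i.
Proof. by case/lastP: u => // u i; rewrite move_up => -[<-]; exists i. Qed.

Lemma move_down t u i v : move t u (Some i) = Some v <-> v = rcons u i /\ is_node t v.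
Proof.
rewrite /=; case: ifP => E; split=> //; first by case=> <-.
  by case=> ->.
by case=> ->; rewrite E.
Qed.

Lemma move_node t u d v : is_node t u -> move t u d = Some v -> is_node t v.
Proof.
case: d => [i _ /move_down[]|] // nu /move_upP [i E].
by move: nu; rewrite E; exact: is_node_rcons.
Qed.

End Moves.

Section StepP.
Variables (Sigma Gamma : ranked_alphabet) (M : uTHM Sigma Gamma).

Lemma stepP t u q (mu : seq nat -> hM M) tau' :
  step t (u, q, mu) = Some tau' <->
  exists a tau, [/\ lab t u = Some a, hdelta M q a (mu u) = Some tau &
    srel (fun x C => exists2 v, move t u x.2 = Some v &
       C = (v, x.1.1, setm mu u x.1.2)) tau tau'].
Proof.
rewrite /step; case: (lab t u) => [a|]; last by split=> // -[? [? []]].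
case E: (hdelta M q a (mu u)) => [tau|]; last by split=> // -[? [? [[<-]]]]; rewrite E.
pose f (x : hQ M * hM M * dir) : option (config M) :=
  omap (fun v => (v, x.1.1, setm mu u x.1.2)) (move t u x.2).
rewrite (@tmap_optP _ _ _ _ f) //; first last.
- by apply: out_wf_leaves; exact: hdelta_wf E.
- by move=> [[q' m'] d]; rewrite /f /=; case: (move t u d).
have fP x C : f x = Some C <-> exists2 v, move t u x.2 = Some v &
   C = (v, x.1.1, setm mu u x.1.2).
  rewrite /f; case: (move t u x.2) => [v|]; split=> //=; try by case.
  - by case=> <-; exists v.
  - by case=> v' [<-] ->.
split.
  move=> H; exists a, tau; split=> //.
  by apply: srel_imp_in H => x C _ _ /fP.
case=> a' [tau2 [[<-]]]; rewrite E => -[<-] H.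
by apply: srel_imp_in H => x C _ _ H; apply/fP.
Qed.

End StepP.
Arguments step : simpl never.
Arguments move : simpl never.

(** * Machines that never try to leave the root upwards *)

Fixpoint smap (G A B : Type) (f : A -> B) (t : tree (G + A)) : tree (G + B) :=
  let 'Node x ch := t in
  Node (match x with inl g => inl g | inr a => inr (f a) end) (map (smap f) ch).

Lemma smap_srel (G A B : Type) (f : A -> B) (t : tree (G + A)) :
  wf_leaves t -> srel (fun a b => b = f a) t (smap f t).
Proof.
elim/tree_nested_ind: t => [[g|a] ch] IH /=; last first.
  by case: ch IH => //= _ _; constructor.
move=> sh; constructor; elim: IH sh => //= c l Hc _ IHl /andP[/Hc ? /IHl ?].
by constructor.
Qed.

Definition vdir (r : nat) (d : dir) : bool :=
  if d is Some i then (0 < i) && (i <= r) else true.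

Lemma srel_out_wf (G X Y : Type) (rk : G -> nat) r r' (R : X * dir -> Y * dir -> Prop)
    t t' : srel R t t' -> out_wf rk r t ->
  (forall b, List.In b (leaves t') -> vdir r' b.2) -> out_wf rk r' t'.
Proof.
move=> H; elim/srel_ind2: t t' / H => [g ch ch' HF IH /= /andP[sz Hch] H|a [y d] _ _ H /=].
  rewrite -(Forall2_size HF) sz /=.
  elim: {HF sz} IH Hch H => //= c c' l l' Hc _ IHl /andP[Wc Wl] H.
  apply/andP; split.
    by apply: Hc => // b ib; apply: H; apply/List.in_or_app; left.
  by apply: IHl => // b ib; apply: H; apply/List.in_or_app; right.
by move: (H (y, d)) => /(_ (or_introl erefl)).
Qed.

Definition has_up (G X : Type) (t : tree (G + X * dir)) :=
  has (fun x : X * dir => ~~ isSome x.2) (leaves t).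

Lemma has_upP (G X : Type) (t : tree (G + X * dir)) :
  has_up t <-> exists x, List.In (x, None) (leaves t).
Proof.
rewrite /has_up; elim: (leaves t) => [|[x [d|]] s IH] /=.
- by split=> // -[].
- split=> [/IH [y iy]|[y [//|iy]]]; first by exists y; right.
  by apply/IH; exists y.
- by split=> // _; exists x; left.
Qed.

(** A [step] is undefined as soon as one leaf of its output leaves the tree. Once outputs are
    emitted symbol by symbol, or erased nodes are put above the root, such a failure would show only
    later and on one branch, and the other branches would be chains without a corresponding run.
    Legality excludes this at reachable configurations. *)
Definition legal (Sigma Gamma : ranked_alphabet) (M : uTHM Sigma Gamma) :=
  forall t rest q mu a tau, gchain (step t) (init_config M) rest ->
    last (init_config M) rest = ([::], q, mu) -> lab t [::] = Some a ->
    hdelta M q a (mu [::]) = Some tau -> ~~ has_up tau.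

Section Norm.
Variables (Sigma Gamma : ranked_alphabet) (M : uTHM Sigma Gamma).

(* The state flag marks the very first configuration, the memory flag marks
   the root from then on. *)
Definition norm_delta (q : hQ M * bool) (a : ra_sym Sigma) (m : hM M * bool) :=
  if hdelta M q.1 a m.1 is Some tau then
    if (q.2 || m.2) && has_up tau then None
    else Some (smap (fun x : hQ M * hM M * dir =>
           ((x.1.1, false), (x.1.2, q.2 || m.2), x.2)) tau)
  else None.

Lemma norm_wf q a m tau : norm_delta q a m = Some tau ->
  out_wf (ra_rank Gamma) (ra_rank Sigma a) tau.
Proof.
rewrite /norm_delta; case E: (hdelta M _ _ _) => [tau0|] //; case: ifP => // _ [<-].
have W := hdelta_wf E; have S := smap_srel (fun x : hQ M * hM M * dir =>
           ((x.1.1, false), (x.1.2, q.2 || m.2), x.2)) (out_wf_leaves W).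
apply: (srel_out_wf S W) => b /(srel_leaf_l (srel_sym S)) [[x [i|]] ia ->] //=.
exact: (out_wf_dir W ia).
Qed.

Definition norm : uTHM Sigma Gamma :=
  @UTHM Sigma Gamma (hQ M * bool)%type (hM M * bool)%type (htop M, false)
    (hqinit M, true) norm_delta norm_wf.

Definition norm_rel (C' : config norm) (C : config M) : Prop :=
  let '(u', q', mu') := C' in let '(u, q, mu) := C in
  [/\ u' = u, q'.1 = q, forall v, (mu' v).1 = mu v &
    if q'.2 then u = [::] /\ forall v, (mu' v).2 = false
    else forall v, (mu' v).2 = (v == [::])].

Lemma norm_flag u q' mu' C : norm_rel (u, q', mu') C -> q'.2 || (mu' u).2 = (u == [::]).
Proof.
move: C => [[u0 q] mu] [-> _ _]; case: ifP => _ /=; last by move->.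
by case=> ->.
Qed.

Lemma norm_leaf u q' mu' q mu (x : hQ M * hM M * dir) v : norm_rel (u, q', mu') (u, q, mu) ->
  norm_rel (v, (x.1.1, false), setm mu' u (x.1.2, u == [::])) (v, x.1.1, setm mu u x.1.2).
Proof.
case=> _ Eq Em Hf; split=> //= w; rewrite /setm; case: eqP => // ne; first by rewrite ne.
by move: Hf; case: ifP => // _ [E ->]; move: ne; rewrite E => /eqP/negbTE ->.
Qed.

Lemma norm_step_l t C' C tau' : norm_rel C' C -> step t C' = Some tau' ->
  exists tau, step t C = Some tau /\ srel norm_rel tau' tau.
Proof.
move: C' C => [[u' q'] mu'] [[u q] mu] HR; have Hf := norm_flag HR.
have [Eu Eq Em _] := HR; subst u' q.
move=> /stepP [a [tau1 [La]]] /=; rewrite /norm_delta Em.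
case E: (hdelta M _ _ _) => [tau0|] //; rewrite Hf.
case: ifP => // Hup [<-] S1.
have S0 := smap_srel (fun x : hQ M * hM M * dir =>
           ((x.1.1, false), (x.1.2, u == [::]), x.2)) (out_wf_leaves (hdelta_wf E)).
have S2 := srel_trans S0 S1.
have [|tau S3] := @srel_ex _ _ _ (fun x C => exists2 v, move t u x.2 = Some v &
       C = (v, x.1.1, setm mu u x.1.2)) tau0 (out_wf_leaves (hdelta_wf E)).
  move=> x ix; have [C' iC' [y [iy -> [v Hm _]]]] := srel_leaf_l S2 ix.
  by exists (v, x.1.1, setm mu u x.1.2); exists v.
exists tau; split; first by apply/stepP; exists a, tau0.
apply: srel_imp_in (srel_comp S2 S3) => C' C _ _ [x [ix [y [_ -> [v /= Hm ->]]] [v' Hm' ->]]].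
move: Hm'; rewrite Hm => -[<-]; exact: (norm_leaf x v HR).
Qed.

Lemma norm_step_r t C' C tau : norm_rel C' C -> step t C = Some tau ->
  exists tau', step t C' = Some tau' /\ srel norm_rel tau' tau.
Proof.
move: C' C => [[u' q'] mu'] [[u q] mu] HR; have Hf := norm_flag HR.
have [Eu Eq Em _] := HR; subst u' q.
move=> /stepP [a [tau0 [La E S]]].
have S0 := smap_srel (fun x : hQ M * hM M * dir =>
           ((x.1.1, false), (x.1.2, u == [::]), x.2)) (out_wf_leaves (hdelta_wf E)).
have Hup : (u == [::]) && has_up tau0 = false.
  apply/negP => /andP[/eqP Eu /has_upP [x ix]].
  by have [C _ [v]] := srel_leaf_l S ix; rewrite Eu.
have [|tau' S3] := @srel_ex _ _ _ (fun x (C : config norm) => exists2 v, move t u x.2 = Some v &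
       C = (v, x.1.1, setm mu' u x.1.2)) _ (srel_wf_leaves (srel_sym S0)).
  move=> y iy; have [x ix ->] := srel_leaf_l (srel_sym S0) iy.
  have [C _ [v Hm _]] := srel_leaf_l S ix.
  by exists (v, (x.1.1, false), setm mu' u (x.1.2, u == [::])); exists v.
exists tau'; split.
  apply/stepP; exists a, (smap (fun x : hQ M * hM M * dir =>
           ((x.1.1, false), (x.1.2, u == [::]), x.2)) tau0); split=> //=.
  by rewrite /norm_delta Em E Hf Hup.
apply: srel_imp_in (srel_comp (srel_trans S0 S3) S) =>
  C' C _ _ [x [ix [y [_ -> [v /= Hm ->]]] [v' Hm' ->]]].
move: Hm'; rewrite Hm => -[<-]; exact: (norm_leaf x v HR).
Qed.

Lemma norm_init : norm_rel (init_config norm) (init_config M).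
Proof. by []. Qed.

Lemma norm_sem t r : sem norm t r <-> sem M t r.
Proof.
rewrite /sem !yieldsP; split.
  by apply: (@sim_lock _ _ _ _ _ norm_rel) norm_init => C' C tau'; exact: norm_step_l.
apply: (@sim_lock _ _ _ _ _ (fun C C' => norm_rel C' C)) norm_init => C C' tau HR E.
have [tau' [E' S]] := norm_step_r HR E.
by exists tau'; split=> //; exact: srel_sym.
Qed.

Lemma norm_run t rest : gchain (step t) (init_config norm) rest ->
  exists rest', gchain (step t) (init_config M) rest' /\ Forall2 norm_rel rest rest'.
Proof.
by apply: sim_chain norm_init => C' C tau'; exact: norm_step_l.
Qed.

Lemma Forall2_last (A B : Type) (R : A -> B -> Prop) s s' a b :
  R a b -> Forall2 R s s' -> R (last a s) (last b s').
Proof. by move=> Rab H; elim: H a b Rab => //= x y l l' Rxy _ IH a b _; exact: IH. Qed.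

Lemma norm_legal : legal norm.
Proof.
move=> t rest q mu a tau /norm_run [rest' [_ HF]] El La /=.
have := Forall2_last norm_init HF; rewrite El => /norm_flag Hf.
rewrite /norm_delta; case E: (hdelta M _ _ _) => [tau0|] //.
rewrite Hf eqxx /=; case: ifP => // Hup [<-]; apply/negP => /has_upP [x ix].
have S := smap_srel (fun x : hQ M * hM M * dir =>
           ((x.1.1, false), (x.1.2, true), x.2)) (out_wf_leaves (hdelta_wf E)).
have [[y d] iy [_ Ed]] := srel_leaf_l (srel_sym S) ix.
have: has_up tau0 by apply/has_upP; exists y; rewrite Ed.
by rewrite Hup.
Qed.

Lemma norm_pos rest rest' : Forall2 norm_rel rest rest' ->
  map (@cpos _ _ norm) rest = map (@cpos _ _ M) rest'.
Proof. by elim=> //= [[[u' q'] mu'] [[u q] mu]] l l' [-> _ _ _] _ ->. Qed.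

End Norm.

Lemma visits_map (Sigma Gamma : ranked_alphabet) (M : uTHM Sigma Gamma)
  (cs : seq (config M)) S : visits cs S = count (mem S) (map (@cpos _ _ M) cs).
Proof. by rewrite count_map. Qed.

Lemma is_runP (Sigma Gamma : ranked_alphabet) (M : uTHM Sigma Gamma) t cs :
  is_run t cs <-> exists2 rest, cs = init_config M :: rest &
     gchain (step t) (init_config M) rest.
Proof.
case: cs => [|C rest] /=; first by split=> // -[].
split=> [[-> /chainP Hc]|[r [-> ->] /chainP Hc]] //.
by exists rest.
Qed.

Lemma norm_narrow (Sigma Gamma : ranked_alphabet) (M : uTHM Sigma Gamma) L :
  narrow_visit_on M L -> narrow_visit_on (norm M) L.
Proof.
case=> n Hn; exists n => t Lt cs /is_runP [rest -> Hc] S aS nS.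
have [rest' [Hc' HF]] := norm_run Hc.
rewrite visits_map (_ : map _ _ = map (@cpos _ _ M) (init_config M :: rest')).
  by rewrite -visits_map; apply: Hn Lt _ _ _ aS nS; apply/is_runP; exists rest'.
by rewrite /= (norm_pos HF).
Qed.

Lemma norm_bounded (Sigma Gamma : ranked_alphabet) (M : uTHM Sigma Gamma) L :
  bounded_visit_on M L -> bounded_visit_on (norm M) L.
Proof.
case=> n Hn; exists n => t Lt cs /is_runP [rest -> Hc] u.
have [rest' [Hc' HF]] := norm_run Hc.
rewrite visits_map (_ : map _ _ = map (@cpos _ _ M) (init_config M :: rest')).
  by rewrite -visits_map; apply: Hn Lt _ _ _; apply/is_runP; exists rest'.
by rewrite /= (norm_pos HF).
Qed.

(** On a well-ranked tree child moves succeed by [hdelta_wf], and legality rules out the only other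
    failure. So definedness of [hdelta] alone decides whether a reachable configuration has a
    step. *)
Lemma legal_step (Sigma Gamma : ranked_alphabet) (M : uTHM Sigma Gamma) t rest
    u q (mu : seq nat -> hM M) a tau :
  legal M -> wf_tree (ra_rank Sigma) t ->
  gchain (step t) (init_config M) rest -> last (init_config M) rest = (u, q, mu) ->
  lab t u = Some a -> hdelta M q a (mu u) = Some tau ->
  (forall x, List.In x (leaves tau) -> exists v, move t u x.2 = Some v) /\
  exists2 tau', step t (u, q, mu) = Some tau' &
    srel (fun x C => exists2 v, move t u x.2 = Some v &
       C = (v, x.1.1, setm mu u x.1.2)) tau tau'.
Proof.
move=> leg W Hc El La E.
have Hm x : List.In x (leaves tau) -> exists v, move t u x.2 = Some v.
  case: x => x [i|] ix; rewrite /move /=.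
    exists (rcons u i); rewrite (wf_child _ W La).
    by rewrite (out_wf_dir (hdelta_wf E) ix).
  case: u El La E => [|k u] El La E; last by eexists.
  have := leg _ _ _ _ _ _ Hc El La E.
  by move/negP; case; apply/has_upP; exists x.
split=> //; have [|tau' S] := @srel_ex _ _ _ (fun x C => exists2 v, move t u x.2 = Some v &
       C = (v, x.1.1, setm mu u x.1.2)) tau (out_wf_leaves (hdelta_wf E)).
  by move=> x /Hm [v Hv]; exists (v, x.1.1, setm mu u x.1.2); exists v.
by exists tau' => //; apply/stepP; exists a, tau.
Qed.

(** * One-symbol-per-step systems and their computation trees *)

(* [None] stays at the current node. *)
Definition xdir := option dir.

Definition xmove (Sigma : ranked_alphabet) (t : tree (ra_sym Sigma)) u (d : xdir) :=
  if d is Some d' then move t u d' else Some u.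

(** One symbol per step, one successor per child: a node of the output corresponds to a
    configuration, and the path to it is a run. *)
Record bsys (Sigma : ranked_alphabet) (G : Type) := BSys {
  bQ : finType;
  bM : finType;
  btop : bM;
  binit : bQ;
  bact : bQ -> ra_sym Sigma -> bM -> option (G * seq (bQ * bM * xdir)) }.
Arguments bact {Sigma G} b _ _ _.

Section Bsys.
Variables (Sigma : ranked_alphabet) (G : Type) (W : bsys Sigma G).
Variable t : tree (ra_sym Sigma).

Definition bconf : Type := ((seq nat * bQ W) * (seq nat -> bM W))%type.

Definition bini : bconf := ([::], binit W, fun _ => btop W).

Definition cstep (c : bconf) : option (G * seq bconf) :=
  let '(u, p, mu) := c in
  if lab t u is Some a then
    if bact W p a (mu u) is Some (g, ks) then
      omap (pair g) (mapo (fun x => omap (fun v => (v, x.1.1, setm mu u x.1.2))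
         (xmove t u x.2)) ks)
    else None
  else None.

Lemma cstepP u p mu g cs : cstep (u, p, mu) = Some (g, cs) <->
  exists a ks, [/\ lab t u = Some a, bact W p a (mu u) = Some (g, ks) &
    Forall2 (fun x C => exists2 v, xmove t u x.2 = Some v &
      C = (v, x.1.1, setm mu u x.1.2)) ks cs].
Proof.
have fP x (C : bconf) : omap (fun v => (v, x.1.1, setm mu u x.1.2)) (xmove t u x.2) = Some C
   <-> exists2 v, xmove t u x.2 = Some v & C = (v, x.1.1, setm mu u x.1.2).
  case: (xmove t u x.2) => [v|]; split=> //=; try by case.
  - by case=> <-; exists v.
  - by case=> v' [<-] ->.
rewrite /cstep; case: (lab t u) => [a|]; last by split=> // -[? [? []]].
case E: (bact W p a (mu u)) => [[g' ks]|]; last by split=> // -[? [? [[<-]]]]; rewrite E.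
split.
  case E': (mapo _ ks) => [cs'|] //= [<- <-]; exists a, ks; split=> //.
  by move/mapoP: E'; apply: Forall2_imp_in => x C _ _ /fP.
case=> a' [ks' [[<-]]]; rewrite E => -[-> <-] HF.
have/mapoP -> //: Forall2 (fun x C =>
   omap (fun v => (v, x.1.1, setm mu u x.1.2)) (xmove t u x.2) = Some C) ks cs.
by apply: Forall2_imp_in HF => x C _ _ /fP.
Qed.

Inductive unf : bconf -> tree G -> Prop :=
| Unf c g cs ss : cstep c = Some (g, cs) -> Forall2 unf cs ss -> unf c (Node g ss).

Fixpoint bchain (c : bconf) (rest : seq bconf) : Prop :=
  match rest with
  | [::] => True
  | c' :: r => (exists g cs, cstep c = Some (g, cs) /\ List.In c' cs) /\ bchain c' r
  end.

Lemma bchain_rcons c rest c' : bchain c (rcons rest c') <->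
  bchain c rest /\ exists g cs, cstep (last c rest) = Some (g, cs) /\ List.In c' cs.
Proof. by elim: rest c => [|d r IH] c /=; [tauto|rewrite IH; tauto]. Qed.

End Bsys.
Arguments cstep : simpl never.

(** * Cutting transition outputs into single symbols *)

Inductive erases (G : Type) : tree (option G) -> tree G -> Prop :=
| ErasesSkip c s : erases c s -> erases (Node None [:: c]) s
| ErasesOut g ch ch' : Forall2 (@erases G) ch ch' -> erases (Node (Some g) ch) (Node g ch').

(** Equality and choice are classical here; they make membership in lists of trees and the finite
    type [seq_sub] available for arbitrary labels. *)
HB.instance Definition _ (A : Type) := gen_eqMixin (tree A).
HB.instance Definition _ (A : Type) := gen_choiceMixin (tree A).

Fixpoint subtrees (A : Type) (t : tree A) : seq (tree A) :=
  let 'Node _ ch := t in t :: flatten (map (@subtrees A) ch).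

Fixpoint height (A : Type) (t : tree A) : nat :=
  let 'Node _ ch := t in foldr maxn 0 (map (fun c => (height c).+1) ch).

Lemma height_child (A : Type) (a : A) ch c : c \in ch -> height c < height (Node a ch).
Proof.
rewrite /=; elim: ch => //= d ch IH; rewrite inE => /orP[/eqP ->|/IH]; rewrite leq_max.
  by rewrite leqnn.
by move=> ->; rewrite orbT.
Qed.

Lemma subtrees_refl (A : Type) (t : tree A) : t \in subtrees t.
Proof. by case: t => a ch; rewrite inE eqxx. Qed.

Lemma InP (T : eqType) (x : T) s : List.In x s <-> x \in s.
Proof.
elim: s => [|y s IH] /=; first by rewrite in_nil.
by rewrite inE; split=> [[->|/IH ->]|/orP[/eqP ->|/IH]]; rewrite ?eqxx ?orbT; auto.
Qed.

Lemma subtrees_child (A : Type) (t : tree A) a ch c :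
  Node a ch \in subtrees t -> c \in ch -> c \in subtrees t.
Proof.
elim/tree_nested_ind: t => b dh IH; rewrite /= inE => /orP[/eqP [_ <-] ic|H ic].
  rewrite inE; apply/orP; right; apply/flattenP; exists (subtrees c).
    exact: map_f.
  exact: subtrees_refl.
rewrite inE; apply/orP; right; move/flattenP: H => [l /mapP [d id ->] Hd].
apply/flattenP; exists (subtrees d); first exact: map_f.
by move/List.Forall_forall: IH => /(_ d); apply=> //; apply/InP.
Qed.

Section StepA.
Variables (Sigma Gamma : ranked_alphabet) (H : uTHM Sigma Gamma).
Local Notation oT := (tree (ra_sym Gamma + (hQ H * hM H) * dir)).

Definition out_subtrees : seq oT :=
  flatten [seq (if hdelta H x.1.1 x.1.2 x.2 is Some tau then subtrees tau else [::])
     | x <- enum {: hQ H * ra_sym Sigma * hM H}].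

Lemma delta_subtrees q a m tau : hdelta H q a m = Some tau ->
  {subset subtrees tau <= out_subtrees}.
Proof.
move=> E c ic; apply/flattenP; exists (subtrees tau) => //.
by apply/mapP; exists (q, a, m); rewrite ?mem_enum //= E.
Qed.

Lemma out_subtreesP c : c \in out_subtrees -> exists q a m tau,
  hdelta H q a m = Some tau /\ c \in subtrees tau.
Proof.
move=> /flattenP [l /mapP [[[q a] m] _ ->]] /=.
by case E: (hdelta H q a m) => [tau|] // ic; exists q, a, m, tau.
Qed.

Lemma out_subtrees_child a ch c : Node a ch \in out_subtrees -> c \in ch ->
  c \in out_subtrees.
Proof.
by move=> /out_subtreesP [q [b [m [tau [E it]]]]] /(subtrees_child it) /(delta_subtrees E).
Qed.

Lemma out_subtrees_wf c : c \in out_subtrees ->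
  exists r, out_wf (ra_rank Gamma) r c.
Proof.
move=> /out_subtreesP [q [a [m [tau [/hdelta_wf wf ic]]]]]; exists (ra_rank Sigma a).
elim/tree_nested_ind: tau wf ic => [x ch] IH wf; rewrite /= inE => /orP[/eqP ->//|].
move=> /flattenP [l /mapP [d id ->]]; move/List.Forall_forall: IH => /(_ d); apply.
  exact/InP.
by case: x wf id => [g /= /andP[_ /allP]|[y e] /= /andP[/nilP ->]] //; apply.
Qed.

(** The additional states are the parts of transition outputs that are still to be emitted; they are
    subtrees of finitely many finite trees. *)
Definition wQ : finType := (hQ H + seq_sub out_subtrees)%type.

(** The default value is a placeholder for trees outside [out_subtrees], which never arise from
    [resolve]. *)
Definition to_state (c : oT) : wQ :=
  if insub c is Some x then inr x else inl (hqinit H).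

Definition resolve (st : wQ) (a : ra_sym Sigma) (m : hM H) : option oT :=
  match st with inl q => hdelta H q a m | inr x => Some (ssval x) end.

(** During the emission the memory keeps its value from before the step: the new memory belongs to a
    leaf and may differ from leaf to leaf, so it is written only when a leaf is reached. *)
Definition emit (m : hM H) (tau : oT) :
    option (ra_sym Gamma) * seq (wQ * hM H * xdir) :=
  match tau with
  | Node (inl g) ch => (Some g, [seq (to_state c, m, None) | c <- ch])
  | Node (inr (q, m', d)) _ => (None, [:: (inl q, m', Some d)])
  end.

Definition flat : bsys Sigma (option (ra_sym Gamma)) :=
  @BSys Sigma (option (ra_sym Gamma)) wQ (hM H) (htop H) (inl (hqinit H))
    (fun st a m => omap (emit m) (resolve st a m)).

Lemma resolve_to_state c a m : c \in out_subtrees -> resolve (to_state c) a m = Some c.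
Proof. by move=> ic; rewrite /to_state insubT. Qed.

Lemma resolve_sub st a m tau : resolve st a m = Some tau -> tau \in out_subtrees.
Proof.
case: st => [q /= E|[x ix] [<-]] //.
exact: (delta_subtrees E (subtrees_refl _)).
Qed.

Definition orank (g : option (ra_sym Gamma)) := if g is Some g' then ra_rank Gamma g' else 1.

Lemma flat_rank st a m g ks : bact flat st a m = Some (g, ks) -> size ks = orank g.
Proof.
rewrite /=; case E: (resolve st a m) => [tau|] //= [].
have [r] := out_subtrees_wf (resolve_sub E).
case: tau {E} => [[g'|[[q m'] d]] ch] /=; last by move=> _ [<- <-].
by case/andP => /eqP sz _ [<- <-]; rewrite size_map.
Qed.

Variable t : tree (ra_sym Sigma).

Definition mv u (mu : seq nat -> hM H) (x : hQ H * hM H * dir) (C : config H) :=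
  exists2 v, move t u x.2 = Some v & C = (v, x.1.1, setm mu u x.1.2).

(** Stated for an arbitrary output [tau] pending at [u], of which [tau'] is the instantiated form;
    only then does the induction pass through output nodes as well as through configuration
    leaves. *)
Lemma yields_unf n tau' s : gyh (step t) n tau' s -> forall u mu st a tau,
  lab t u = Some a -> resolve st a (mu u) = Some tau -> srel (mv u mu) tau tau' ->
  exists s1, unf t ((u, st, mu) : bconf flat) s1 /\ erases s1 s.
Proof.
elim/gyh_ind2: n tau' s / => [n g ch' ch'' _ IH|n C tau2 s E _ IH] u mu st a tau La Rs S.
  inversion S as [? ch ? HF|]; subst.
  have it := resolve_sub Rs.
  have : Forall2 (fun c s => exists s1,
       unf t ((u, to_state c, mu) : bconf flat) s1 /\ erases s1 s) ch ch''.
    have := Forall2_comp (Forall2_sym HF) IH.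
    apply: Forall2_imp_in => c s /InP ic _ [c' [_ Hc]] /(_ u mu (to_state c) a c La).
    by apply=> //; rewrite resolve_to_state //; exact: out_subtrees_child it ic.
  move=> H2; have [ss [Hu He]] : exists ss,
      Forall2 (unf t) [seq ((u, to_state c, mu) : bconf flat) | c <- ch] ss /\
      Forall2 (@erases _) ss ch''.
    elim: H2 => [|c s l l' [s1 [Us Es]] _ [ss [H1 H2]]]; first by exists [::].
    by exists (s1 :: ss); split; constructor.
  exists (Node (Some g) ss); split; last by constructor.
  apply: Unf Hu; apply/cstepP; exists a, [seq (to_state c, mu u, None) | c <- ch].
  split=> //=; first by rewrite Rs.
  elim: {+}ch => [|c l IHl] //=; constructor=> //.
  by exists u => //=; rewrite setm_id.
inversion S as [|[[q m] d] ? [v Hv EC]]; subst => {S}.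
move: E => /stepP [a' [tau3 [La' E' S']]].
have [s1 [Us Es]] := IH v (setm mu u m) (inl q) a' tau3 La' E' S'.
exists (Node None [:: s1]); split; last by constructor.
apply: Unf (List.Forall2_cons _ _ Us (List.Forall2_nil _)).
apply/cstepP; exists a, [:: (inl q, m, Some d)]; split=> //=; first by rewrite Rs.
by constructor=> //; exists v.
Qed.

Lemma unf_yields s1 : forall s u mu st a tau,
  lab t u = Some a -> resolve st a (mu u) = Some tau ->
  unf t ((u, st, mu) : bconf flat) s1 -> erases s1 s ->
  exists2 tau', srel (mv u mu) tau tau' & gy (step t) tau' s.
Proof.
elim/tree_nested_ind: s1 => g ss IH s u mu st a tau La Rs Us Es.
inversion Us as [? ? cs ? Ec HF]; subst.
have [a' [ks [La' Ek HK]]] := (cstepP _ _ _ _ _ _).1 Ec.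
move: La' Ek; rewrite La => -[<-] /=; rewrite Rs /= => -[].
have it := resolve_sub Rs; have [r wf] := out_subtrees_wf it.
case: tau it wf {Rs} => [[g'|[[q m] d]] ch] it wf /= [Eg Eks]; subst g ks.
  inversion Es as [|? ? ch'' HE]; subst.
  have H1 : Forall2 (fun c s => exists2 tau', srel (mv u mu) c tau' & gy (step t) tau' s) ch ch''.
    have HK' : Forall2 (fun c C => C = ((u, to_state c, mu) : bconf flat)) ch cs.
      elim: ch cs HK {it wf Ec HF} => [|c ch IHch] cs HK; inversion HK as [|? C ? cs' [v Hv EC] HK'];
        subst; constructor; last exact: IHch.
      by move: Hv; rewrite setm_id => -[<-].
    have HF' := Forall2_comp (Forall2_sym HK') HF.
    have HF2 := Forall2_comp (Forall2_sym HF') HE.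
    apply: Forall2_imp_in HF2 => c s /InP ic _ [s1 [is1 [C [_ EC Us1]] Es1]]; subst C.
    move/List.Forall_forall: IH => /(_ s1 is1 s u mu (to_state c) a c La); apply=> //.
    by rewrite resolve_to_state //; exact: out_subtrees_child it ic.
  have [ch' [Hs Hg]] : exists ch', Forall2 (srel (mv u mu)) ch ch' /\ Forall2 (gy (step t)) ch' ch''.
    elim: H1 => [|c s l l' [x Sx Gx] _ [xs [H1 H2]]]; first by exists [::].
    by exists (x :: xs); split; constructor.
  by exists (Node (inl g') ch'); [constructor|exact: gy_out].
case: ch wf it => // _ _.
inversion HK as [|? C ? cs' [v Hv EC] HK']; subst; inversion HK'; subst.
inversion HF as [|? s1 ? ss' Us1 HF']; subst; inversion HF'; subst.
inversion Es as [? ? Es1|]; subst.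
inversion Us1 as [? g cs1 ss1 Ec1 HF1]; subst.
have [a1 [ks1 [La1]]] := (cstepP _ _ _ _ _ _).1 Ec1.
rewrite /=; case E1: (hdelta H q a1 _) => [tau1|] //= _ _.
have IH' := proj1 (List.Forall_forall _ _) IH _ (or_introl erefl).
have [tau1' S1 G1] := IH' s v (setm mu u m) (inl q) a1 tau1 La1 E1 Us1 Es1.
exists (Node (inr (v, q, setm mu u m)) [::]); first by constructor; exists v.
by apply: gy_conf G1; apply/stepP; exists a1, tau1.
Qed.

Lemma flat_sem s : sem H t s <-> exists s1, unf t (bini flat) s1 /\ erases s1 s.
Proof.
rewrite /sem yieldsP; split.
  case=> n Hn; inversion Hn as [|? ? tau' ? Est Hg]; subst.
  move/stepP: Est => [a [tau [La E S]]].
  exact: (yields_unf Hg La (st := inl (hqinit H)) E S).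
case=> s1 [Us Es]; inversion Us as [? g cs ss Ec HF]; subst.
have [a [ks [La]]] := (cstepP _ _ _ _ _ _).1 Ec.
rewrite /=; case E: (hdelta H _ _ _) => [tau|] //= _ _.
have [tau' S Hg] := unf_yields La (st := inl (hqinit H)) E Us Es.
by apply: gy_conf Hg; apply/stepP; exists a, tau.
Qed.

End StepA.

(** Every unfolding of [flat] has an erased form, so [H] and [flat] have the same domain. *)
Lemma erases_total (Gamma : ranked_alphabet) (s1 : tree (option (ra_sym Gamma))) :
  wf_tree (@orank Gamma) s1 -> exists s, erases s1 s.
Proof.
elim/tree_nested_ind: s1 => [[g|] ch] IH /= /andP[/eqP sz W]; last first.
  case: ch sz IH W => [|c []] //= _ IH /andP[W _].
  have [s Es] := proj1 (List.Forall_forall _ _) IH _ (or_introl erefl) W.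
  by exists s; constructor.
have [|ch' HE] := @Forall2_ex _ _ (@erases (ra_sym Gamma)) ch.
  move=> c ic; apply: (proj1 (List.Forall_forall _ _) IH _ ic).
  exact: (all_In W).
by exists (Node g ch'); constructor.
Qed.

Lemma flat_wf (Sigma Gamma : ranked_alphabet) (H : uTHM Sigma Gamma) t c s1 :
  @unf _ _ (flat H) t c s1 -> wf_tree (@orank Gamma) s1.
Proof.
elim/tree_nested_ind: s1 c => g ss IH [[u st] mu] Us.
inversion Us as [? ? cs ? Ec HF]; subst.
have [a [ks [La Ek HK]]] := (cstepP _ _ _ _ _ _).1 Ec.
rewrite /= -(Forall2_size HF) -(Forall2_size HK) (flat_rank Ek) eqxx /=.
elim: HF IH {Us Ec HK Ek} => //= c s l l' Us _ IHl IH.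
inversion IH; subst; apply/andP; split; eauto.
Qed.

(** * Visits of the one-symbol system *)

Section FlatBound.
Variables (Sigma Gamma : ranked_alphabet) (H : uTHM Sigma Gamma).
Variables (t : tree (ra_sym Sigma)) (b : nat).
Hypothesis leg : legal H.
Hypothesis wft : wf_tree (ra_rank Sigma) t.
Hypothesis bnd : forall cs, is_run (H := H) t cs -> forall u, visits cs [:: u] <= b.

Definition max_height := foldr maxn 0 (map (@height _) (out_subtrees H)).

Lemma max_heightP c : c \in out_subtrees H -> height c <= max_height.
Proof.
rewrite /max_height; elim: (out_subtrees H) => //= d l IH; rewrite inE leq_max.
by case/orP=> [/eqP ->|/IH ->]; rewrite ?leqnn ?orbT.
Qed.

(** The visits to [u], the present one included, that the output now being emitted can still cause:
    every emitted symbol descends one level in that output. *)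
Definition flat_weight (u : seq nat) (c : bconf (flat H)) :=
  if c.1.1 == u then
    (match c.1.2 with inl _ => max_height | inr x => height (ssval x) end).+1
  else 0.

(** The run of [H] lags behind: it ends in the configuration whose transition output is being
    emitted, at the same node and with the same memory. *)
Definition flat_inv (rest : seq (config H)) (c : bconf (flat H)) :=
  gchain (step t) (init_config H) rest /\
  exists q, last (init_config H) rest = (c.1.1, q, c.2) /\
    match c.1.2 with
    | inl q' => q = q'
    | inr x => exists a tau, [/\ lab t c.1.1 = Some a, hdelta H q a (c.2 c.1.1) = Some tau
        & forall y, List.In y (leaves (ssval x)) -> List.In y (leaves tau)]
    end.

Lemma flat_chain (u : seq nat) rest : forall hist c, flat_inv hist c -> bchain t c rest ->
  exists rest', gchain (step t) (init_config H) (hist ++ rest') /\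
    count (fun C : bconf (flat H) => C.1.1 == u) (c :: rest) <=
    flat_weight u c + count (fun C => cpos C == u) rest' * max_height.+1.
Proof.
elim: rest => [|c' rest IH] hist c [Hh [q [El Hc]]] Hch.
  exists [::]; rewrite cats0; split=> //=; rewrite /flat_weight.
  by case: eqP; rewrite //= mul0n addn0.
case: Hch => [[g [cs [Ec ic]]] Hch].
move: c El Hc Ec => [[u0 st] mu] El Hc Ec; rewrite /= in El Hc.
have [a [ks [La Ek HK]]] := (cstepP _ _ _ _ _ _).1 Ec.
move: Ek; rewrite /=; case Rs: (resolve st a (mu u0)) => [tau|] //= [].
have it := resolve_sub Rs.
have Hht : height tau <=
    match st with inl _ => max_height | inr x => height (ssval x) end.
  by case: st Rs {Hc Ec} => [q' _|x [->]] //=; exact: max_heightP.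
have [tau0 [E0 sub0]] : exists tau0, hdelta H q a (mu u0) = Some tau0 /\
    forall y, List.In y (leaves tau) -> List.In y (leaves tau0).
  case: st Rs Hc {Ec Hht} => [q' E ->|x [<-] [a' [tau0 [La' E0 Hs]]]]; first by exists tau.
  by move: La'; rewrite La => -[Ea]; exists tau0; rewrite Ea.
(* The chain follows one branch only, but the step of [H] must be defined on all of them; legality
   provides this. *)
have [Hm [tau0' Est S]] := legal_step leg wft Hh El La E0.
have [x ix [v Hv Ex]] := Forall2_in_l (Forall2_sym HK) ic.
case: tau it {Rs} Hht sub0 => [[g'|[[q1 m1] d]] ch] it Hht sub0 /= [_ Eks]; subst ks.
  move/List.in_map_iff: ix => [c0 [Ex0 ic0]]; subst x; move: Hv Ex => /= [<-].
  rewrite setm_id => Ex; move/InP: ic0 => ic0.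
  have ic0' := out_subtrees_child it ic0.
  have Hh0 := height_child (inl g') ic0.
  have Es : to_state c0 = inr (SeqSub ic0').
    by rewrite /to_state insubT.
  have [|rest' [Hr' Hcnt]] := IH hist c' _ Hch.
    rewrite Ex; split=> //; exists q; split=> //=; rewrite Es.
    exists a, tau0; split=> // y iy; apply: sub0; apply/List.in_flat_map.
    by exists c0; split=> //; apply/InP.
  exists rest'; split=> //.
  apply: leq_trans (_ : (u0 == u) + (flat_weight u c' + count (fun C => cpos C == u) rest' *
     max_height.+1) <= _).
    by rewrite /= leq_add2l.
  rewrite addnA leq_add2r Ex /flat_weight /= Es /=.
  by case: eqP => //= _; exact: leq_trans Hh0 Hht.
case: ix => // Ex0; subst x; move: Hv Ex => /= Hv Ex.
have [C1 iC1 [v' Hv' EC1]] := srel_leaf_l S (sub0 (q1, m1, d) (or_introl erefl)).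
move: Hv'; rewrite Hv => -[Ev]; subst v'.
have [|rest' [Hr' Hcnt]] := IH (rcons hist C1) c' _ Hch.
  rewrite Ex EC1; split; last by exists q1; rewrite last_rcons.
  by apply/gchain_rcons; split=> //; exists tau0'; rewrite El -EC1.
exists (C1 :: rest'); split; first by rewrite -cat_rcons.
apply: leq_trans (_ : (u0 == u) + (flat_weight u c' + count (fun C => cpos C == u) rest' *
     max_height.+1) <= _).
  by rewrite /= leq_add2l.
rewrite [count _ (C1 :: _)]/= mulnDl !addnA leq_add2r.
have -> : cpos C1 = v by rewrite EC1.
have -> : flat_weight u c' = if v == u then max_height.+1 else 0 by rewrite Ex.
rewrite /flat_weight -[(_, st, _).1.1]/u0.
by case: (u0 == u); case: (v == u); rewrite ?mul1n ?mul0n; lia.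
Qed.

Lemma flat_bounded (u : seq nat) rest : bchain t (bini (flat H)) rest ->
  count (fun C : bconf (flat H) => C.1.1 == u) (bini (flat H) :: rest) <= b * max_height.+1.
Proof.
move=> Hc; have [|rest' [Hr' Hcnt]] := @flat_chain u rest [::] (bini (flat H)) _ Hc.
  by split=> //; exists (hqinit H).
apply: leq_trans Hcnt _.
have Hrun : is_run t (init_config H :: rest') by apply/is_runP; exists rest'.
apply: leq_trans (_ : visits (init_config H :: rest') [:: u] * max_height.+1 <= _);
  last by rewrite leq_mul2r bnd ?orbT.
rewrite /visits /= mulnDl; apply: leq_add.
  by rewrite /flat_weight inE /cpos /=; case: eqP; rewrite ?mul1n.
by rewrite leq_mul2r; apply/orP; right; apply: eq_leq; apply: eq_count => C; rewrite inE.
Qed.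

End FlatBound.

(** * Walking through erased nodes *)

Definition oalph (Gamma : ranked_alphabet) : ranked_alphabet :=
  @RankedAlphabet (option (ra_sym Gamma)) (@orank Gamma).

(* The node of the erased tree that a node of the original tree becomes;
   an erased node becomes its first surviving descendant. *)
Fixpoint pr (G : Type) (s : tree (option G)) (x : seq nat) : seq nat :=
  if x is i :: x' then
    let 'Node g ch := s in
    if List.nth_error ch i.-1 is Some c then
      if g is Some _ then i :: pr c x' else pr c x'
    else [::]
  else [::].

Section Pr.
Variable G : Type.

Lemma pr_subt (s1 : tree (option G)) (s : tree G) x s1' : erases s1 s -> subt s1 x = Some s1' ->
  exists s', subt s (pr s1 x) = Some s' /\ erases s1' s'.
Proof.
elim: x s1 s => [|i x IH] s1 s E /=; first by case=> <-; exists s.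
case: E => [c s0 E|g ch ch' E]; case: i => // i /=.
  by case: i => [|[]] //= H; exact: IH E H.
case En: (List.nth_error ch i) => [c|] // H.
have [c' Ec' Ec] := Forall2_nth E En.
by have [s' Hs'] := IH _ _ Ec H; exists s' => /=; rewrite Ec'.
Qed.

Lemma pr_rcons (s1 : tree (option G)) x i g ch : subt s1 x = Some (Node g ch) -> is_node s1 (rcons x i) ->
  pr s1 (rcons x i) = if g is Some _ then rcons (pr s1 x) i else pr s1 x.
Proof.
rewrite /is_node; elim: x s1 => [|j x IH] [g1 ch1] /=.
  case=> -> ->; case: i => // i; rewrite /=.
  by case: (List.nth_error ch i) => // c; case: g.
case: j => // j /=; case: (List.nth_error ch1 j) => // c Hs /(IH _ Hs) ->.
by case: (g); case: (g1).
Qed.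

(** [pr] forgets only the index taken at an erased node, which has a single child. Hence two nodes
    can part only at a surviving node, and there their projections part as well. *)
Lemma pr_comp (s1 : tree (option G)) (s : tree G) x x' : erases s1 s -> is_node s1 x -> is_node s1 x' ->
  prefix (pr s1 x) (pr s1 x') -> prefix x x' || prefix x' x.
Proof.
rewrite /is_node; elim: x s1 s x' => [|i x IH] s1 s [|i' x'] E //=; case: E => [c s0 E|g ch ch' E];
  case: i => // i; case: i' => // i' /=.
  case: i => [|[]] //=; case: i' => [|[]] //= H H' /(IH _ _ _ E H H').
  by [].
case En: (List.nth_error ch i) => [c|] //; case En': (List.nth_error ch i') => [c'|] //.
move=> H H' /andP[/eqP[Ei] Hp]; subst i'; rewrite !eqxx /=.
have [c'' _ Ec] := Forall2_nth E En.
have Ecc : c' = c by congruence.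
by subst c'; exact: IH Ec H H' Hp.
Qed.

(** A fibre of [pr] is a chain of erased nodes that ends in one surviving node. *)
Lemma pr_inj (s1 : tree (option G)) (s : tree G) x x' g g' : erases s1 s -> lab s1 x = Some (Some g) ->
  lab s1 x' = Some (Some g') -> pr s1 x = pr s1 x' -> x = x'.
Proof.
rewrite /lab; elim: x s1 s x' => [|i x IH] s1 s [|i' x'] E //=; case: E => [c s0 E|g0 ch ch' E] //=.
- by case: i' => // i'; case: (List.nth_error ch i').
- by case: i => // i; case: (List.nth_error ch i).
- case: i => // i; case: i' => // i'; case: i => [|[]] //=; case: i' => [|[]] //=.
  by move=> H H' /(IH _ _ _ E H H') ->.
- case: i => // i; case: i' => // i' /=.
  case En: (List.nth_error ch i) => [c|] //; case En': (List.nth_error ch i') => [c'|] // H H'.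
  case=> Ei Hp; subst i'; congr cons; have [c'' _ Ec] := Forall2_nth E En.
  have Ecc : c' = c by congruence.
by subst c'; exact: IH Ec H H' Hp.
Qed.

Lemma erases_lab (s1 : tree (option G)) (s : tree G) x g : erases s1 s -> lab s1 x = Some (Some g) -> lab s (pr s1 x) = Some g.
Proof.
move=> E Hl; have [ch Es] := lab_subt Hl; have [s' [Es' E']] := pr_subt E Es.
by rewrite /lab Es'; inversion E'; subst.
Qed.

Lemma erases_skip (s1 : tree (option G)) (s : tree G) x : erases s1 s -> lab s1 x = Some None ->
  exists c, subt s1 x = Some (Node None [:: c]).
Proof.
move=> E Hl; have [ch Es] := lab_subt Hl; have [s' [Es' E']] := pr_subt E Es.
by inversion E' as [c|]; subst; exists c.
Qed.

Lemma pr_node (s1 : tree (option G)) (s : tree G) x : erases s1 s -> is_node s1 x -> is_node s (pr s1 x).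
Proof.
rewrite /is_node => E; case Es: (subt s1 x) => [s1'|] // _.
by have [s' [-> _]] := pr_subt E Es.
Qed.

Lemma pr_down (s1 : tree (option G)) (s : tree G) x g i : erases s1 s -> lab s1 x = Some (Some g) ->
  is_node s (rcons (pr s1 x) i) -> is_node s1 (rcons x i).
Proof.
move=> E Hl; have [ch Es] := lab_subt Hl; have [s' [Es' E']] := pr_subt E Es.
inversion E' as [|? ? ch' HF]; subst.
rewrite /is_node (subt_rcons _ Es') (subt_rcons _ Es); case: i => // i.
by rewrite !nth_error_size (Forall2_size HF).
Qed.

End Pr.

Lemma erases_wf (Gamma : ranked_alphabet) (s1 : tree (option (ra_sym Gamma))) s :
  erases s1 s -> wf_tree (@orank Gamma) s1 -> wf_tree (ra_rank Gamma) s.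
Proof.
elim/tree_nested_ind: s1 s => g ch IH s E.
inversion E as [c s0 Ec|g' ch0 ch' HF]; subst => /=.
  by move=> /andP[W _]; exact: (List.Forall_inv IH _ Ec).
case/andP=> /eqP <- W; rewrite -(Forall2_size HF) eqxx /=.
elim: HF IH W {E} => //= c c' l l' Ec _ IHl IH /andP[Wc Wl].
by rewrite (List.Forall_inv IH _ Ec Wc) (IHl (List.Forall_inv_tail IH) Wl).
Qed.

Section StepB.
Variables (Gamma Xi : ranked_alphabet) (N : uTHM Gamma Xi).

(** The flag records whether the last proper move of [N] went up; on an erased node, whose only
    child is number 1, the walk goes on in the same direction. *)
Definition walk_delta (q : hQ N * bool) (g : ra_sym (oalph Gamma)) (m : hM N) :
    option (tree (ra_sym Xi + (hQ N * bool * hM N) * dir)) :=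
  match g with
  | None => Some (Node (inr (q, m, if q.2 then None else Some 1)) [::])
  | Some g => omap (smap (fun x : hQ N * hM N * dir =>
       ((x.1.1, ~~ isSome x.2), x.1.2, x.2))) (hdelta N q.1 g m)
  end.

Lemma walk_wf q g m tau : walk_delta q g m = Some tau ->
  out_wf (ra_rank Xi) (ra_rank (oalph Gamma) g) tau.
Proof.
case: g => [g|] /=; last by case=> <- /=; case: q.2.
case E: (hdelta N _ _ _) => [tau0|] //= [<-].
have Wf := hdelta_wf E; have S := smap_srel (fun x : hQ N * hM N * dir =>
       ((x.1.1, ~~ isSome x.2), x.1.2, x.2)) (out_wf_leaves Wf).
apply: (srel_out_wf S Wf) => b /(srel_leaf_l (srel_sym S)) [[x [i|]] ia ->] //=.
exact: (out_wf_dir Wf ia).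
Qed.

Definition walk : uTHM (oalph Gamma) Xi :=
  @UTHM (oalph Gamma) Xi (hQ N * bool)%type (hM N) (htop N) (hqinit N, false)
    walk_delta walk_wf.

Hypothesis leg : legal N.
Variables (s1 : tree (ra_sym (oalph Gamma))) (s : tree (ra_sym Gamma)).
Hypothesis Ers : erases s1 s.
Hypothesis wfs : wf_tree (@orank Gamma) s1.

(** The phase between an up-move of [N] and the arrival at the parent. An erased node projects to
    the surviving node below it, here the one that [N] has just left. *)
Definition climbing (C1 : config walk) : bool :=
  (lab s1 C1.1.1 == Some None) && C1.1.2.2.

(** While the walk is climbing, [N] already stands at the parent of the projection. A run of [N] is
    carried along because legality speaks about reachable configurations. *)
Definition walk_rel (C1 : config walk) (C : config N) : Prop :=
  [/\ C1.1.2.1 = C.1.2, is_node s1 C1.1.1,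
    forall x g, lab s1 x = Some (Some g) -> C1.2 x = C.2 (pr s1 x),
    if climbing C1 then exists i, pr s1 C1.1.1 = rcons C.1.1 i else C.1.1 = pr s1 C1.1.1
   & exists2 rest, gchain (step s) (init_config N) rest & last (init_config N) rest = C].

Lemma walk_init : walk_rel (init_config walk) (init_config N).
Proof. by split=> //; [rewrite /climbing andbF|exists [::]]. Qed.

Lemma walk_real C1 C g tau : walk_rel C1 C -> lab s1 C1.1.1 = Some (Some g) ->
  hdelta N C.1.2 g (C.2 C.1.1) = Some tau ->
  exists tau1 tau', [/\ step s1 C1 = Some tau1, step s C = Some tau' &
    srel (fun D1 D => walk_rel D1 D /\
      (climbing D1 -> pr s1 D1.1.1 = pr s1 C1.1.1)) tau1 tau'].
Proof.
move: C1 C => [[x [q b]] mu1] [[y q'] mu] [/= Eq nx Hmu Hcl [rest Hc El]] Lx E; subst q'.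
move: Hcl; rewrite /climbing /= Lx /= => Ey; subst y.
have Ly := erases_lab Ers Lx.
have [Hm [tau' E' S']] := legal_step leg (erases_wf Ers wfs) Hc El Ly E.
have S0 := smap_srel (fun x : hQ N * hM N * dir =>
       ((x.1.1, ~~ isSome x.2), x.1.2, x.2)) (out_wf_leaves (hdelta_wf E)).
(* Each move of [N] in [s] begins with a possible move in [s1]. [Hm] excludes an up-move at the root
   of [s], above which [s1] may still have erased nodes. *)
have Key (z : hQ N * hM N * dir) : List.In z (leaves tau) ->
    exists2 v1, move s1 x z.2 = Some v1 &
    forall v, move s (pr s1 x) z.2 = Some v ->
      let D1 : config walk := (v1, (z.1.1, ~~ isSome z.2), setm mu1 x z.1.2) in
      (if climbing D1 then exists i, pr s1 v1 = rcons v i else v = pr s1 v1) /\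
      is_node s1 v1 /\ (climbing D1 -> pr s1 v1 = pr s1 x).
  case: z => [[q' m'] [i|]] iz.
    have [v Hv] := Hm _ iz; move/move_down: Hv => [Ev nv]; subst v.
    have nx' := pr_down Ers Lx nv; have [ch Es] := lab_subt Lx.
    exists (rcons x i); first by apply/move_down.
    move=> v /move_down [-> _] /=; rewrite /climbing /= andbF; split=> //.
    by rewrite (pr_rcons Es nx').
  have [v Hv] := Hm _ iz; move/move_upP: Hv => [i Ev].
  case/lastP: x nx Lx {Ly Hm E' S' El E} Ev => [|x j] nx Lx Ev.
    by move/(congr1 size): Ev; rewrite size_rcons.
  exists x; first exact: move_up.
  move=> v'; rewrite Ev move_up => -[<-] /=.
  have nx' := is_node_rcons nx; have [g' Lg'] := (labP _ _).1 nx'.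
  have [ch Es] := lab_subt Lg'; move: Ev; rewrite (pr_rcons Es nx) /climbing /= Lg' andbT.
  case: g' Lg' Es => [g'|] Lg' Es /=.
    by move=> /rcons_inj [-> _]; split=> //; split.
  by move=> Ev; split; first exists i.
have [|tau1 S1] := @srel_ex _ _ _ (fun z (D : config walk) => exists2 v, move s1 x z.2 = Some v &
       D = (v, z.1.1, setm mu1 x z.1.2)) _ (srel_wf_leaves (srel_sym S0)).
  move=> z iz; have [z0 iz0 Ez] := srel_leaf_l (srel_sym S0) iz.
  have [v1 Hv1 _] := Key _ iz0; exists (v1, z.1.1, setm mu1 x z.1.2); exists v1 => //.
  by rewrite Ez.
exists tau1, tau'; split=> //.
  apply: (@stepP _ _ walk s1 x (q, b) mu1 tau1).2; exists (Some g), (smap (fun x : hQ N * hM N * dir =>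
       ((x.1.1, ~~ isSome x.2), x.1.2, x.2)) tau); split=> //=.
  by rewrite (Hmu _ _ Lx) E.
apply: srel_imp_in (srel_comp (srel_trans S0 S1) S') => D1 D _ iD
  [z [iz [z' [_ -> [v1 Hv1 ->]]] [v Hv ED]]].
have [v1' Hv1' /(_ _ Hv) /= [H1 [H2 H3]]] := Key _ iz.
move: Hv1' H1 H2 H3; rewrite Hv1 => -[<-] H1 H2 H3; split=> //; rewrite ED; split=> //=.
  move=> x' g' Lx'; rewrite /setm; case: eqP => [->|ne]; first by rewrite eqxx.
  by case: eqP => [/(pr_inj Ers Lx' Lx)|_] //; exact: Hmu Lx'.
exists (rcons rest D); last by rewrite last_rcons ED.
by apply/gchain_rcons; split=> //; exists tau'; rewrite El.
Qed.

Definition walk_measure (C1 : config walk) :=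
  if C1.1.2.2 then size C1.1.1 else
  if subt s1 C1.1.1 is Some c then height c else 0.

Lemma walk_skip C1 C : walk_rel C1 C -> lab s1 C1.1.1 = Some None ->
  exists D1, [/\ step s1 C1 = Some (Node (inr D1) [::]), walk_rel D1 C,
    D1.1.2.2 = C1.1.2.2,
    if C1.1.2.2 then exists i, C1.1.1 = rcons D1.1.1 i
      else D1.1.1 = rcons C1.1.1 1 /\ pr s1 D1.1.1 = pr s1 C1.1.1 &
    walk_measure D1 < walk_measure C1].
Proof.
move: C1 C => [[x [q b]] mu1] [[y q'] mu] [/= Eq nx Hmu Hcl Hrest] Lx; subst q'.
have [c Es] := erases_skip Ers Lx.
suff [v [Hv Hpos Hcl' Hms]] : exists v, [/\ move s1 x (if b then None else Some 1) = Some v,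
    if b then exists i, x = rcons v i else v = rcons x 1 /\ pr s1 v = pr s1 x,
    if climbing (v, (q, b), mu1) then exists i, pr s1 v = rcons y i else y = pr s1 v &
    walk_measure (v, (q, b), mu1) < walk_measure (x, (q, b), mu1)].
  exists (v, (q, b), mu1); split=> //; last first.
    by split=> //=; exact: move_node Hv.
  apply: (@stepP _ _ walk s1 x (q, b) mu1 _).2; exists None, (Node (inr ((q, b), mu1 x, if b then None else Some 1)) [::]).
  by split=> //; constructor; exists v => //=; rewrite setm_id.
move: Hcl; rewrite /climbing /= Lx /=; case: b => /=.
  case=> i Hi; case/lastP: x nx Lx Es Hi => [_ _ _ /= |x j nx Lx Es Hi].
    by move/(congr1 size); rewrite size_rcons.
  exists x; rewrite move_up; split=> //; first by exists j.
    have [g' Lg'] := (labP _ _).1 (is_node_rcons nx); have [ch Es'] := lab_subt Lg'.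
    move: Hi; rewrite (pr_rcons Es' nx) Lg' andbT.
    case: g' Lg' Es' => [g'|] Lg' Es' /=; last by exists i.
    by move=> /rcons_inj [-> _].
  by rewrite /walk_measure /= size_rcons.
move=> Ey; have n1 : is_node s1 (rcons x 1) by rewrite /is_node (subt_rcons _ Es).
exists (rcons x 1); rewrite andbF (pr_rcons Es n1); split=> //; first exact/move_down.
by rewrite /walk_measure /= (subt_rcons _ Es) Es /= maxn0.
Qed.

Lemma walk_transit C1 C : walk_rel C1 C -> exists D1, [/\ walk_rel D1 C,
  exists g, lab s1 D1.1.1 = Some (Some g) &
  forall r, gy (step s1) (Node (inr D1) [::]) r -> gy (step s1) (Node (inr C1) [::]) r].
Proof.
have [n] := ubnP (walk_measure C1); elim: n C1 => // n IH C1 Hn HR.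
have [_ /labP [[g|] Lx] _ _ _] := HR; first by exists C1; split=> //; exists g.
have [D1 [E1 HR1 _ _ Hm]] := walk_skip HR Lx.
have [|D [HD1 HD2 HD3]] := IH D1 _ HR1; first exact: leq_trans Hm Hn.
by exists D; split=> // r /HD3; exact: gy_conf.
Qed.

Lemma walk_lab C1 C g : walk_rel C1 C -> lab s1 C1.1.1 = Some (Some g) ->
  lab s C.1.1 = Some g /\ C1.2 C1.1.1 = C.2 C.1.1.
Proof.
move=> [_ _ Hmu Hcl _] Lx; move: Hcl; rewrite /climbing Lx /= => ->.
by split; [exact: erases_lab|exact: Hmu Lx].
Qed.

Lemma walk_real_l C1 C g tau1 : walk_rel C1 C -> lab s1 C1.1.1 = Some (Some g) ->
  step s1 C1 = Some tau1 -> exists2 tau', step s C = Some tau' &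
    srel (fun D1 D => walk_rel D1 D /\
      (climbing D1 -> pr s1 D1.1.1 = pr s1 C1.1.1)) tau1 tau'.
Proof.
move=> HR Lx E1; have [Ly Em] := walk_lab HR Lx; have [Eq _ _ _ _] := HR.
have [tau E] : exists tau, hdelta N C.1.2 g (C.2 C.1.1) = Some tau.
  move: C1 C HR Lx E1 Ly Em Eq => [[x [q b]] mu1] [[y q'] mu] /= _ Lx /stepP [a [tau [La]]].
  move: La; rewrite Lx => -[<-] /=; case E: (hdelta N q g (mu1 x)) => [tau0|] // _ _ _ <- <-.
  by exists tau0.
have [tau1' [tau' [E1' E' S]]] := walk_real HR Lx E.
by exists tau' => //; move: E1'; rewrite E1 => -[->].
Qed.

Lemma walk_sem r : sem walk s1 r <-> sem N s r.
Proof.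
rewrite /sem !yieldsP; split.
  apply: (@sim _ _ _ _ _ walk_rel) walk_init => C1 C n r' HR Hg.
  inversion Hg as [|? ? tau1 ? E1 Hg']; subst.
  have [_ /labP [[g|] Lx] _ _ _] := HR.
    have [tau' E' S] := walk_real_l HR Lx E1.
    exists tau1, tau'; split=> //; first by move=> s'; exact: gy_conf.
    by apply: srel_imp_in S => D1 D _ _ [].
  have [D1 [E1' HR1 _ _ _]] := walk_skip HR Lx; move: E1 Hg'; rewrite E1' => -[<-] Hg'.
  (* An erased node costs the walk a step and [N] none: [N] answers with its unchanged
     configuration, and progress lies in the smaller height on the side of the walk. *)
  by exists (Node (inr D1) [::]), (Node (inr C) [::]); split=> //; constructor.
apply: (@sim _ _ _ _ _ (fun C C1 => walk_rel C1 C)) walk_init => C C1 n r' HR Hg.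
have [D1 [HR1 [g Lx] Htr]] := walk_transit HR.
inversion Hg as [|? ? tau' ? E' Hg']; subst.
have [Ly _] := walk_lab HR1 Lx.
have [tau E] : exists tau, hdelta N C.1.2 g (C.2 C.1.1) = Some tau.
  move: C E' Ly {HR HR1 Hg} => [[y q] mu] /stepP [a [tau [La E _]]] /=.
  by rewrite La => -[<-]; exists tau.
have [tau1 [tau'' [E1 E'' S]]] := walk_real HR1 Lx E.
move: E''; rewrite E' => -[Et]; subst tau''.
exists tau', tau1; split=> //; first by move=> s' Hs; apply: Htr; exact: gy_conf E1 Hs.
by apply: srel_imp_in (srel_sym S) => D D1' _ _ [].
Qed.

(** * Visits of the walk to an antichain *)

Section Narrow.
Variable S : seq (seq nat).
Hypothesis uS : uniq S.
Hypothesis aS : antichain S.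
Hypothesis nS : all (is_node s1) S.

Lemma pr_inj_S : {in S &, injective (pr s1)}.
Proof.
move=> x x' ix ix' E; apply/eqP/negPn/negP => ne.
have nx := allP nS _ ix; have nx' := allP nS _ ix'.
have := pr_comp Ers nx nx'; rewrite E prefix_refl => /(_ isT).
by rewrite (negbTE (aS ix ix' ne)) (negbTE (aS ix' ix _)) // eq_sym.
Qed.

Lemma pr_antichain : antichain (map (pr s1) S).
Proof.
move=> _ _ /mapP [x ix ->] /mapP [x' ix' ->] ne.
have {}ne : x != x' by apply: contraNneq ne => ->.
apply/negP => /(pr_comp Ers (allP nS _ ix) (allP nS _ ix')).
by rewrite (negbTE (aS ix ix' ne)) (negbTE (aS ix' ix _)) // eq_sym.
Qed.

(** The elements of [S] in the fibre of [y], at most one since fibres are chains. [below] and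
    [above] count the elements that the walk meets from [x] on while it goes down, respectively up,
    in the fibre of [x]. *)
Definition wgt y := count (fun z => pr s1 z == y) S.
Definition below x := count (fun z => prefix x z && (pr s1 z == pr s1 x)) S.
Definition above x := count (fun z => prefix z x && (pr s1 z == pr s1 x)) S.

Lemma wgt_le y : wgt y <= (y \in map (pr s1) S).
Proof.
rewrite -count_uniq_mem ?map_inj_in_uniq //; last exact: pr_inj_S.
by rewrite count_map.
Qed.

Lemma below_wgt x : below x <= wgt (pr s1 x).
Proof. by apply: sub_count => z /andP[]. Qed.

Lemma above_wgt x : above x <= wgt (pr s1 x).
Proof. by apply: sub_count => z /andP[]. Qed.

Lemma count_disj (T : Type) (p q r : pred T) l : (forall z, p z -> r z) ->
  (forall z, q z -> r z) -> (forall z, p z -> ~~ q z) -> count p l + count q l <= count r l.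
Proof.
move=> pr0 qr pq; elim: l => //= z l IH.
have := pr0 z; have := qr z; have := pq z.
by case: (p z); case: (q z); case: (r z) => //= H1 H2 H3;
  try (by move: (H1 isT)); try (by move: (H2 isT)); try (by move: (H3 isT)); lia.
Qed.

Lemma in_below x : (x \in S) <= below x.
Proof.
case ix: (x \in S) => //; rewrite -has_count; apply/hasP; exists x => //.
by rewrite prefix_refl eqxx.
Qed.

Lemma in_above x : (x \in S) <= above x.
Proof.
case ix: (x \in S) => //; rewrite -has_count; apply/hasP; exists x => //.
by rewrite prefix_refl eqxx.
Qed.

Lemma prefix_rcons_l (x z : seq nat) i : prefix (rcons x i) z -> prefix x z /\ z != x.
Proof.
move=> /prefixP [w ->]; rewrite cat_rcons prefix_prefix; split=> //.
by apply/eqP => /(congr1 size); rewrite size_cat /=; lia.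
Qed.

Lemma below_rcons x i : pr s1 (rcons x i) = pr s1 x ->
  (x \in S) + below (rcons x i) <= below x.
Proof.
move=> E; rewrite -count_uniq_mem //; apply: count_disj => z.
- by move=> /= /eqP ->; rewrite prefix_refl eqxx.
- by rewrite E => /andP[/prefix_rcons_l [-> _]].
- by move=> /= /eqP ->; apply/negP => /andP[/prefix_rcons_l [_ /eqP]].
Qed.

Lemma above_rcons x i : pr s1 (rcons x i) = pr s1 x ->
  (rcons x i \in S) + above x <= above (rcons x i).
Proof.
move=> E; rewrite -count_uniq_mem //; apply: count_disj => z.
- by move=> /= /eqP ->; rewrite prefix_refl eqxx.
- rewrite E => /andP[/prefixP [w ->] ->]; rewrite andbT rcons_cat; exact: prefix_prefix.
- move=> /= /eqP ->; apply/negP => /andP[/prefixP [w /(congr1 size)]].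
  by rewrite size_cat size_rcons; lia.
Qed.

(* The visits to [S] during the current passage that are still to come: one when
   the walk passes [S] downwards, one when it passes [S] upwards again. *)
Definition potential (C1 : config walk) (C : config N) :=
  if climbing C1 then above C1.1.1 + (wgt C.1.1).*2
  else below C1.1.1 + wgt (pr s1 C1.1.1).

Lemma in_potential C1 C : (C1.1.1 \in S) <= potential C1 C.
Proof.
rewrite /potential; case: ifP => _; apply: leq_trans (leq_addr _ _).
  exact: in_above.
exact: in_below.
Qed.

Lemma potential_le C1 C : walk_rel C1 C -> climbing C1 = false ->
  potential C1 C <= (wgt C.1.1).*2.
Proof.
move=> [_ _ _ Hcl _] Ecl; rewrite /potential Ecl; move: Hcl; rewrite Ecl => ->.
by rewrite -addnn leq_add2r below_wgt.
Qed.

(** Every visit to [S] is paid out of the potential. A silent step adds nothing to it, and a proper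
    step of [N] adds at most twice the weight of its new position, once for each direction of
    passing through the fibre. *)
Lemma walk_chain rest : forall C1 C, walk_rel C1 C -> gchain (step s1) C1 rest ->
  exists2 rest', gchain (step s) C rest' &
   count (fun D : config walk => D.1.1 \in S) (C1 :: rest) <=
   potential C1 C + (\sum_(D <- rest') wgt D.1.1).*2.
Proof.
elim: rest => [|D1 rest IH] C1 C HR.
  by exists [::] => //; rewrite /= addn0; apply: leq_trans (leq_addr _ _); exact: in_potential.
case=> -[tau1 [E1 iD1]] Hch; have [_ /labP [[g|] Lx] _ Hcl _] := HR.
  have [tau' E' S'] := walk_real_l HR Lx E1.
  have [D iD [HRD Hpr]] := srel_leaf_l S' iD1.
  have [rest' Hr' Hcnt] := IH _ _ HRD Hch.
  exists (D :: rest'); first by split=> //; exists tau'.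
  rewrite big_cons doubleD addnA.
  have Hp : (C1.1.1 \in S) + potential D1 D <= potential C1 C + (wgt D.1.1).*2.
    rewrite {2}/potential /climbing Lx /= -addnA; apply: leq_add; first exact: in_below.
    case Ed: (climbing D1).
      (* The climb begins in the fibre of [C1]; the visit on its way up was reserved by the second
         summand of the potential of [C1]. *)
      by rewrite /potential Ed leq_add2r -(Hpr Ed) above_wgt.
    by apply: leq_trans (leq_addl _ _); exact: potential_le.
  apply: leq_trans (leq_add Hp (leqnn _)).
  by rewrite /= -addnA leq_add2l.
have [D1' [E1' HR1 Eb Hpos _]] := walk_skip HR Lx.
move: E1 iD1; rewrite E1' => -[<-] /= [ED|//]; subst D1'.
have [rest' Hr' Hcnt] := IH _ _ HR1 Hch.
exists rest' => //.
suff Hp : (C1.1.1 \in S) + potential D1 C <= potential C1 C.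
  by apply: leq_trans (leq_add Hp (leqnn _)); rewrite -addnA leq_add2l.
move: Hpos; rewrite {2}/potential; move: Hcl; rewrite {1 2}/climbing Lx eqxx /=.
case: (C1.1.2.2) Eb => Eb.
  move=> [i Hi] [j Hj]; rewrite Hj in Hi *.
  case Ed: (climbing D1); last first.
    by apply: leq_add; [exact: in_above|exact: potential_le].
  rewrite /potential Ed addnA leq_add2r; apply: above_rcons.
  move: Ed => /andP[/eqP Hl _]; have [ch Es] := lab_subt Hl; rewrite (pr_rcons Es) // -Hj.
  by case: HR.
move=> _ [Hx Hpr]; rewrite /potential /climbing Eb andbF Hpr addnA leq_add2r Hx.
by apply: below_rcons; rewrite -Hx.
Qed.

Lemma walk_narrow b rest : gchain (step s1) (init_config walk) rest ->
  (forall cs, is_run s cs -> visits (H := N) cs (map (pr s1) S) <= b) ->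
  visits (init_config walk :: rest) S <= b.*2.
Proof.
move=> Hch Hb; have [rest' Hr' Hcnt] := walk_chain walk_init Hch.
apply: leq_trans Hcnt _.
apply: leq_trans (_ : (\sum_(D <- init_config N :: rest') wgt D.1.1).*2 <= _).
  rewrite big_cons doubleD leq_add2r; apply: potential_le walk_init _.
  by rewrite /climbing andbF.
rewrite leq_double; apply: leq_trans (Hb (init_config N :: rest') _); last first.
  by apply/is_runP; exists rest'.
rewrite /visits -sum1_count [X in _ <= X]big_mkcond; apply: leq_sum => D _.
by apply: leq_trans (wgt_le _) _; rewrite /cpos; case: (_ \in _).
Qed.

End Narrow.
End StepB.

(** * Regularity of the domain *)

Definition regular (Sigma : ranked_alphabet) (L : tree (ra_sym Sigma) -> Prop) :=
  exists (F : finType) (phi : tree (ra_sym Sigma) -> F)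
    (alpha : ra_sym Sigma -> seq F -> F) (acc : pred F),
    (forall a ch, phi (Node a ch) = alpha a (map phi ch)) /\
    forall t, wf_tree (ra_rank Sigma) t -> (L t <-> acc (phi t)).

(** * Behaviour types of walks with a decreasing counter *)

Section Walker.
Variables (Sigma : ranked_alphabet) (Q : finType) (M : Type) (cnt : M -> nat).
Variable tr : Q -> ra_sym Sigma -> M -> Q -> M -> xdir -> Prop.
Variable stuck : Q -> ra_sym Sigma -> M -> Prop.
Hypothesis tr_cnt : forall q a m q' m' d, tr q a m q' m' d -> cnt m' < cnt m.

Local Notation T := (tree (ra_sym Sigma)).
Local Notation mem := (seq nat -> M).
Definition wconf : Type := ((seq nat * Q) * mem)%type.

(** A branch of a branching computation, seen as a nondeterministic walk: [tr] selects one
    successor. *)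
Definition wstep (t : T) (C C' : wconf) : Prop :=
  let '(u, q, mu) := C in
  exists a m' d, [/\ lab t u = Some a, tr q a (mu u) C'.1.2 m' d,
    xmove t u d = Some C'.1.1 & C'.2 = setm mu u m'].

Fixpoint wreach (t : T) (n : nat) (C C' : wconf) : Prop :=
  if n is n'.+1 then exists C1, wstep t C C1 /\ wreach t n' C1 C' else C = C'.

Definition wstuck (t : T) (C : wconf) : Prop :=
  exists a, lab t C.1.1 = Some a /\ stuck C.1.2 a (C.2 C.1.1).

Definition wexit (t : T) (C : wconf) (o : Q * mem) : Prop :=
  exists a m', [/\ C.1.1 = [::], lab t [::] = Some a,
    tr C.1.2 a (C.2 [::]) o.1 m' (Some None) & o.2 = setm C.2 [::] m'].

Definition wends (t : T) (C : wconf) (o : option (Q * mem)) : Prop :=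
  if o is Some o' then wexit t C o' else wstuck t C.

(* What a walk entering [t] at the root can end in: stuck, or leaving upwards. *)
Definition outc (t : T) (mu : mem) (q : Q) (o : option (Q * mem)) : Prop :=
  exists n C, wreach t n ([::], q, mu) C /\ wends t C o.

Definition join (i : nat) (mu nu : mem) : mem :=
  fun w => if w is j :: w' then if j == i then nu w' else mu w else mu w.

Lemma join_id i mu : join i mu (fun w => mu (i :: w)) = mu.
Proof. by apply/funext => -[|j w] //=; case: eqP => // ->. Qed.

Lemma join_setm i mu nu w m : join i mu (setm nu w m) = setm (join i mu nu) (i :: w) m.
Proof.
apply/funext => -[|j v]; rewrite /setm //=.
by rewrite eqseq_cons; case: (j == i).
Qed.

Section Child.
Variables (a : ra_sym Sigma) (ch : seq T) (i : nat) (c : T).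
Hypothesis Ec : List.nth_error ch i = Some c.
Local Notation t := (Node a ch).

Lemma lab_child w : lab t (i.+1 :: w) = lab c w.
Proof. by rewrite /lab /= Ec. Qed.

Lemma xmove_child w d v : xmove t (i.+1 :: w) d = Some v <->
  (exists2 w', v = i.+1 :: w' & xmove c w d = Some w') \/
  [/\ w = [::], v = [::] & d = Some None].
Proof.
case: d => [[k|]|] /=.
- split.
    move/move_down => [-> n]; left; exists (rcons w k) => //.
    by apply/move_down; split=> //; move: n; rewrite /is_node /= Ec.
  case=> [[w' -> /move_down [-> n]]|[]] //; apply/move_down; split=> //.
  by rewrite /is_node /= Ec.
- case/lastP: w => [|w j].
    rewrite /move /=; split=> [[<-]|]; first by right.
    by case=> [[]//|[_ -> _]].
  rewrite -rcons_cons !move_up; split=> [[<-]|].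
    by left; exists w.
  by case=> [[w' -> [->]]|[]] //; case: w.
- split=> [[<-]|]; first by left; exists w.
  by case=> [[w' -> [->]]|[]].
Qed.

Lemma wstep_child w q mu nu C' : wstep t (i.+1 :: w, q, join i.+1 mu nu) C' ->
  (exists w' q' nu', C' = (i.+1 :: w', q', join i.+1 mu nu') /\ wstep c (w, q, nu) (w', q', nu'))
  \/ (exists q' nu', [/\ w = [::], wexit c ([::], q, nu) (q', nu')
       & C' = ([::], q', join i.+1 mu nu')]).
Proof.
move: C' => [[v q'] mu'] /= [b [m' [d [Lb Htr Hm Emu]]]].
move: Lb Htr Emu; rewrite lab_child eqxx -join_setm => Lb Htr ->.
case/xmove_child: Hm => [[w' -> Hm]|[Ew -> Ed]].
  by left; exists w', q', (setm nu w m'); split=> //; exists b, m', d.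
right; exists q', (setm nu [::] m'); rewrite Ew in Lb Htr *; split=> //.
by exists b, m'; rewrite -Ed.
Qed.

Lemma child_wstep w q nu w' q' nu' mu : wstep c (w, q, nu) (w', q', nu') ->
  wstep t (i.+1 :: w, q, join i.+1 mu nu) (i.+1 :: w', q', join i.+1 mu nu').
Proof.
move=> [b [m' [d [/= Lb Htr Hm ->]]]]; exists b, m', d; rewrite /= lab_child eqxx.
by split=> //; [apply/xmove_child; left; exists w'|rewrite join_setm].
Qed.

Lemma child_wexit q nu q' nu' mu : wexit c ([::], q, nu) (q', nu') ->
  wstep t ([:: i.+1], q, join i.+1 mu nu) ([::], q', join i.+1 mu nu').
Proof.
move=> [b [m' [/= _ Lb Htr ->]]]; exists b, m', (Some None); rewrite /= lab_child eqxx.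
by split=> //; rewrite join_setm.
Qed.

(** A walk that starts inside a child either is still there, or is cut at the first time it leaves
    the child. *)
Lemma wreach_child n C' : forall w q mu nu,
  wreach t n (i.+1 :: w, q, join i.+1 mu nu) C' ->
  (exists w' q' nu', C' = (i.+1 :: w', q', join i.+1 mu nu') /\
     wreach c n (w, q, nu) (w', q', nu'))
  \/ (exists n1 q1 nu1 q2 nu2 n2, [/\ wreach c n1 (w, q, nu) ([::], q1, nu1),
       wexit c ([::], q1, nu1) (q2, nu2) &
       wreach t n2 ([::], q2, join i.+1 mu nu2) C']).
Proof.
elim: n => [|n IH] w q mu nu /=; first by move=> <-; left; exists w, q, nu.
case=> C1 [/wstep_child [[w' [q' [nu' [-> Hs]]]]|[q' [nu' [-> Hx ->]]]]] Hr.
  case: (IH _ _ _ _ Hr) => [[w2 [q2 [nu2 [-> Hr']]]]|].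
    by left; exists w2, q2, nu2; split=> //; exists (w', q', nu').
  move=> [n1 [q1 [nu1 [q2 [nu2 [n2 [H1 H2 H3]]]]]]].
  by right; exists n1.+1, q1, nu1, q2, nu2, n2; split=> //; exists (w', q', nu').
by right; exists 0, q, nu, q', nu', n.
Qed.

Lemma child_wreach n : forall w q nu w' q' nu' mu, wreach c n (w, q, nu) (w', q', nu') ->
  wreach t n (i.+1 :: w, q, join i.+1 mu nu) (i.+1 :: w', q', join i.+1 mu nu').
Proof.
elim: n => [|n IH] w q nu w' q' nu' mu /=; first by case=> -> -> ->.
case=> -[[w1 q1] nu1] [Hs Hr]; exists (i.+1 :: w1, q1, join i.+1 mu nu1).
by split; [exact: child_wstep|exact: IH].
Qed.

End Child.

Lemma wreach_cat t n n' C C' C'' : wreach t n C C' -> wreach t n' C' C'' ->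
  wreach t (n + n') C C''.
Proof.
by elim: n C => [|n IH] C /=; [move=> ->|case=> C1 [Hs Hr] H; exists C1; split; auto].
Qed.

(** First-step analysis in which a whole excursion into a child counts as one step. Only the memory
    at the root and the outcomes of the children occur in it. *)
Inductive onode a ch mu q o : Prop :=
| OStuck of stuck q a (mu [::]) & o = None
| OExit q' m' of tr q a (mu [::]) q' m' (Some None) & o = Some (q', setm mu [::] m')
| OStay q' m' of tr q a (mu [::]) q' m' None & outc (Node a ch) (setm mu [::] m') q' o
| OStuckIn q' m' i c of tr q a (mu [::]) q' m' (Some (Some i.+1)) &
    List.nth_error ch i = Some c & outc c (fun w => mu (i.+1 :: w)) q' None & o = None
| OChild q' m' i c q2 nu of tr q a (mu [::]) q' m' (Some (Some i.+1)) &
    List.nth_error ch i = Some c & outc c (fun w => mu (i.+1 :: w)) q' (Some (q2, nu)) &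
    outc (Node a ch) (join i.+1 (setm mu [::] m') nu) q2 o.

Lemma outc_node a ch mu q o : outc (Node a ch) mu q o <-> onode a ch mu q o.
Proof.
split.
  case=> -[|n] [C []].
    move=> <-; case: o => [[q' mu']|] /=.
      by case=> b [m' [_ [<-] Htr E]]; apply: (@OExit a ch mu q _ q' m' Htr); rewrite -E.
    by case=> b [[<-] Hs]; apply: OStuck.
  case=> -[[v q'] mu'] [[b [m' [d [/= [<-] Htr Hm ->]]]] Hr] He.
  case: d Htr Hm => [[i|]|] Htr //=; last first.
    by case=> Ev; subst v; apply: (@OStay a ch mu q _ q' m' Htr); exists n, C.
  case/move_down => Ev; subst v; rewrite /= /is_node /=; case: i Htr Hr => // i Htr Hr.
  case Ec: (List.nth_error ch i) => [c|] // _.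
  move: Hr; rewrite -(join_id i.+1 (setm mu [::] m')) => Hr.
  case: (wreach_child Ec Hr) => [[w [q1 [nu [EC Hr']]]]|].
    subst C; case: o He => [[q2 mu2] [b' [m2 []]]|] //= [b' []].
    rewrite (lab_child _ Ec) /= eqxx => Lb Hs.
    by apply: (@OStuckIn a ch mu q _ q' m' i c Htr Ec) => //; exists n, (w, q1, nu); split=> //; exists b'.
  move=> [n1 [q1 [nu1 [q2 [nu2 [n2 [H1 H2 H3]]]]]]].
  apply: (@OChild a ch mu q _ q' m' i c q2 (nu2) Htr Ec); first by exists n1, ([::], q1, nu1); split; [exact: H1|exact: H2].
  by exists n2, C.
case=> [Hs ->|q' m' Htr ->|q' m' Htr [n [C [Hr He]]]|q' m' i c Htr Ec [n [C [Hr He]]] ->|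
        q' m' i c q2 nu Htr Ec [n [C [Hr He]]] [n2 [C2 [Hr2 He2]]]].
- by exists 0, ([::], q, mu); split=> //; exists a.
- by exists 0, ([::], q, mu); split=> //; exists a, m'.
- exists n.+1, C; split=> //; exists ([::], q', setm mu [::] m'); split=> //.
  by exists a, m', None.
- move: C Hr He => [[w q1] nu] Hr [b [Lb Hs]].
  exists n.+1, (i.+1 :: w, q1, join i.+1 (setm mu [::] m') nu); split; last first.
    by exists b; rewrite /= (lab_child _ Ec) /= eqxx.
  exists ([:: i.+1], q', setm mu [::] m'); split.
    exists a, m', (Some (Some i.+1)); split=> //; apply/move_down; split=> //.
    by rewrite /is_node /= Ec.
  by rewrite -{1}(join_id i.+1 (setm mu [::] m')); exact: (child_wreach _ Ec).
- move: C Hr He => [[w q1] nu1] Hr He; have Ew : w = [::] by case: He => [? [? []]].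
  subst w; exists (n + n2.+1).+1, C2; split=> //.
  exists ([:: i.+1], q', setm mu [::] m'); split.
    exists a, m', (Some (Some i.+1)); split=> //; apply/move_down; split=> //.
    by rewrite /is_node /= Ec.
  apply: (@wreach_cat _ _ _ _ ([:: i.+1], q1, join i.+1 (setm mu [::] m') nu1)).
    by rewrite -{1}(join_id i.+1 (setm mu [::] m')); exact: (child_wreach _ Ec).
  exists ([::], q2, join i.+1 (setm mu [::] m') nu); split=> //.
  exact: (child_wexit _ Ec).
Qed.

(** Behaviour up to a depth. An outcome shows the exit state and, in place of the memory left
    behind, the type of the tree under that memory one level lower. So every [ty n] is finite,
    although there are infinitely many memories. *)
Fixpoint ty (n : nat) : finType :=
  if n is n'.+1 then {ffun Q -> {set option (Q * ty n')}} else unit.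

Fixpoint typ (n : nat) (t : T) (mu : mem) : ty n :=
  if n is n'.+1 as k return ty k then
    [ffun q => [set x | `[< exists2 o, outc t mu q o &
       omap (fun y => (y.1, typ n' t y.2)) o = x >]]]
  else tt.
Arguments typ : simpl never.

Lemma typE n t mu q : (typ n.+1 t mu : {ffun Q -> {set option (Q * ty n)}}) q =
  [set x | `[< exists2 o, outc t mu q o & omap (fun y => (y.1, typ n t y.2)) o = x >]].
Proof. by rewrite /typ ffunE. Qed.

Definition osim (P : mem -> mem -> Prop) (o o' : option (Q * mem)) : Prop :=
  match o, o' with
  | None, None => True
  | Some (q, mu), Some (q', mu') => q = q' /\ P mu mu'
  | _, _ => False
  end.

Definition omatch (P : mem -> mem -> Prop) (t t' : T) (mu mu' : mem) :=
  forall q o, outc t mu q o -> exists2 o', outc t' mu' q o' & osim P o o'.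

(** Equality of types is a back-and-forth condition on outcomes: matching outcomes end in the same
    state and leave memories that agree one level lower. *)
Lemma typS_eq n t t' mu mu' : typ n.+1 t mu = typ n.+1 t' mu' <->
  omatch (fun nu nu' => typ n t nu = typ n t' nu') t t' mu mu' /\
  omatch (fun nu nu' => typ n t' nu = typ n t nu') t' t mu' mu.
Proof.
have half x x' nu nu' : typ n.+1 x nu = typ n.+1 x' nu' ->
    omatch (fun nu nu' => typ n x nu = typ n x' nu') x x' nu nu'.
  move/ffunP => E q o Ho; move: (E q); rewrite !typE => /setP
    /(_ (omap (fun y => (y.1, typ n x y.2)) o)); rewrite !inE.
  rewrite (asboolT (_ : exists2 o0, _ & _)); last by exists o.
  move/esym/asboolP => [o' Ho' Eo]; exists o' => //.
  by case: o o' Eo {Ho Ho'} => [[q1 nu1]|] [[q2 nu2]|] //= [-> ->].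
split=> [E|[H1 H2]]; first by split; apply: half.
apply/ffunP => q; rewrite !typE; apply/setP => x; rewrite !inE.
apply/asboolP/asboolP => -[o Ho <-].
  have [o' Ho' Hs] := H1 q o Ho; exists o' => //.
  by case: o o' Hs {Ho Ho'} => [[q1 nu1]|] [[q2 nu2]|] //= [-> ->].
have [o' Ho' Hs] := H2 q o Ho; exists o' => //.
by case: o o' Hs {Ho Ho'} => [[q1 nu1]|] [[q2 nu2]|] //= [-> ->].
Qed.

Lemma omatch_imp (P P' : mem -> mem -> Prop) t t' mu mu' :
  (forall nu nu', P nu nu' -> P' nu nu') -> omatch P t t' mu mu' -> omatch P' t t' mu mu'.
Proof.
move=> H Hm q o /Hm [o' Ho' Hs]; exists o' => //.
by case: o o' Hs {Ho'} => [[q1 nu1]|] [[q2 nu2]|] //= [-> /H].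
Qed.

Lemma typ_down n : forall t t' mu mu', typ n.+1 t mu = typ n.+1 t' mu' ->
  typ n t mu = typ n t' mu'.
Proof.
elim: n => // n IH t t' mu mu' /typS_eq [H1 H2]; apply/typS_eq.
by split; [apply: omatch_imp H1|apply: omatch_imp H2] => nu nu' /IH.
Qed.

Definition chsim n (ch ch' : seq T) (mu mu' : mem) :=
  forall i, match List.nth_error ch i, List.nth_error ch' i with
    | Some c, Some c' =>
        typ n c (fun w => mu (i.+1 :: w)) = typ n c' (fun w => mu' (i.+1 :: w))
    | None, None => True
    | _, _ => False
    end.

Lemma chsim_sym n ch ch' mu mu' : chsim n ch ch' mu mu' -> chsim n ch' ch mu' mu.
Proof.
move=> H i; move: (H i); case: (List.nth_error ch i) => [c|];
  case: (List.nth_error ch' i) => [c'|] //.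
Qed.

Definition typ_all t t' mu mu' := forall k, typ k t mu = typ k t' mu'.

(* Every visit decreases the counter at the root, so a walk enters the children at
   most that many times: children types of that depth determine everything. *)
Lemma typ_congr n a : forall ch ch' mu mu', chsim n ch ch' mu mu' -> mu [::] = mu' [::] ->
  cnt (mu [::]) <= n ->
  omatch (typ_all (Node a ch) (Node a ch')) (Node a ch) (Node a ch') mu mu'.
Proof.
elim: n => [|n IH] ch ch' mu mu' Hch Er0 le.
  move=> q o /outc_node [Hs ->|q' m' Htr|q' m' Htr|q' m' i c Htr|q' m' i c q2 nu Htr] *;
    try by move: (leq_trans (tr_cnt Htr) le).
  by exists None => //; apply/outc_node; apply: OStuck => //; rewrite -Er0.
(* Matching outcomes up to all depths, in both directions, already gives equal types at every depth;
   the induction hypothesis is strengthened by this. *)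
have {}IH : forall ch ch' mu mu', chsim n ch ch' mu mu' -> mu [::] = mu' [::] ->
    cnt (mu [::]) <= n ->
    typ_all (Node a ch) (Node a ch') mu mu' /\
    omatch (typ_all (Node a ch) (Node a ch')) (Node a ch) (Node a ch') mu mu'.
  move=> ch1 ch1' nu nu' H1 H2 H3; split; last exact: IH.
  case=> // k; apply/typS_eq; split.
    by apply: omatch_imp (IH _ _ _ _ H1 H2 H3) => x y; apply.
  rewrite H2 in H3; apply: omatch_imp (IH _ _ _ _ (chsim_sym H1) (esym H2) H3) => x y.
  exact.
have Hlow m' : cnt m' < cnt (mu [::]) -> chsim n ch ch' (setm mu [::] m') (setm mu' [::] m').
  move=> _ i; move: (Hch i); case: (List.nth_error ch i) => [c|];
    case: (List.nth_error ch' i) => [c'|] //; exact: typ_down.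
have Hc m' : cnt m' < cnt (mu [::]) -> cnt m' <= n by move=> H; rewrite -ltnS; exact: leq_trans H le.
move=> q o /outc_node [Hs ->|q' m' Htr ->|q' m' Htr Ho|q' m' i c Htr Ec Ho ->|
   q' m' i c q2 nu Htr Ec Ho Ho2]; try have lt := tr_cnt Htr.
- by exists None => //; apply/outc_node; apply: OStuck => //; rewrite -Er0.
- exists (Some (q', setm mu' [::] m')).
    by apply/outc_node; apply: OExit; rewrite -?Er0; first exact: Htr.
  by split=> //; apply: (IH _ _ _ _ (Hlow _ lt) _ _).1 => //; exact: Hc.
- have [o' Ho' Hs] := (IH _ _ _ _ (Hlow _ lt) erefl (Hc _ lt)).2 q' o Ho.
  by exists o' => //; apply/outc_node; apply: OStay Ho'; rewrite -Er0.
- move: (Hch i); rewrite Ec; case Ec': (List.nth_error ch' i) => [c'|] // /typS_eq [Hm _].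
  have [o' Ho' Hs] := Hm _ _ Ho; case: o' Ho' Hs => [[]|] // Ho' _.
  by exists None => //; apply/outc_node; apply: OStuckIn Ec' Ho' _ => //; rewrite -Er0; exact: Htr.
- move: (Hch i); rewrite Ec; case Ec': (List.nth_error ch' i) => [c'|] // /typS_eq [Hm _].
  have [o' Ho' Hs] := Hm _ _ Ho; case: o' Ho' Hs => [[q2' nu']|] // Ho' [Eq En]; subst q2'.
  (* The child just left is matched one level lower by its outcome; the other children are unchanged
     and lose a level through [typ_down]. *)
  have Hj : chsim n ch ch' (join i.+1 (setm mu [::] m') nu) (join i.+1 (setm mu' [::] m') nu').
    move=> j; move: (Hlow _ lt j); rewrite /join /= eqSS; case: eqP => [->|_] //.
    by rewrite Ec Ec' => _; exact: En.
  have [o2 Ho2' Hs2] := (IH _ _ _ _ Hj erefl (Hc _ lt)).2 q2 o Ho2.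
  by exists o2 => //; apply/outc_node; apply: OChild Ec' Ho' Ho2'; rewrite -Er0; exact: Htr.
Qed.

Variables (top : M) (qi : Q).

(** The congruence needs depth at least [cnt top]; one level more makes the type a function of the
    entry state even if [cnt top] is 0, and the acceptance test reads that function. *)
Definition phi (t : T) : ty (cnt top).+1 := typ (cnt top).+1 t (fun _ => top).

Lemma phi_congr a ch ch' : map phi ch = map phi ch' -> phi (Node a ch) = phi (Node a ch').
Proof.
have half x x' : map phi x = map phi x' ->
    omatch (typ_all (Node a x) (Node a x')) (Node a x) (Node a x') (fun _ => top) (fun _ => top).
  move=> E; apply: (@typ_congr (cnt top).+1) => //.
  move=> i; elim: i x x' E => [|i IH] [|c x] [|c' x'] //= [Ec Et] //; exact: IH Et.
move=> E; apply/typS_eq; split.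
  by apply: omatch_imp (half _ _ E) => x y; apply.
by apply: omatch_imp (half _ _ (esym E)) => x y; apply.
Qed.

Lemma walker_regular : @regular Sigma (fun t => ~ exists o, outc t (fun _ => top) qi o).
Proof.
(* The children are represented by a classically chosen list with the same types; by [phi_congr] the
   choice does not influence the value. *)
pose alpha a (fs : seq (ty (cnt top).+1)) :=
  if pselect (exists ch, map phi ch = fs) is left H then phi (Node a (projT1 (cid H)))
  else phi (Node a [::]).
exists (ty (cnt top).+1), phi, alpha, (fun f => (f : {ffun Q -> {set _}}) qi == set0); split.
  move=> a ch; rewrite /alpha; case: pselect => [H|[]]; last by exists ch.
  by apply: phi_congr; rewrite (projT2 (cid H)).
move=> t _; rewrite /phi typE; split.
  move=> H; apply/eqP/setP => x; rewrite !inE; apply/negbTE/asboolP => -[o Ho _].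
  by apply: H; exists o.
move=> /eqP/setP H [o Ho]; have := H (omap (fun y => (y.1, typ (cnt top) t y.2)) o).
by rewrite !inE => /negbT/asboolP; apply; exists o.
Qed.

End Walker.

(** * From walks to the domain of a one-symbol system *)

Lemma nodes_enum (A : Type) (t : tree A) :
  exists2 l, uniq l & forall u, is_node t u = (u \in l).
Proof.
elim/tree_nested_ind: t => a ch IH.
suff [l ul Hl] : exists2 l, uniq l & forall u, (u \in l) =
    (if u is i.+1 :: u' then if List.nth_error ch i is Some c then is_node c u' else false
     else false).
  exists ([::] :: l); first by rewrite /= ul Hl.
  move=> [|i u]; rewrite inE // Hl /is_node /=; case: i => // i.
  by case: (List.nth_error ch i).
elim: IH => {ch} [|c ch [lc uc Hc] _ [l ul Hl]].
  by exists [::] => // -[|[|[|i]] u].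
pose sh (u : seq nat) := if u is i :: u' then i.+1 :: u' else [::].
have nl : [::] \notin l by rewrite Hl.
have shi : {in l &, injective sh}.
  by move=> [|i u] [|j v] //= _ _ [-> ->].
exists (map (cons 1) lc ++ map sh l).
  rewrite cat_uniq (map_inj_uniq (_ : injective (cons 1))) ?uc; last by move=> x y [].
  rewrite (map_inj_in_uniq shi) ul andbT /=; apply/hasPn => _ /mapP [v iv ->].
  apply/mapP => -[w _]; case: v iv => [|i v]; first by rewrite (negbTE nl).
  by rewrite Hl; case: i.
move=> [|i u]; rewrite mem_cat.
  apply/orP => -[/mapP [] //|/mapP [[|i v] iv] //]; by move: iv; rewrite (negbTE nl).
case: i => [|[|i]] /=.
- apply/orP => -[/mapP [] //|/mapP [[|i v] iv] //].
- rewrite (_ : _ \in map sh l = false) ?orbF.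
    by rewrite mem_map; [rewrite Hc|move=> x y []].
  by apply/mapP => -[[|i v] iv] //= [Ei]; move: iv; rewrite Hl -Ei.
- rewrite (_ : _ \in map (cons 1) lc = false) /=; last by apply/mapP => -[].
  rewrite -[List.nth_error _ _]/(List.nth_error ch i) -(Hl (i.+1 :: u)).
  by apply/mapP/idP => [[[|j v] jv //= [-> ->]]|iu] //; exists (i.+1 :: u).
Qed.

Lemma size_le_sum_count (T : Type) (I : eqType) (f : T -> I) (l : seq I) (s : seq T) :
  (forall x, List.In x s -> f x \in l) ->
  size s <= \sum_(u <- l) count (fun x => f x == u) s.
Proof.
elim: s => [|x s IH] H /=; first by [].
rewrite big_split /= -add1n; apply: leq_add; last by apply: IH => y iy; apply: H; right.
have := H x (or_introl erefl); elim: {H IH} l => //= u l IH.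
rewrite inE big_cons; case: eqP => //= _ /IH H; exact: leq_trans H (leq_addl _ _).
Qed.

Lemma In_rcons (A : Type) (x y : A) s : List.In x (rcons s y) -> List.In x s \/ x = y.
Proof. by elim: s => [|z s IH] /=; [case=> [->|//]; right|case=> [->|/IH []]; auto]. Qed.

Section DomainRegular.
Variables (Sigma : ranked_alphabet) (G : Type) (W : bsys Sigma G) (b : nat).
Hypothesis Hb : forall t, wf_tree (ra_rank Sigma) t -> forall rest,
  bchain t (bini W) rest -> forall u : seq nat,
  count (fun c : bconf W => c.1.1 == u) (bini W :: rest) <= b.

(** The second memory component is fuel: [b] units at every node, one of them spent per visit. By
    the visit bound the branches of [W] never lack fuel. *)
Definition btr (q : bQ W) (a : ra_sym Sigma) (m : bM W * nat) (q' : bQ W)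
    (m' : bM W * nat) (d : xdir) :=
  m.2 = m'.2.+1 /\ exists g ks, bact W q a m.1 = Some (g, ks) /\ List.In (q', m'.1, d) ks.

(** The remaining way to fail, leaving the root upwards, is an exit of the walk; the two kinds of
    outcome cover all failures of a branch. *)
Definition bstuck (q : bQ W) (a : ra_sym Sigma) (m : bM W * nat) :=
  bact W q a m.1 = None \/ exists g ks q' m' i,
    [/\ bact W q a m.1 = Some (g, ks), List.In (q', m', Some (Some i)) ks &
     ~~ (0 < i <= ra_rank Sigma a)].

Lemma btr_cnt q a m q' m' d : btr q a m q' m' d -> m'.2 < m.2.
Proof. by case=> ->. Qed.

Variable t : tree (ra_sym Sigma).
Hypothesis wft : wf_tree (ra_rank Sigma) t.

Local Notation top' := (fun _ : seq nat => (btop W, b)).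
Local Notation wC := (wconf (bQ W) (bM W * nat)).
Definition wproj (C : wC) : bconf W := (C.1, fun v => (C.2 v).1).

Lemma unf_wstep C C' s : wstep btr t C C' -> unf t (wproj C) s ->
  exists s', unf t (wproj C') s'.
Proof.
move: C C' => [[u q] mu] [[v q'] mu'] [a [m' [d [/= La [_ [g [ks [Ek ik]]]] Hm Emu]]]] U.
inversion U as [? g' cs ss Ec HF]; subst.
have [a' [ks' [La' Ek' HK]]] := (cstepP _ _ _ _ _ _).1 Ec.
move: La' Ek'; rewrite La => -[<-] /=; rewrite Ek => -[_ Eks]; subst ks'.
have [c ic [v' /= Hv Ev]] := Forall2_in_l HK ik.
have [s' _ Us] := Forall2_in_l HF ic.
exists s'; move: Hv; rewrite Hm => -[Evv]; subst v'; move: Us; rewrite Ev.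
have -> : setm (fun v => (mu v).1) u m'.1 = fun v => (setm mu u m' v).1.
  by apply/funext => w; rewrite /setm; case: eqP.
by [].
Qed.

Lemma unf_wreach n C C' : wreach btr t n C C' -> (exists s, unf t (wproj C) s) ->
  exists s, unf t (wproj C') s.
Proof.
elim: n C => [|n IH] C /=; first by move=> ->.
by case=> C1 [Hs Hr] [s U]; apply: IH Hr _; exact: unf_wstep Hs U.
Qed.

Lemma unf_ends C s o : unf t (wproj C) s -> ~ wends btr bstuck t C o.
Proof.
move: C => [[u q] mu] U; inversion U as [? g' cs ss Ec HF]; subst.
have [a [ks [La Ek HK]]] := (cstepP _ _ _ _ _ _).1 Ec.
case: o => [[q2 mu2] [a' [m' [/= Eu La' [_ [g [ks' [Ek' ik]]]] _]]]|[a' [/= La' Hs]]].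
  subst u; move: La' Ek'; rewrite La => -[<-] /=; rewrite Ek => -[_ Eks]; subst ks'.
  by have [c _ [v]] := Forall2_in_l HK ik.
move: La' Hs; rewrite La => -[<-] [|[g [ks' [q' [m' [i [Ek' ik Hi]]]]]]] /=.
  by rewrite Ek.
move: Ek'; rewrite /= Ek => -[_ Eks]; subst ks'.
have [c _ [v /= Hv _]] := Forall2_in_l HK ik.
by move/move_down: Hv Hi => [-> ]; rewrite (wf_child _ wft La) => ->.
Qed.

(** [belast] leaves out the current configuration, whose visit is not yet paid for. *)
Lemma bchain_wreach rest : bchain t (bini W) rest -> exists n mu,
  [/\ wreach btr t n (([::], binit W), top') ((last (bini W) rest).1, mu),
      forall v, (mu v).1 = (last (bini W) rest).2 v &
      forall v, (mu v).2 = b - count (fun c : bconf W => c.1.1 == v) (belast (bini W) rest)].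
Proof.
elim/last_ind: rest => [|rest c IH].
  by move=> _; exists 0, top'; split=> //= v; rewrite subn0.
move=> /[dup] Hch /bchain_rcons [Hc [g [cs [Ec ic]]]].
have [n [mu [Hr H1 H2]]] := IH Hc.
rewrite last_rcons belast_rcons.
case El : (last (bini W) rest) => [[u q] nu] in Ec Hr H1 H2 *; rewrite /= in Hr H1 H2.
have [a [ks [La Ek HK]]] := (cstepP _ _ _ _ _ _).1 Ec.
have [[[q' m'] d] ix [v Hv Ecc]] := Forall2_in_l (Forall2_sym HK) ic; subst c.
have Hcnt := Hb wft Hc u; rewrite lastI -cats1 count_cat /= El /= eqxx in Hcnt.
pose mu' := setm mu u (m', b - count (fun c : bconf W => c.1.1 == u) (bini W :: rest)).
exists (n + 1), mu'; split.
- apply: (wreach_cat Hr); exists (v, q', mu'); split=> //.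
  exists a, (m', b - count (fun c : bconf W => c.1.1 == u) (bini W :: rest)), d; split=> //.
  split; last by exists g, ks; rewrite H1.
  by rewrite H2 [in RHS]lastI -cats1 count_cat El /= eqxx; lia.
- by move=> w; rewrite /mu' /setm /=; case: eqP.
- move=> w; rewrite /mu' /setm; case: eqP => [->//|ne].
  rewrite H2 [in RHS]lastI -cats1 count_cat El /=.
  by rewrite (negbTE (introN eqP _)) ?addn0 // => E; case: ne.
Qed.

Lemma bchain_node rest : is_node t [::] -> bchain t (bini W) rest -> is_node t (last (bini W) rest).1.1.
Proof.
move=> n0; elim/last_ind: rest => // rest c IH /bchain_rcons [Hc [g [cs [Ec ic]]]].
rewrite last_rcons; have := IH Hc; case: (last _ _) Ec => [[u q] nu] Ec nu'.
have [a [ks [La Ek HK]]] := (cstepP _ _ _ _ _ _).1 Ec.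
have [[x d] ix [v Hv ->]] := Forall2_in_l (Forall2_sym HK) ic.
by case: d Hv {ix} => [d /(move_node nu')|[<-]].
Qed.

Lemma no_outc_step rest : ~ (exists o, outc btr bstuck t top' (binit W) o) ->
  bchain t (bini W) rest -> exists g cs, cstep t (last (bini W) rest) = Some (g, cs).
Proof.
move=> No Hch; have [n [mu [Hr H1 H2]]] := bchain_wreach Hch.
have nd := bchain_node (erefl : is_node t [::]) Hch.
have Hcnt := Hb wft Hch.
case El : (last (bini W) rest) => [[u q] nu] in nd Hr H1 H2 *; rewrite /= in nd Hr H1 H2.
have [a La] := (labP _ _).1 nd.
have Ends o : ~ wends btr bstuck t (u, q, mu) o.
  by move=> Ho; apply: No; exists o; exists n, (u, q, mu).
case Ek : (bact W q a (nu u)) => [[g ks]|]; last first.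
  by case: (Ends None); exists a; split=> //; left; rewrite /= H1.
have [cs HK] : exists cs : seq (bconf W), Forall2 (fun x C => exists2 v, xmove t u x.2 = Some v &
      C = (v, x.1.1, setm nu u x.1.2)) ks cs.
  apply: Forall2_ex => -[[q' m'] d] ix.
  suff [v Hv] : exists v, xmove t u d = Some v by exists (v, q', setm nu u m'); exists v.
  case: d ix => [[i|]|] ix /=; last by exists u.
    case: (boolP (0 < i <= ra_rank Sigma a)) => Hi.
      by exists (rcons u i); apply/move_down; rewrite (wf_child _ wft La).
    case: (Ends None); exists a; split=> //; right.
    by exists g, ks, q', m', i; rewrite /= H1.
  case/lastP: u Ek La ix Ends nd Hr El => [|u j] Ek La ix Ends nd Hr El; last first.
    by exists u; exact: move_up.
  case: (Ends (Some (q', setm mu [::] (m', (mu [::]).2.-1)))).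
  exists a, (m', (mu [::]).2.-1); split=> //=; split=> /=.
    rewrite prednK // H2 subn_gt0; apply: leq_trans (Hcnt [::]).
    by rewrite lastI -cats1 count_cat El /= addn1.
  by exists g, ks; rewrite H1.
exists g, cs; apply/cstepP; exists a, ks; split=> //.
Qed.

(** Without an outcome every branch can be prolonged; since a branch has at most [b] configurations
    per node of [t], the prolongation ends and the unfolding is finite. *)
Lemma unf_no_outc : (exists s, unf t (bini W) s) <->
  ~ exists o, outc btr bstuck t top' (binit W) o.
Proof.
split.
  move=> [s U] [o [n [C [Hr He]]]].
  have [|s' U'] := unf_wreach Hr; first by exists s.
  exact: unf_ends U' He.
move=> No; have [l ul Hl] := nodes_enum t.
suff H k rest : bchain t (bini W) rest -> size l * b <= size rest + k ->
    exists s, unf t (last (bini W) rest) s.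
  exact: (H (size l * b) [::]).
elim: k rest => [|k IH] rest Hch Hsz; last first.
  have [g [cs Ec]] := no_outc_step No Hch.
  have [ss HF] : exists ss, Forall2 (unf t) cs ss.
    apply: Forall2_ex => c ic; have := IH (rcons rest c); rewrite last_rcons; apply.
      by apply/bchain_rcons; split=> //; exists g, cs.
    by rewrite size_rcons; lia.
  by exists (Node g ss); exact: Unf Ec HF.
(* In the base case the chain has one configuration more than the visit bounds of all nodes together
   allow. *)
have Hin : forall c : bconf W, List.In c (bini W :: rest) -> c.1.1 \in l.
  move=> c ic; rewrite -Hl; elim/last_ind: rest Hch ic {Hsz} => [_ [<-|//] //|rest d IHr Hch].
  move=> Hi; have [|->] := @In_rcons _ c d (bini W :: rest) Hi.
    by apply: IHr; case/bchain_rcons: Hch.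
  by have := bchain_node (erefl : is_node t [::]) Hch; rewrite last_rcons.
have := size_le_sum_count Hin.
have : \sum_(u <- l) count (fun c : bconf W => c.1.1 == u) (bini W :: rest) <= size l * b.
  elim: {Hin Hl Hsz ul} l => [|u l IHl]; rewrite ?big_nil // big_cons mulSn.
  exact: leq_add (Hb wft Hch u) IHl.
by move=> H1 H2; have := leq_trans (leq_trans H2 H1) Hsz; rewrite /= addn0 ltnn.
Qed.

End DomainRegular.

Lemma domain_regular (Sigma : ranked_alphabet) (G : Type) (W : bsys Sigma G) (b : nat) :
  (forall t, wf_tree (ra_rank Sigma) t -> forall rest,
    bchain t (bini W) rest -> forall u : seq nat,
    count (fun c : bconf W => c.1.1 == u) (bini W :: rest) <= b) ->
  regular (fun t => exists s, unf t (bini W) s).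
Proof.
move=> Hb; have [F [phi [alpha [acc [H1 H2]]]]] :=
  walker_regular (bstuck (W := W)) (@btr_cnt _ _ W) (btop W, b) (binit W).
exists F, phi, alpha, acc; split=> // t wft.
by rewrite -(H2 t wft); exact: unf_no_outc.
Qed.

(** * Machines with stay moves that know the index of the current child *)

Fixpoint xout_wf (G A : Type) (rk : G -> nat) (t : tree (G + A)) : bool :=
  let 'Node x ch := t in
  match x with
  | inl g => (size ch == rk g) && all (xout_wf rk) ch
  | inr _ => size ch == 0
  end.

Lemma xout_wf_leaves (G A : Type) (rk : G -> nat) (t : tree (G + A)) :
  xout_wf rk t -> wf_leaves t.
Proof.
elim/tree_nested_ind: t => [[g|a] ch] IH //= /andP[_].
by elim: IH => //= c l Hc _ IHl /andP[/Hc -> /IHl].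
Qed.

Lemma srel_xout_wf (G A B : Type) (rk : G -> nat) (R : A -> B -> Prop) t t' :
  srel R t t' -> xout_wf rk t -> xout_wf rk t'.
Proof.
move=> H; elim/srel_ind2: t t' / H => // g ch ch' HF IH /= /andP[sz Hch].
rewrite -(Forall2_size HF) sz /=.
by elim: {HF sz} IH Hch => //= c c' l l' Hc _ IHl /andP[/Hc -> /IHl].
Qed.

Lemma out_wfP (G X : Type) (rk : G -> nat) r (t : tree (G + X * dir)) :
  out_wf rk r t <-> xout_wf rk t /\ forall b, List.In b (leaves t) -> vdir r b.2.
Proof.
split.
  move=> W; split; last by case=> x [i|] // /(out_wf_dir W).
  elim/tree_nested_ind: t W => [[g|[x d]] ch] IH /= /andP[sz H] //.
  by rewrite sz /=; elim: IH H {sz} => //= c l Hc _ IHl /andP[/Hc -> /IHl].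
elim/tree_nested_ind: t => [[g|[x d]] ch] IH /= [].
  move=> /andP[-> Hch] H /=; elim: IH Hch H => //= c l Hc _ IHl /andP[Wc Wl] H.
  apply/andP; split.
    by apply: Hc; split=> // b ib; apply: H; apply/List.in_or_app; left.
  by apply: IHl => // b ib; apply: H; apply/List.in_or_app; right.
by move=> -> H; exact: (H (x, d) (or_introl erefl)).
Qed.

(** The [nat] argument of [xdelta] receives the index of the current node among its siblings, 0 at
    the root. It is needed to undo an up-move of [H], which means going down to the child with that
    index. *)
Record xmachine (Sigma Xi : ranked_alphabet) := XMachine {
  xQ : finType;
  xM : finType;
  xtop : xM;
  xqi : xQ;
  xdelta : xQ -> ra_sym Sigma -> nat -> xM -> option (tree (ra_sym Xi + (xQ * xM) * xdir));
  xdelta_wf : forall q a k m tau, xdelta q a k m = Some tau -> xout_wf (ra_rank Xi) tau }.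
Arguments xdelta {Sigma Xi} x _ _ _ _.

Section XStep.
Variables (Sigma Xi : ranked_alphabet) (X : xmachine Sigma Xi).

Definition xconf : Type := ((seq nat * xQ X) * (seq nat -> xM X))%type.

Definition xini : xconf := ([::], xqi X, fun _ => xtop X).

Definition xstep (t : tree (ra_sym Sigma)) (C : xconf) : option (tree (ra_sym Xi + xconf)) :=
  let '(u, q, mu) := C in
  if lab t u is Some a then
    if xdelta X q a (last 0 u) (mu u) is Some tau then
      tmap_opt (fun x => match x with
        | inl g => Some (inl g)
        | inr y => omap (fun v => inr (v, y.1.1, setm mu u y.1.2)) (xmove t u y.2)
        end) tau
    else None
  else None.

Lemma xstepP t u q (mu : seq nat -> xM X) tau' :
  xstep t (u, q, mu) = Some tau' <->
  exists a tau, [/\ lab t u = Some a, xdelta X q a (last 0 u) (mu u) = Some tau &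
    srel (fun y C => exists2 v, xmove t u y.2 = Some v &
       C = (v, y.1.1, setm mu u y.1.2)) tau tau'].
Proof.
rewrite /xstep; case: (lab t u) => [a|]; last by split=> // -[? [? []]].
case E: (xdelta X q a _ (mu u)) => [tau|]; last by split=> // -[? [? [[<-]]]]; rewrite E.
pose f (y : xQ X * xM X * xdir) : option xconf :=
  omap (fun v => (v, y.1.1, setm mu u y.1.2)) (xmove t u y.2).
rewrite (@tmap_optP _ _ _ _ f) //; first last.
- exact: xout_wf_leaves (xdelta_wf E).
- by move=> y; rewrite /f /=; case: (xmove t u y.2).
have fP y C : f y = Some C <-> exists2 v, xmove t u y.2 = Some v &
   C = (v, y.1.1, setm mu u y.1.2).
  rewrite /f; case: (xmove t u y.2) => [v|]; split=> //=; try by case.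
  - by case=> <-; exists v.
  - by case=> v' [<-] ->.
split.
  move=> H; exists a, tau; split=> //.
  by apply: srel_imp_in H => x C _ _ /fP.
case=> a' [tau2 [[<-]]]; rewrite E => -[<-] H.
by apply: srel_imp_in H => x C _ _ H; apply/fP.
Qed.

End XStep.
Arguments xstep : simpl never.

Section XMoves.
Variables (Sigma : ranked_alphabet) (t : tree (ra_sym Sigma)).

Lemma xmove_inj u d d' v : xmove t u d = Some v -> xmove t u d' = Some v -> d = d'.
Proof.
case: d d' => [[i|]|] [[j|]|] //=.
- by move=> /move_down [-> _] /move_down [/rcons_inj [->]].
- move=> /move_down [-> _] /move_upP [k /(congr1 size)]; rewrite !size_rcons; lia.
- move=> /move_down [-> _] [/(congr1 size)]; rewrite !size_rcons; lia.
- move=> /[swap] /move_down [-> _] /move_upP [k /(congr1 size)]; rewrite !size_rcons; lia.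
- move=> /move_upP [k ->] [/(congr1 size)]; rewrite !size_rcons; lia.
- move=> [->] /move_down [/(congr1 size)]; rewrite !size_rcons; lia.
- move=> [->] /move_upP [k /(congr1 size)]; rewrite !size_rcons; lia.
Qed.

Definition back (u : seq nat) (d : xdir) : xdir :=
  match d with
  | None => None
  | Some None => Some (Some (last 0 u))
  | Some (Some _) => Some None
  end.

Lemma back_ok u d v : is_node t u -> xmove t u d = Some v ->
  xmove t v (back u d) = Some u.
Proof.
case: d => [[i|]|] nu /=.
- by move=> /move_down [-> _]; exact: move_up.
- by move=> /move_upP [k Eu]; subst u; rewrite last_rcons; apply/move_down.
- by case=> ->.
Qed.

End XMoves.

(** * The log distributed over the input tree *)

Section StepC.
Variables (Sigma Gamma Xi : ranked_alphabet) (W : bsys Sigma (ra_sym Gamma)).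
Variables (N : uTHM Gamma Xi) (cap : nat).
Hypothesis Wrank : forall p a m g ks, bact W p a m = Some (g, ks) -> size ks = ra_rank Gamma g.

Definition rmax (A : ranked_alphabet) := \max_(a : ra_sym A) ra_rank A a.

Lemma rmax_le (A : ranked_alphabet) (a : ra_sym A) : ra_rank A a <= rmax A.
Proof. exact: (@leq_bigmax _ (fun a => ra_rank A a)). Qed.

(** The name of a node of [s] relative to the place of its record: the direction to the record of
    its parent, the slot of that record, and the child number. [None] names the root of [s]. *)
Definition ckey : finType :=
  option (option (option 'I_(rmax Sigma).+1) * 'I_cap * 'I_(rmax Gamma).+1).
Definition crec : finType := (ckey * bQ W * bM W * hM N)%type.
Definition cmem : finType := (bM W * {ffun 'I_cap -> option crec})%type.
(** The second component tells how [N] arrives: from above, with the state of [H] and the key of the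
    node, or from below, with the slot of the record to resume. *)
Definition cstate : finType := (hQ N * (bQ W * ckey + 'I_cap))%type.

Definition code (d : xdir) : option (option 'I_(rmax Sigma).+1) := omap (omap inord) d.
Definition decode (e : option (option 'I_(rmax Sigma).+1)) : xdir :=
  omap (omap (@nat_of_ord _)) e.

Definition fset (recs : {ffun 'I_cap -> option crec}) i r : {ffun 'I_cap -> option crec} :=
  [ffun i' => if i' == i then r else recs i'].

(** Arriving from below resets the memory of [H] at this node to its value before the recorded step.
    The records stay, so a later descent finds them again by their keys. *)
Definition arrive (md : bQ W * ckey + 'I_cap) (m : cmem) : option ('I_cap * cmem) :=
  match md with
  | inl (p, key) =>
      if [pick i | if m.2 i is Some r then r.1.1.1 == key else false] is Some i
      then Some (i, m)
      else if [pick i | m.2 i == None] is Some i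
      then Some (i, (m.1, fset m.2 i (Some (key, p, m.1, htop N))))
      else None
  | inr i => if m.2 i is Some r then Some (i, (r.1.2, m.2)) else None
  end.

(** [back] reads only the last index of a node, so [[:: u]] serves as a node with index [u]. *)
Definition cleaf (u : nat) i (key : ckey) (p : bQ W) (pre : bM W)
    (recs : {ffun 'I_cap -> option crec}) (ks : seq (bQ W * bM W * xdir))
    (y : hQ N * hM N * dir) : option (cstate * cmem * xdir) :=
  let recs' := fset recs i (Some (key, p, pre, y.1.2)) in
  match y.2 with
  | Some j =>
      if List.nth_error ks j.-1 is Some x then
        Some ((y.1.1, inl (x.1.1, Some (code (back [:: u] x.2), i, inord j))),
              (x.1.2, recs'), x.2)
      else None
  | None =>
      if key is Some z then Some ((y.1.1, inr z.1.2), (pre, recs'), decode z.1.1)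
      else None
  end.

Definition clift u i key p pre recs ks (x : ra_sym Xi + (hQ N * hM N) * dir) :
    option (ra_sym Xi + (cstate * cmem) * xdir) :=
  match x with
  | inl g => Some (inl g)
  | inr y => omap inr (cleaf u i key p pre recs ks y)
  end.

Definition cdelta (q : cstate) (a : ra_sym Sigma) (k : nat) (m : cmem) :=
  if arrive q.2 m is Some (i, (cur, recs)) then
    if recs i is Some (key, p, pre, nm) then
      if bact W p a pre is Some (g, ks) then
        if hdelta N q.1 g nm is Some tau then
          tmap_opt (clift k i key p pre recs ks) tau
        else None
      else None
    else None
  else None.

Lemma tmap_clift u i key p pre recs ks g nm q tau tau' : hdelta N q g nm = Some tau ->
  tmap_opt (clift u i key p pre recs ks) tau = Some tau' <->
  srel (fun y l => cleaf u i key p pre recs ks y = Some l) tau tau'.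
Proof.
move=> E; apply: tmap_optP => //; exact: out_wf_leaves (hdelta_wf E).
Qed.

Lemma cdelta_wf q a k m tau : cdelta q a k m = Some tau -> xout_wf (ra_rank Xi) tau.
Proof.
rewrite /cdelta; case: (arrive _ _) => [[i [cur recs]]|] //.
case: (recs i) => [[[[key p] pre] nm]|] //; case: (bact W p a pre) => [[g ks]|] //.
case E: (hdelta N q.1 g nm) => [tau0|] // /(tmap_clift _ _ _ _ _ _ _ _ E) S.
by apply: srel_xout_wf S _; case: ((out_wfP _ _ _).1 (hdelta_wf E)).
Qed.

Definition sim_machine : xmachine Sigma Xi :=
  @XMachine Sigma Xi cstate cmem (btop W, [ffun=> None]) (hqinit N, inl (binit W, None))
    cdelta cdelta_wf.

Variables (t : tree (ra_sym Sigma)) (s : tree (ra_sym Gamma)).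
Hypothesis wft : wf_tree (ra_rank Sigma) t.
Hypothesis Us : unf t (bini W) s.

Fixpoint conf_at (c : bconf W) (x : seq nat) : option (bconf W) :=
  if x is j :: x' then
    if cstep t c is Some (_, cs) then
      if j is j'.+1 then
        if List.nth_error cs j' is Some c' then conf_at c' x' else None
      else None
    else None
  else Some c.

Lemma unf_at c s0 x g ss : unf t c s0 -> subt s0 x = Some (Node g ss) ->
  exists c', conf_at c x = Some c' /\ unf t c' (Node g ss).
Proof.
elim: x c s0 => [|j x IH] c s0 U /=; first by case=> <-; exists c.
inversion U as [? g' cs ss' Ec HF]; subst; rewrite Ec; case: j => // j /=.
case Es: (List.nth_error ss' j) => [s'|] // Hs.
have [c' -> U'] := Forall2_nth (Forall2_sym HF) Es; exact: IH Hs.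
Qed.

Lemma conf_at_rcons c x j : conf_at c (rcons x j) =
  if conf_at c x is Some c' then
    if cstep t c' is Some (_, cs) then
      if j is j'.+1 then List.nth_error cs j' else None
    else None
  else None.
Proof.
elim: x c => [|i x IH] c /=.
  case: (cstep t c) => [[g cs]|] //; case: j => // j.
  by case: (List.nth_error cs j).
case: (cstep t c) => [[g cs]|] //; case: i => // i.
by case: (List.nth_error cs i).
Qed.

Definition cf x := conf_at (bini W) x.

Lemma cf_node x : is_node s x -> exists u p mu a g ks,
  [/\ cf x = Some (u, p, mu), lab t u = Some a, bact W p a (mu u) = Some (g, ks),
    lab s x = Some g &
    (forall j y, List.nth_error ks j = Some y -> exists v,
      [/\ xmove t u y.2 = Some v, cf (rcons x j.+1) = Some (v, y.1.1, setm mu u y.1.2)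
        & is_node s (rcons x j.+1)]) /\
    (forall j, is_node s (rcons x j) -> exists2 y, List.nth_error ks j.-1 = Some y & 0 < j <= size ks)].
Proof.
move=> /labP [g Lx]; have [ss Es] := lab_subt Lx.
have [[[u p] mu] [Ex U]] := unf_at Us Es.
inversion U as [? ? cs ? Ec HF]; subst.
have [a [ks [La Ek HK]]] := (cstepP _ _ _ _ _ _).1 Ec.
exists u, p, mu, a, g, ks; split=> //; split=> [j y Hj|j]; last first.
  rewrite /is_node (subt_rcons _ Es); case: j => // j.
  rewrite nth_error_size -(Forall2_size HF) -(Forall2_size HK) => lt.
  have := nth_error_size ks j; rewrite lt /=.
  by case: (List.nth_error ks j) => [y|] // _; exists y.
have [c Hc [v Hv EC]] := Forall2_nth HK Hj; exists v; split=> //.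
  by rewrite /cf conf_at_rcons -/(cf x) /cf Ex Ec Hc EC.
have [s' Hs' _] := Forall2_nth HF Hc.
by rewrite /is_node (subt_rcons _ Es) Hs'.
Qed.

(* [gh v i]: the node of [s] whose record is stored in slot [i] at the node [v]. *)
Definition ghost := seq nat -> 'I_cap -> option (seq nat).

Definition key_ok (gh : ghost) (v z : seq nat) (key : ckey) : Prop :=
  (z = [::] /\ key = None) \/
  exists z' j e i v', [/\ z = rcons z' j, key = Some (code e, i, inord j),
    xmove t v e = Some v' & gh v' i = Some z'].

(** By [gi_new] a node without a record still has the initial memory of [N], so creating records on
    demand loses nothing. *)
Record ginv (nu : seq nat -> cmem) (mu1 : seq nat -> hM N) (gh : ghost) : Prop := GInv {
  gi_dom : forall v i, (nu v).2 i = None <-> gh v i = None;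
  gi_rec : forall v i z, gh v i = Some z -> is_node s z /\ exists p mu key,
     [/\ cf z = Some (v, p, mu), (nu v).2 i = Some (key, p, mu v, mu1 z) & key_ok gh v z key];
  gi_new : forall z, (forall v i, gh v i <> Some z) -> mu1 z = htop N;
  gi_inj : forall v i i' z, gh v i = Some z -> gh v i' = Some z -> i = i' }.

Definition gpos (z : seq nat) : option (seq nat) := omap (fun c : bconf W => c.1.1) (cf z).

Definition gcard (gh : ghost) v := #|[pred i | gh v i != None]|.

(** When [N] comes from below, the memory of [H] at the current node has not yet been reset; it is
    therefore exempt until [arrive] has acted. *)
Definition mode_ok (gh : ghost) (u x : seq nat) (p : bQ W) (mu : seq nat -> bM W)
    (nu : seq nat -> cmem) (md : bQ W * ckey + 'I_cap) : Prop :=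
  match md with
  | inl (p', key) => [/\ p' = p, forall v, (nu v).1 = mu v & key_ok gh u x key]
  | inr i => gh u i = Some x /\ forall v, v <> u -> (nu v).1 = mu v
  end.

(** Records at a node are charged to earlier positions of [N]; the current position is left out
    because its arrival may create one more record. *)
Definition crel (C : config N) (D : xconf sim_machine) : Prop :=
  let '(x, q, mu1) := C in let '(u, qx, nu) := D in
  [/\ qx.1 = q, is_node s x & exists p mu gh rest,
    [/\ cf x = Some (u, p, mu), ginv nu mu1 gh, mode_ok gh u x p mu nu qx.2,
      gchain (step s) (init_config N) rest /\ last (init_config N) rest = C &
      forall v, gcard gh v <=
        count (fun C : config N => gpos C.1.1 == Some v) (belast (init_config N) rest)]].

Hypothesis Hcap : forall rest, gchain (step s) (init_config N) rest -> forall v : seq nat,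
  count (fun C : config N => gpos C.1.1 == Some v) (init_config N :: rest) <= cap.

Lemma code_bound u e v : is_node t u -> xmove t u e = Some v -> decode (code e) = e.
Proof.
case: e => [[k|]|] //= nu /move_down [-> nk]; rewrite inordK //.
have [a La] := (labP _ _).1 nu; move: nk; rewrite (wf_child _ wft La) => /andP[_ H].
by rewrite ltnS; apply: leq_trans H (rmax_le _).
Qed.

Lemma child_bound z j : is_node s (rcons z j) -> nat_of_ord (inord j : 'I_(rmax Gamma).+1) = j.
Proof.
move=> n; have [u [p [mu [a [g [ks [_ _ Ek _ [_ Hn]]]]]]]] := cf_node (is_node_rcons n).
have [_ _ /andP[_ le]] := Hn _ n; rewrite inordK // ltnS.
by apply: leq_trans (rmax_le g); rewrite -(Wrank Ek).
Qed.

Lemma cf_pos_node x u p mu : is_node s x -> cf x = Some (u, p, mu) -> is_node t u.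
Proof.
move=> /cf_node [u' [p' [mu' [a [g [ks [-> La _ _ _]]]]]]] [<- _ _].
by apply/labP; exists a.
Qed.

(** Together with [key_ok_fun]: at a fixed node of [t] a key determines the node of [s] and
    conversely, so a search for the key finds the record of that very node. *)
Lemma key_ok_inj nu mu1 gh u z x key : ginv nu mu1 gh -> is_node t u ->
  is_node s z -> is_node s x ->
  key_ok gh u z key -> key_ok gh u x key -> z = x.
Proof.
move=> G nu' nz nx [[-> ->]|[z' [j [e [i [v [Ez -> He Hg]]]]]]]
  [[->]|[x' [j' [e' [i' [v' [Ex Ek He' Hg']]]]]]] //.
case: Ek => /(congr1 decode) Ee Ei Ej; subst z x i'.
move: Ee; rewrite (code_bound nu' He) (code_bound nu' He') => Ee; subst e'.
move: He'; rewrite He => -[Ev]; subst v'; move: Hg'; rewrite Hg => -[->].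
by move/(congr1 (@nat_of_ord _)): Ej; rewrite (child_bound nz) (child_bound nx) => ->.
Qed.

(** The parent is produced at one node of [t] and has one slot there by [gi_inj], and only one
    direction leads to that node. *)
Lemma key_ok_fun nu mu1 gh u x key key' : ginv nu mu1 gh ->
  key_ok gh u x key -> key_ok gh u x key' -> key = key'.
Proof.
move=> G [[-> ->]|[z' [j [e [i [v [Ez -> He Hg]]]]]]]
  [[Ex ->]|[x' [j' [e' [i' [v' [Ex -> He' Hg']]]]]]] //.
- by case: (x') Ex.
- by move: Ez; rewrite Ex; case: (z').
move: Ex; rewrite Ez => /rcons_inj [Ex Ej]; subst x' j'.
have [_ [p [mu [k1 [Ec _ _]]]]] := gi_rec G Hg.
have [_ [p' [mu' [k1' [Ec' _ _]]]]] := gi_rec G Hg'.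
move: Ec'; rewrite Ec => -[Ev _ _]; subst v'.
by rewrite (xmove_inj He He') (gi_inj G Hg Hg').
Qed.

Lemma key_ok_ext (gh gh' : ghost) u x key :
  (forall v i z, gh v i = Some z -> gh' v i = Some z) ->
  key_ok gh u x key -> key_ok gh' u x key.
Proof.
move=> H [?|[z' [j [e [i [v [Ez Ek He Hg]]]]]]]; first by left.
by right; exists z', j, e, i, v; split=> //; exact: H.
Qed.

Lemma ginv_cur nu nu' mu1 gh : (forall v, (nu' v).2 = (nu v).2) ->
  ginv nu mu1 gh -> ginv nu' mu1 gh.
Proof.
move=> E [H1 H2 H3 H4]; split=> //; first by move=> v i; rewrite E.
move=> v i z /H2 [nz [p [mu [key [Ez Er Ek]]]]]; split=> //.
by exists p, mu, key; rewrite E.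
Qed.

Lemma arrive_ok x q mu1 u qx nu : crel (x, q, mu1) (u, qx, nu) ->
  exists p mu rest i m gh,
    [/\ cf x = Some (u, p, mu), arrive qx.2 (nu u) = Some (i, m),
        ginv (setm nu u m) mu1 gh & gh u i = Some x] /\
    [/\ forall v, (setm nu u m v).1 = mu v,
      gchain (step s) (init_config N) rest,
      last (init_config N) rest = (x, q, mu1) &
      forall v, gcard gh v <=
        count (fun C : config N => gpos C.1.1 == Some v) (init_config N :: rest)].
Proof.
move=> [Eq nx [p [mu [gh [rest [Ex G Hm [Hc El] Hcard]]]]]].
have Hcnt v : count (fun C : config N => gpos C.1.1 == Some v) (init_config N :: rest) =
   count (fun C : config N => gpos C.1.1 == Some v) (belast (init_config N) rest) + (v == u).
  by rewrite lastI -cats1 count_cat El /= addn0 /gpos Ex /= (inj_eq Some_inj) eq_sym.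
have Hcard' v : gcard gh v <=
    count (fun C : config N => gpos C.1.1 == Some v) (init_config N :: rest).
  by rewrite Hcnt; apply: leq_trans (Hcard v) (leq_addr _ _).
exists p, mu, rest; case: (qx.2) Hm => [[p' key]|i] /=; last first.
  case=> Hg Hcur; have [_ [p' [mu' [key [Ex' Er Ek]]]]] := gi_rec G Hg.
  move: Ex'; rewrite Ex => -[Ep Emu]; subst p' mu'.
  exists i, (mu u, (nu u).2), gh; rewrite Er; split; split=> //.
    by apply: ginv_cur G => v; rewrite /setm; case: eqP => [->|].
  by move=> v; rewrite /setm; case: eqP => [->//|]; exact: Hcur.
case=> Ep Hcur Hk; subst p'.
have nu' := cf_pos_node nx Ex.
case: pickP => [i|Hno1].
  case Er: ((nu u).2 i) => [[[[key' p'] pre] nm]|] //= /eqP Ek; subst key'.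
  have [z Hz] : exists z, gh u i = Some z.
    by case Hz: (gh u i) => [z|]; [exists z|move/(gi_dom G): Hz; rewrite Er].
  have [nz [p2 [mu2 [key2 [Ez Er2 Ek2]]]]] := gi_rec G Hz.
  move: Er2; rewrite Er => -[Ekk Ep2 Epre Enm]; rewrite -Ekk in Ek2.
  have Ezx := key_ok_inj G nu' nz nx Ek2 Hk; subst z.
  by exists i, (nu u), gh; rewrite setm_id; split; split.
have Hnew v i : gh v i <> Some x.
  move=> Hg; have [_ [p' [mu' [key' [Ex' Er Ek']]]]] := gi_rec G Hg.
  move: Ex'; rewrite Ex => -[Ev Ep Emu]; subst v p' mu'.
  have Ek := key_ok_fun G Ek' Hk; subst key'.
  by have := Hno1 i; rewrite Er /= eqxx.
case: pickP => [i /eqP Hi|Hno2]; last first.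
  (* If all slots were taken, the earlier visits would already number [cap], and the present one
     would exceed the bound. *)
  have Hall : gcard gh u = cap.
    rewrite /gcard -[RHS]card_ord; apply: eq_card => i; rewrite !inE.
    by apply/eqP => /(gi_dom G) /eqP; rewrite (Hno2 i).
  have := leq_trans (Hcap Hc u) (eq_leq (esym Hall)); rewrite Hcnt eqxx addn1.
  by move=> /leq_trans /(_ (Hcard u)); rewrite ltnn.
pose gh' : ghost := fun v i' => if (v == u) && (i' == i) then Some x else gh v i'.
have Hgi : gh u i = None by apply/(gi_dom G).
have Hext v i' z : gh v i' = Some z -> gh' v i' = Some z.
  by rewrite /gh'; case: eqP => [->|] //=; case: eqP => [->|] //; rewrite Hgi.
exists i, ((nu u).1, fset (nu u).2 i (Some (key, p, (nu u).1, htop N))), gh'.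
split; split=> //.
- split.
  + move=> v i'; rewrite /setm /gh'; case: eqP => [->|_] /=; last exact: (gi_dom G).
    by rewrite ffunE; case: eqP => // _; exact: (gi_dom G).
  + move=> v i' z; rewrite {1}/gh' /setm; case: eqP => [->|_] /=; last first.
      move=> /(gi_rec G) [nz [p' [mu' [key' [Ez Er Ek]]]]]; split=> //.
      by exists p', mu', key'; split=> //; exact: key_ok_ext Hext Ek.
    rewrite ffunE; case: eqP => [_ [<-]|_].
      split=> //; exists p, mu, key; split=> //; last exact: key_ok_ext Hext Hk.
      by rewrite Hcur (gi_new G).
    move=> /(gi_rec G) [nz [p' [mu' [key' [Ez Er Ek]]]]]; split=> //.
    by exists p', mu', key'; split=> //; exact: key_ok_ext Hext Ek.
  + by move=> z Hz; apply: (gi_new G) => v i' Hg; exact: (Hz v i' (Hext _ _ _ Hg)).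
  + move=> v i1 i2 z; rewrite /gh'; case: eqP => [->|_] /=; last exact: (gi_inj G).
    case: eqP => [->|_]; case: eqP => [->|_] //; last exact: (gi_inj G).
      by case=> <- /Hnew.
    by move=> /[swap] -[<-] /Hnew.
- by rewrite /gh' !eqxx.
- by move=> v; rewrite /setm; case: eqP => [->|_]; rewrite /= Hcur.
- move=> v; change (gcard gh' v <= count (fun C : config N => gpos C.1.1 == Some v)
    (init_config N :: rest)).
  rewrite Hcnt; case: eqP => [->|ne]; last first.
    rewrite addn0; apply: leq_trans (Hcard v); apply: eq_leq; apply: eq_card => i'.
    by rewrite !inE /gh' (introF eqP ne).
  apply: leq_trans (_ : gcard gh u + 1 <= _); last by rewrite leq_add2r.
  rewrite /gcard addn1; apply: leq_trans (_ : #|[predU1 i & [pred i' | gh u i' != None]]| <= _).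
    by apply: subset_leq_card; apply/subsetP => i'; rewrite !inE /gh' eqxx /=; case: (i' == i).
  by rewrite cardU1 -addn1 addnC leq_add2l; case: (_ \notin _).
Qed.

Lemma leaf_ok x q mu1 u (nu : seq nat -> xM sim_machine) p mu rest i key m recs gh a g ks
    (y : hQ N * hM N * dir) x' :
  cf x = Some (u, p, mu) -> is_node s x ->
  ginv (setm nu u (m, recs)) mu1 gh -> gh u i = Some x ->
  (forall v, (setm nu u (m, recs) v).1 = mu v) ->
  gchain (step s) (init_config N) rest ->
  last (init_config N) rest = (x, q, mu1) ->
  (forall v, gcard gh v <=
     count (fun C : config N => gpos C.1.1 == Some v) (init_config N :: rest)) ->
  recs i = Some (key, p, mu u, mu1 x) -> key_ok gh u x key ->
  lab t u = Some a -> bact W p a (mu u) = Some (g, ks) ->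
  move s x y.2 = Some x' ->
  (exists tau, step s (x, q, mu1) = Some tau /\
     List.In (x', y.1.1, setm mu1 x y.1.2) (leaves tau)) ->
  exists l v, [/\ cleaf (last 0 u) i key p (mu u) recs ks y = Some l,
    xmove t u l.2 = Some v &
    crel (x', y.1.1, setm mu1 x y.1.2) (v, l.1.1, setm nu u l.1.2)].
Proof.
move=> Ex nx G Hg Hcur Hc El Hcard Er Hk La Ek Hmv [tau [Est iC]].
have nu' := cf_pos_node nx Ex.
pose recs' := fset recs i (Some (key, p, mu u, y.1.2)).
have Gen m' : ginv (setm nu u (m', recs')) (setm mu1 x y.1.2) gh.
  case: G => H1 H2 H3 H4; split=> //.
  - move=> v i'; move: (H1 v i'); rewrite /setm; case: eqP => [->|_] //=.
    by rewrite ffunE; case: eqP => [->|] //; rewrite Hg; split.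
  - move=> v i' z Hz; have [nz [p' [mu' [key' [Ez Er' Ek']]]]] := H2 _ _ _ Hz.
    split=> //; exists p', mu', key'; split=> //; move: Er'; rewrite {1 2}/setm.
    case: eqP => [Ev|ne] /=.
      subst v; rewrite ffunE; case: eqP => [Ei|ni]; first subst i'.
        move: Hz; rewrite Hg => -[Exz]; subst z; rewrite Er => -[-> -> ->].
        by rewrite setm_eq.
      rewrite /setm; case: eqP => // Ezx _; case: ni.
      by apply: H4 Hz _; rewrite Ezx.
    rewrite /setm; case: eqP => // Ezx _; case: ne.
    by move: Ez; rewrite Ezx Ex => -[->].
  - move=> z Hz; rewrite /setm; case: eqP => [Ez|_]; last exact: H3.
    by case: (Hz u i); rewrite Hg Ez.
have Rst : gchain (step s) (init_config N) (rcons rest (x', y.1.1, setm mu1 x y.1.2)) /\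
    last (init_config N) (rcons rest (x', y.1.1, setm mu1 x y.1.2)) =
      (x', y.1.1, setm mu1 x y.1.2).
  by rewrite last_rcons; split=> //; apply/gchain_rcons; split=> //; exists tau; rewrite El.
have nx' := move_node nx Hmv.
case Ed : y.2 Hmv => [j|].
  move/move_down => [Ex' _]; subst x'.
  have [u2 [p2 [mu2 [a2 [g2 [ks2 [Ex2 La2 Ek2 Ls [Hks Hn]]]]]]]] := cf_node nx.
  move: Ex2; rewrite Ex => -[Eu Ep Emu]; subst u2 p2 mu2.
  move: La2; rewrite La => -[Ea]; subst a2; move: Ek2; rewrite Ek => -[Eg Eks]; subst g2 ks2.
  have [z Hz /andP[j0 _]] := Hn _ nx'; have Ej : j = j.-1.+1 by rewrite prednK.
  have [v [Hv Ecf _]] := Hks _ _ Hz; rewrite -Ej in Ecf.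
  rewrite /cleaf Ed Hz; eexists; exists v; split; [by []|exact: Hv|].
  split=> //=; exists z.1.1, (setm mu u z.1.2), gh, (rcons rest (rcons x j, y.1.1, setm mu1 x y.1.2)).
  split=> //; last by rewrite belast_rcons.
  split=> //.
    move=> w; move: (Hcur w); rewrite /setm; case: eqP => //.
  right; exists x, j, (back [:: last 0 u] z.2), i, u; split=> //.
  by rewrite (_ : back _ _ = back u z.2) //; exact: back_ok.
move=> Hmv; move: Hmv Hk => /move_upP [j Exj] [[Ex0 _]|].
  by move: Exj; rewrite Ex0; case: (x').
move=> [z [j' [e [i' [v' [Ez Ekey He Hg']]]]]].
move: Ez; rewrite Exj => /rcons_inj [Ez Ejj]; subst z j'.
rewrite /cleaf Ed Ekey /= (code_bound nu' He); eexists; exists v'; split; [by []|exact: He|].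
have [_ [p' [mu' [k' [Ex' _ _]]]]] := gi_rec G Hg'.
split=> //=; exists p', mu', gh, (rcons rest (x', y.1.1, setm mu1 x y.1.2)); split=> //.
- by rewrite -Exj -Ekey; exact: Gen.
- split=> // w nw.
  have -> : (setm nu u (mu u, fset recs i (Some (Some (code e, i', inord j), p, mu u, y.1.2))) w).1 = mu w.
    by move: (Hcur w); rewrite /setm; case: eqP => [->|].
  (* [mu] results from the memory at the parent by one step of [H] taken at [v'], so both memories
     agree at every other node. *)
  have : cf (rcons x' j) = Some (u, p, mu) by rewrite -Exj.
  rewrite /cf conf_at_rcons -/(cf x') Ex'; case Ecs: (cstep t (v', p', mu')) => [[g' cs]|] //.
  case: (j) => // j2 Hcs; have [a3 [ks3 [_ _ HK]]] := (cstepP _ _ _ _ _ _).1 Ecs.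
  have [z _ [v2 _ [_ _ ->]]] := Forall2_nth (Forall2_sym HK) Hcs.
  by rewrite /setm; case: eqP.
- by rewrite -Exj.
- by rewrite belast_rcons.
Qed.

(** An up-move of [N] fails only at the root of [s], whose key is [None], and there [cleaf] fails
    too. *)
Lemma leaf_def x key u i p pre recs g ks y gh l q a :
  is_node s x -> key_ok gh u x key -> bact W p a pre = Some (g, ks) ->
  (forall j, 0 < j <= size ks -> is_node s (rcons x j)) ->
  vdir (ra_rank Gamma g) y.2 ->
  cleaf q i key p pre recs ks y = Some l -> exists x', move s x y.2 = Some x'.
Proof.
move=> nx Hk Ek Hch Hd; rewrite /cleaf; case: (y.2) Hd => [j|] /=.
  move=> Hj _; exists (rcons x j); apply/move_down; split=> //.
  by apply: Hch; rewrite (Wrank Ek).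
case: key Hk => // key [[_ //]|[z [j [_ [_ [_ [-> _ _ _]]]]]]] _ _.
by exists z; exact: move_up.
Qed.

Lemma arrived x q mu1 u qx nu : crel (x, q, mu1) (u, qx, nu) ->
  exists p mu rest i key m gh a g ks recs,
    [/\ cf x = Some (u, p, mu), arrive qx.2 (nu u) = Some (i, (m, recs)),
        ginv (setm nu u (m, recs)) mu1 gh & gh u i = Some x] /\
    [/\ forall v, (setm nu u (m, recs) v).1 = mu v,
      gchain (step s) (init_config N) rest,
      last (init_config N) rest = (x, q, mu1) &
      forall v, gcard gh v <=
        count (fun C : config N => gpos C.1.1 == Some v) (init_config N :: rest)] /\
    [/\ recs i = Some (key, p, mu u, mu1 x), key_ok gh u x key, lab t u = Some a,
      bact W p a (mu u) = Some (g, ks) & lab s x = Some g /\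
      forall tau', xstep (X := sim_machine) t (u, qx, nu) = Some tau' <->
        exists tau ltau, [/\ hdelta N q g (mu1 x) = Some tau,
          srel (fun y l => cleaf (last 0 u) i key p (mu u) recs ks y = Some l) tau ltau &
          srel (fun y C => exists2 v, xmove t u y.2 = Some v &
             C = (v, y.1.1, setm nu u y.1.2)) ltau tau']].
Proof.
move=> HR; have [Eq nx _] := HR.
have [p [mu [rest [i [[m recs] [gh [[Ex Ea G Hg] [Hcur Hc El Hcard]]]]]]]] := arrive_ok HR.
have [_ [p' [mu' [key [Ex' Er Hk]]]]] := gi_rec G Hg.
move: Ex'; rewrite Ex => -[Ep Emu]; subst p' mu'; rewrite setm_eq /= in Er.
have [u2 [p2 [mu2 [a [g [ks [Ex2 La Ek Ls _]]]]]]] := cf_node nx.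
move: Ex2; rewrite Ex => -[Eu Ep Emu]; subst u2 p2 mu2.
exists p, mu, rest, i, key, m, gh, a, g, ks, recs; split; [by []|split; [by []|]].
split=> //; split=> // tau'.
have Ed k : xdelta sim_machine qx a k (nu u) =
    if hdelta N q g (mu1 x) is Some tau then
      tmap_opt (clift k i key p (mu u) recs ks) tau
    else None.
  by rewrite /= /cdelta Ea Er Ek Eq.
split.
  move=> /xstepP [a' [ltau [La']]]; move: La'; rewrite La => -[<-]; rewrite Ed.
  case E: (hdelta N q g (mu1 x)) => [tau|] // /(tmap_clift _ _ _ _ _ _ _ _ E) S S'.
  by exists tau, ltau.
case=> tau [ltau [E S S']]; apply/xstepP; exists a, ltau; split=> //.
by rewrite Ed E; apply/(tmap_clift _ _ _ _ _ _ _ _ E).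
Qed.

Lemma node_child x g : is_node s x -> lab s x = Some g ->
  forall j, 0 < j <= ra_rank Gamma g -> is_node s (rcons x j).
Proof.
move=> /cf_node [u [p [mu [a [g' [ks [_ _ Ek Ls [Hks _]]]]]]]]; rewrite Ls => -[<-] j.
rewrite -(Wrank Ek); case: j => // j /= lt.
have := nth_error_size ks j; rewrite lt; case Hy: (List.nth_error ks j) => [y|] // _.
by have [v [_ _]] := Hks _ _ Hy.
Qed.

Lemma sim_machine_step C D tau1 : crel C D -> step s C = Some tau1 ->
  exists tau', xstep t D = Some tau' /\ srel crel tau1 tau'.
Proof.
move: C D => [[x q] mu1] [[u qx] nu] HR Est; have [_ nx _] := HR.
have [p [mu [rest [i [key [m [gh [a [g [ks [recs [[Ex Ea G Hg] [[Hcur Hc El Hcard]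
  [Er Hk La Ek [Ls Hstep]]]]]]]]]]]]]]] := arrived HR.
have [g' [tau [Ls' E S]]] := (stepP _ _ _ _ _).1 Est.
move: Ls' E; rewrite Ls => -[<-] E.
have Key y : List.In y (leaves tau) -> forall C, (exists2 v, move s x y.2 = Some v &
     C = (v, y.1.1, setm mu1 x y.1.2)) -> List.In C (leaves tau1) ->
  exists l v, [/\ cleaf (last 0 u) i key p (mu u) recs ks y = Some l,
    xmove t u l.2 = Some v & crel C (v, l.1.1, setm nu u l.1.2)].
  move=> iy C [x' Hx' ->] iC.
  apply: (leaf_ok Ex nx G Hg Hcur Hc El Hcard Er Hk La Ek Hx').
  by exists tau1.
have [ltau SL] : exists ltau,
    srel (fun y l => cleaf (last 0 u) i key p (mu u) recs ks y = Some l) tau ltau.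
  apply: srel_ex; first exact: out_wf_leaves (hdelta_wf E).
  move=> y iy; have [C iC HC] := srel_leaf_l S iy.
  by have [l [v [Hl _ _]]] := Key y iy C HC iC; exists l.
have [tau' ST] : exists tau', srel (fun y (C : xconf sim_machine) =>
   exists2 v, xmove t u y.2 = Some v & C = (v, y.1.1, setm nu u y.1.2)) ltau tau'.
  apply: srel_ex; first exact: srel_wf_leaves (srel_sym SL).
  move=> l il; have [y iy Hl] := srel_leaf_l (srel_sym SL) il.
  have [C iC HC] := srel_leaf_l S iy.
  have [l' [v [Hl' Hv _]]] := Key y iy C HC iC.
  move: Hl'; rewrite Hl => -[El']; subst l'.
  by exists (v, l.1.1, setm nu u l.1.2); exists v.
exists tau'; split; first by apply/Hstep; exists tau, ltau.
apply: srel_imp_in (srel_comp S (srel_trans SL ST)) => C D iC _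
  [y [iy HC [l [_ Hl [v Hv ->]]]]].
have [l' [v' [Hl' Hv' HR']]] := Key y iy C HC iC.
by move: Hl' Hv' HR'; rewrite Hl => -[<-]; rewrite Hv => -[<-].
Qed.

Lemma sim_machine_back C D tau' : crel C D -> xstep t D = Some tau' ->
  exists tau1, step s C = Some tau1.
Proof.
move: C D => [[x q] mu1] [[u qx] nu] HR; have [_ nx _] := HR.
have [p [mu [rest [i [key [m [gh [a [g [ks [recs [_ [_
  [Er Hk La Ek [Ls Hstep]]]]]]]]]]]]]]] := arrived HR.
move=> /Hstep [tau [ltau [E SL _]]].
have [|tau1 S] := @srel_ex _ _ _ (fun y (C : config N) => exists2 v, move s x y.2 = Some v &
     C = (v, y.1.1, setm mu1 x y.1.2)) tau (out_wf_leaves (hdelta_wf E)).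
  move=> y iy; have [l _ Hl] := srel_leaf_l SL iy.
  have [||x' Hx'] := leaf_def nx Hk Ek _ _ Hl.
  - by rewrite (Wrank Ek); exact: node_child Ls.
  - by case: ((out_wfP _ _ _).1 (hdelta_wf E)) => _; apply.
  by exists (x', y.1.1, setm mu1 x y.1.2); exists x'.
by exists tau1; apply/stepP; exists g, tau.
Qed.

(** Both systems are deterministic: once the source is known to have a step, the forward simulation
    identifies the target step with the given one. *)
Lemma sim_machine_back_rel D C tau' : crel C D -> xstep t D = Some tau' ->
  exists tau1, step s C = Some tau1 /\ srel (fun D C => crel C D) tau' tau1.
Proof.
move=> HR E; have [tau1 E1] := sim_machine_back HR E; exists tau1; split=> //.
have [tau2 [E2 S]] := sim_machine_step HR E1.
by move: E2; rewrite E => -[->]; exact: srel_sym.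
Qed.

Lemma sim_machine_init : crel (init_config N) (xini sim_machine).
Proof.
have ns : is_node s [::] by [].
split=> //; exists (binit W), (fun _ => btop W), (fun _ _ => None), [::]; split=> //.
- by split=> //= v i; rewrite ffunE.
- by split=> //; left.
- by move=> v; rewrite /gcard eq_card0 // => i; rewrite !inE.
Qed.

Lemma sim_machine_sem r :
  gy (xstep t) (Node (inr (xini sim_machine)) [::]) r <-> sem N s r.
Proof.
rewrite /sem yieldsP; split; last first.
  by apply: (@sim_lock _ _ _ _ _ crel) sim_machine_init => C D tau; exact: sim_machine_step.
exact: (sim_lock sim_machine_back_rel sim_machine_init).
Qed.

Lemma sim_machine_bounded rest : gchain (xstep t) (xini sim_machine) rest ->
  forall u : seq nat,
  count (fun D : xconf sim_machine => D.1.1 == u) (xini sim_machine :: rest) <= cap.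
Proof.
move=> Hch u.
have [rest' [Hc HF]] := sim_chain sim_machine_back_rel sim_machine_init Hch.
apply: leq_trans (Hcap Hc u).
have {}HF : Forall2 (fun D C => crel C D) (xini sim_machine :: rest) (init_config N :: rest').
  by constructor=> //; exact: sim_machine_init.
elim: HF => // -[[v qx] nu] [[x q] mu1] l l' HR _ IH.
rewrite [X in X <= _]/= [X in _ <= X]/=; apply: leq_add => //.
have HR' : crel (x, q, mu1) (v, qx, nu) := HR.
by have [_ _ [p [mu [gh [rst [Ex _ _ _ _]]]]]] := HR'; rewrite /gpos Ex.
Qed.

End StepC.

(** * Eliminating stay moves and testing the domain *)

(** Like [srel], except that a leaf may be replaced by a whole tree. *)
Inductive tsub (G A B : Type) (P : A -> tree (G + B) -> Prop) :
    tree (G + A) -> tree (G + B) -> Prop :=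
| TOut g ch ch' : Forall2 (tsub P) ch ch' ->
    tsub P (Node (inl g) ch) (Node (inl g) ch')
| TLeaf a t' : P a t' -> tsub P (Node (inr a) [::]) t'.

Section Tsub.
Variables (G A B : Type) (P : A -> tree (G + B) -> Prop).

Lemma tsub_ind2 (Q : tree (G + A) -> tree (G + B) -> Prop) :
  (forall g ch ch', Forall2 (tsub P) ch ch' -> Forall2 Q ch ch' ->
     Q (Node (inl g) ch) (Node (inl g) ch')) ->
  (forall a t', P a t' -> Q (Node (inr a) [::]) t') ->
  forall t t', tsub P t t' -> Q t t'.
Proof.
move=> HO HL; fix F 3 => t t' [g ch ch' H|a t0 Pa]; last exact: HL.
by apply: (HO _ _ _ H); elim: H => *; constructor; auto.
Qed.

Lemma tsub_leaf t t' b : tsub P t t' -> List.In b (leaves t') ->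
  exists a t0, [/\ List.In a (leaves t), P a t0, List.In b (leaves t0) &
    forall b', List.In b' (leaves t0) -> List.In b' (leaves t')].
Proof.
move=> H; elim/tsub_ind2: t t' / H => [g ch ch' _ IH|a t' Pa ib]; last first.
  by exists a, t'; split=> //; left.
move=> /= /List.in_flat_map [c' [ic' ib]].
have [c ic Hc] := Forall2_in_l (Forall2_sym IH) ic'.
have [a [t0 [ia Pa ib0 Hsub]]] := Hc ib.
exists a, t0; split=> //; first by apply/List.in_flat_map; exists c.
by move=> b' /Hsub ib'; apply/List.in_flat_map; exists c'.
Qed.

Lemma tsub_leaf_l t t' a : tsub P t t' -> List.In a (leaves t) ->
  exists2 t0, P a t0 & forall b', List.In b' (leaves t0) -> List.In b' (leaves t').
Proof.
move=> H; elim/tsub_ind2: t t' / H => [g ch ch' _ IH|a' t' Pa]; last first.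
  by case=> // <-; exists t'.
move=> /= /List.in_flat_map [c [ic ia]].
have [c' ic' /(_ ia) [t0 Pa Hsub]] := Forall2_in_l IH ic.
by exists t0 => // b' /Hsub ib'; apply/List.in_flat_map; exists c'.
Qed.

Lemma tsub_xout_wf (rk : G -> nat) t t' : tsub P t t' ->
  (forall a t0, P a t0 -> xout_wf rk t0) -> xout_wf rk t -> xout_wf rk t'.
Proof.
move=> H HP; elim/tsub_ind2: t t' / H => [g ch ch' HF IH /= /andP[sz Hch]|a t' /HP] //.
rewrite -(Forall2_size HF) sz /=.
by elim: {HF sz} IH Hch => //= c c' l l' Hc _ IHl /andP[/Hc -> /IHl].
Qed.

End Tsub.

Section Expand.
Variables (Sigma Xi : ranked_alphabet) (X : xmachine Sigma Xi).
Local Notation dT := (tree (ra_sym Xi + (xQ X * xM X) * dir)).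

(* [n] bounds the number of consecutive stay moves. *)
Fixpoint xexp (n : nat) (a : ra_sym Sigma) (k : nat) (q : xQ X) (m : xM X) (tau' : dT) : Prop :=
  if n is n'.+1 then
    exists2 tau, xdelta X q a k m = Some tau &
      tsub (fun y tau' => match y.2 with
         | Some d => tau' = Node (inr (y.1, d)) [::]
         | None => xexp n' a k y.1.1 y.1.2 tau'
         end) tau tau'
  else False.

Lemma xexp_wf n a k q m tau' : xexp n a k q m tau' -> xout_wf (ra_rank Xi) tau'.
Proof.
elim: n q m tau' => //= n IH q m tau' [tau E S]; apply: tsub_xout_wf S _ (xdelta_wf E).
by move=> [[q' m'] [d|]] t0 /=; [move=> ->|exact: IH].
Qed.

Variable t : tree (ra_sym Sigma).

Definition xinst u (mu : seq nat -> xM X) (y : (xQ X * xM X) * xdir) (C : xconf X) :=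
  exists2 v, xmove t u y.2 = Some v & C = (v, y.1.1, setm mu u y.1.2).

Definition dinst u (mu : seq nat -> xM X) (y : (xQ X * xM X) * dir) (C : xconf X) :=
  exists2 v, move t u y.2 = Some v & C = (v, y.1.1, setm mu u y.1.2).

Lemma setm_setm (M : Type) (mu : seq nat -> M) u m m' : setm (setm mu u m) u m' = setm mu u m'.
Proof. by apply/funext => v; rewrite /setm; case: eqP. Qed.

Lemma dinst_setm u mu m : dinst u (setm mu u m) = dinst u mu.
Proof. by apply/funext => y; apply/funext => C; rewrite /dinst setm_setm. Qed.

Lemma exp_sound n u a : lab t u = Some a -> forall q mu tau' T s,
  xexp n a (last 0 u) q (mu u) tau' -> srel (dinst u mu) tau' T -> gy (xstep t) T s ->
  gy (xstep t) (Node (inr (u, q, mu)) [::]) s.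
Proof.
move=> La; elim: n => //= n IH q mu tau' T s [tau E S] ST Hg.
suff [T0 S0 Hg0] : exists2 T0, srel (xinst u mu) tau T0 & gy (xstep t) T0 s.
  by apply: gy_conf Hg0; apply/xstepP; exists a, tau.
elim/tsub_ind2: tau tau' / S {E} T s ST Hg => [g ch ch' _ IHc T s ST Hg|y tau' Hy T s ST Hg].
  inversion ST as [? ? chT HF|]; subst; case: Hg => h Hg.
  inversion Hg as [? ? ? ss HG|]; subst.
  have [ch0 [H0 H1]] : exists ch0, Forall2 (srel (xinst u mu)) ch ch0 /\
      Forall2 (gy (xstep t)) ch0 ss.
    elim: IHc chT HF ss HG {ST Hg} => [|c c' l l' Hc _ IHl] chT HF ss HG.
      inversion HF; subst; inversion HG; subst.
      by exists [::]; split; constructor.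
    inversion HF as [|? cT ? chT' Sc HF']; subst; inversion HG as [|? s' ? ss' Gc HG']; subst.
    have [|T0 S0 G0] := Hc cT s' Sc; first by exists h.
    have [ch0 [H0 H1]] := IHl _ HF' _ HG'.
    by exists (T0 :: ch0); split; constructor.
  by exists (Node (inl g) ch0); [constructor|exact: gy_out].
case: y Hy => [[q' m'] [d|]] /= Hy.
  rewrite Hy in ST; inversion ST as [|? C [v Hv EC]]; subst.
  by exists (Node (inr (v, q', setm mu u m')) [::]) => //; constructor; exists v.
exists (Node (inr (u, q', setm mu u m')) [::]); first by constructor; exists u.
by apply: IH Hg; rewrite ?setm_eq ?dinst_setm; [exact: Hy|exact: ST].
Qed.

Lemma exp_ex u a : lab t u = Some a -> forall h q mu s,
  gyh (xstep t) h (Node (inr (u, q, mu)) [::]) s ->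
  exists tau' T, xexp h a (last 0 u) q (mu u) tau' /\ srel (dinst u mu) tau' T.
Proof.
move=> La; elim=> [|h IH] q mu s Hg; inversion Hg as [|? ? T0 ? Est Hg0]; subst.
have [a' [tau [La' E S0]]] := (xstepP _ _ _ _ _).1 Est.
move: La' E; rewrite La => -[<-] E.
suff [tau' [T [H1 H2]]] : exists tau' T,
    tsub (fun y tau' => match y.2 with
         | Some d => tau' = Node (inr (y.1, d)) [::]
         | None => xexp h a (last 0 u) y.1.1 y.1.2 tau'
         end) tau tau' /\ srel (dinst u mu) tau' T.
  by exists tau', T; split=> //; exists tau.
clear Hg Est E; elim/srel_ind2: tau T0 / S0 s Hg0 => [g ch chT _ IHc s Hg|y C [v Hv EC] s Hg].
  inversion Hg as [? ? ? ss HG|]; subst.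
  have [ch' [chT' [H1 H2]]] : exists ch' chT', Forall2 (tsub (fun y tau' => match y.2 with
         | Some d => tau' = Node (inr (y.1, d)) [::]
         | None => xexp h a (last 0 u) y.1.1 y.1.2 tau'
         end)) ch ch' /\ Forall2 (srel (dinst u mu)) ch' chT'.
    elim: IHc ss HG {Hg} => [|c c' l l' Hc _ IHl] ss HG; inversion HG as [|? s' ? ss' Gc HG']; subst.
      by exists [::], [::]; split; constructor.
    have [t1 [T1 [A1 A2]]] := Hc _ Gc; have [ch' [chT' [B1 B2]]] := IHl _ HG'.
    by exists (t1 :: ch'), (T1 :: chT'); split; constructor.
  by exists (Node (inl g) ch'), (Node (inl g) chT'); split; constructor.
subst C; case: y Hv Hg => [[q' m'] [d|]] /= Hv Hg.
  exists (Node (inr ((q', m'), d)) [::]), (Node (inr (v, q', setm mu u m')) [::]).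
  by split; [constructor|constructor; exists v].
case: Hv Hg => <- Hg; have [tau' [T [H1 H2]]] := IH _ _ _ Hg.
exists tau', T; rewrite setm_eq in H1; rewrite dinst_setm in H2.
by split=> //; constructor.
Qed.

(** A contracted step stands for at least one step of [X], so the height drops strictly, as [sim]
    requires of its source tree. *)
Lemma exp_complete n u a : lab t u = Some a -> forall h q mu tau' s,
  xexp n a (last 0 u) q (mu u) tau' ->
  gyh (xstep t) h.+1 (Node (inr (u, q, mu)) [::]) s ->
  exists2 T, srel (dinst u mu) tau' T & gyh (xstep t) h T s.
Proof.
move=> La; elim: n => //= n IH h q mu tau' s [tau E S] Hg.
inversion Hg as [|? ? T0 ? Est Hg0]; subst.
have [a' [tau2 [La' E' S0]]] := (xstepP _ _ _ _ _).1 Est.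
move: La' E'; rewrite La => -[<-]; rewrite E => -[Et]; subst tau2.
clear E Est Hg; elim/tsub_ind2: tau tau' / S T0 s S0 Hg0 => [g ch ch' _ IHc T0 s S0 Hg|y tau' Hy T0 s S0 Hg].
  inversion S0 as [? ? chT HF|]; subst; inversion Hg as [? ? ? ss HG|]; subst.
  have [ch0 [H0 H1]] : exists ch0, Forall2 (srel (dinst u mu)) ch' ch0 /\
      Forall2 (gyh (xstep t) h) ch0 ss.
    elim: IHc chT HF ss HG {S0 Hg} => [|c c' l l' Hc _ IHl] chT HF ss HG.
      inversion HF; subst; inversion HG; subst.
      by exists [::]; split; constructor.
    inversion HF as [|? cT ? chT' Sc HF']; subst; inversion HG as [|? s' ? ss' Gc HG']; subst.
    have [T1 S1 G1] := Hc cT s' Sc Gc.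
    have [ch0 [H0 H1]] := IHl _ HF' _ HG'.
    by exists (T1 :: ch0); split; constructor.
  by exists (Node (inl g) ch0); constructor.
inversion S0 as [|? C [v Hv EC]]; subst.
case: y Hy Hv S0 Hg => [[q' m'] [d|]] /= Hy Hv S0 Hg.
  rewrite Hy; exists (Node (inr (v, q', setm mu u m')) [::]) => //.
  by constructor; exists v.
case: Hv Hg S0 => <- Hg _; case: h Hg => [|h] Hg; first by inversion Hg.
have [|T ST GT] := IH h q' (setm mu u m') tau' s _ Hg; first by rewrite setm_eq.
by exists T; [rewrite dinst_setm in ST|exact: gyh_leq GT].
Qed.

Lemma exp_chain n u a : lab t u = Some a -> forall q mu tau' y v,
  xexp n a (last 0 u) q (mu u) tau' ->
  (forall z, List.In z (leaves tau') -> exists w, move t u z.2 = Some w) ->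
  List.In y (leaves tau') -> move t u y.2 = Some v ->
  exists rest, gchain (xstep t) (u, q, mu) (rcons rest (v, y.1.1, setm mu u y.1.2)).
Proof.
move=> La; elim: n => //= n IH q mu tau' y v [tau E S] Hm iy Hv.
have [T ST] : exists T, srel (xinst u mu) tau T.
  apply: srel_ex; first exact: xout_wf_leaves (xdelta_wf E).
  move=> z iz; have [t0 Hz Hsub] := tsub_leaf_l S iz.
  case: z Hz {iz} => [[q' m'] [d|]] /= Hz; last first.
    by exists (u, q', setm mu u m'); exists u.
  have [|w Hw] := Hm ((q', m'), d); first by apply: Hsub; rewrite Hz; left.
  by exists (w, q', setm mu u m'); exists w.
have Est : xstep t (u, q, mu) = Some T by apply/xstepP; exists a, tau.
have [z [t0 [iz Hz iy0 Hsub]]] := tsub_leaf S iy.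
have [C iC [w Hw EC]] := srel_leaf_l ST iz.
case: z Hz Hw EC {iz} => [[q' m'] [d|]] /= Hz Hw EC.
  move: iy0; rewrite Hz => -[|//] Ey; subst y.
  move: Hv; rewrite /= Hw => -[Ewv]; subst w.
  by exists [::]; rewrite /= -EC; split=> //; exists T.
case: Hw EC => <- EC.
have [|z iz0|||rest Hr] := IH q' (setm mu u m') t0 y v.
- by rewrite setm_eq.
- by apply: Hm; exact: Hsub iz0.
- exact: iy0.
- exact: Hv.
exists (C :: rest); rewrite rcons_cons /=; split; first by exists T.
by rewrite EC; rewrite setm_setm in Hr.
Qed.

End Expand.

(** * Initial traversal with domain test, followed by the run *)

Section Assembly.
Variables (Sigma Xi : ranked_alphabet) (X : xmachine Sigma Xi).
Variables (F : finType) (phi : tree (ra_sym Sigma) -> F)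
  (alpha : ra_sym Sigma -> seq F -> F) (acc : pred F).
Hypothesis phiE : forall a ch, phi (Node a ch) = alpha a (map phi ch).

Let R := rmax Sigma.

Definition aQ : finType := ('I_R.+1 + F + xQ X)%type.
(** Both alternatives keep the sibling index. During the traversal it comes with the values of the
    children evaluated so far, during the run with the memory of [X]. *)
Definition aM : finType := ('I_R.+1 * R.-bseq F + 'I_R.+1 * xM X)%type.
Local Notation aT := (tree (ra_sym Xi + (aQ * aM) * dir)).
Local Notation enter k := (inl (inl k) : aQ).
Local Notation ret f := (inl (inr f) : aQ).
Local Notation wait k fs := (inl (k, insub_bseq R fs) : aM).
Local Notation ran k m := (inr (k, m) : aM).

Definition exp_ok a k q m tau' :=
  (exists n, xexp n a k q m tau') /\ @out_wf _ (xQ X * xM X) (ra_rank Xi) (ra_rank Sigma a) tau'.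

Definition runf (k : 'I_R.+1) (y : (xQ X * xM X) * dir) : (aQ * aM) * dir :=
  ((inr y.1.1, ran k y.1.2), y.2).

(** Some admissible contraction is chosen classically. None exists if the stays do not end, or if a
    direction exceeds the rank, in which case [X] cannot move either. *)
Definition runstep a (k : 'I_R.+1) q m : option aT :=
  if pselect (exists tau', exp_ok a k q m tau') is left H
  then Some (smap (runf k) (projT1 (cid H))) else None.

(** Index 0 marks the root, where the test and the first contracted step of [X] share one
    transition. Elsewhere the value goes up to the parent, and the node is prepared for the run. *)
Definition proceed a (k : 'I_R.+1) (fs : seq F) : option aT :=
  if size fs < ra_rank Sigma a
  then Some (Node (inr ((enter (inord (size fs).+1), wait k fs), Some (size fs).+1)) [::])
  else if k == ord0 then
    if acc (alpha a fs) then runstep a k (xqi X) (xtop X) else None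
  else Some (Node (inr ((ret (alpha a fs), ran k (xtop X)), None)) [::]).

Definition adelta (st : aQ) (a : ra_sym Sigma) (m : aM) : option aT :=
  match st, m with
  | inl (inl k), _ => proceed a k [::]
  | inl (inr f), inl (k, fs) => proceed a k (rcons fs f)
  | inr q, inr (k, m) => runstep a k q m
  | _, _ => None
  end.

Lemma runstep_spec a k q m tau : runstep a k q m = Some tau ->
  exists2 tau', exp_ok a k q m tau' & tau = smap (runf k) tau'.
Proof. by rewrite /runstep; case: pselect => // H [<-]; exists (projT1 (cid H)) => //; case: (cid H). Qed.

Lemma runf_srel k tau' r : out_wf (ra_rank Xi) r tau' ->
  srel (fun y z => z = runf k y) tau' (smap (runf k) tau').
Proof. by move=> W; apply: smap_srel; exact: out_wf_leaves W. Qed.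

Lemma runstep_wf a k q m tau : runstep a k q m = Some tau ->
  out_wf (ra_rank Xi) (ra_rank Sigma a) tau.
Proof.
move=> /runstep_spec [tau' [_ W] ->]; apply: (srel_out_wf (runf_srel k W) W) => b ib.
have [y iy ->] := srel_leaf_l (srel_sym (runf_srel k W)) ib.
by case: ((out_wfP _ _ _).1 W) => _; apply.
Qed.

Lemma proceed_wf a k fs tau : proceed a k fs = Some tau ->
  out_wf (ra_rank Xi) (ra_rank Sigma a) tau.
Proof.
rewrite /proceed; case: ifP => lt; first by case=> <- /=; rewrite lt.
by case: ifP => _; [case: ifP => // _; exact: runstep_wf|case=> <-].
Qed.

Lemma adelta_wf q a m tau : adelta q a m = Some tau ->
  out_wf (ra_rank Xi) (ra_rank Sigma a) tau.
Proof.
case: q => [[k|f]|q] /=; first exact: proceed_wf.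
  by case: m => [[k fs]|] //; exact: proceed_wf.
by case: m => [[k fs]|[k m]] //; exact: runstep_wf.
Qed.

Definition assembled : uTHM Sigma Xi :=
  @UTHM Sigma Xi aQ aM (wait ord0 [::]) (enter ord0) adelta adelta_wf.

Variable t : tree (ra_sym Sigma).
Hypothesis wft : wf_tree (ra_rank Sigma) t.

Definition idx (u : seq nat) : 'I_R.+1 := inord (last 0 u).

Lemma idxE u : is_node t u -> nat_of_ord (idx u) = last 0 u.
Proof.
move=> nu; rewrite /idx inordK //; case/lastP: u nu => // u i nu; rewrite last_rcons.
have [a La] := (labP _ _).1 (is_node_rcons nu).
by move: nu; rewrite (wf_child _ wft La) ltnS => /andP[_ H]; exact: leq_trans H (rmax_le a).
Qed.

(* The run phase, possibly entered from the last step of the initial traversal,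
   whose memory at the current node is still to be overwritten. *)
Definition arel (C : config assembled) (D : xconf X) : Prop :=
  let '(u, st, mu) := C in let '(v, q, nu) := D in
  [/\ u = v, forall w, is_node t w -> w <> u -> mu w = ran (idx w) (nu w) &
    exists2 a, lab t u = Some a & adelta st a (mu u) = runstep a (idx u) q (nu u)].

Lemma arel_next u st mu q nu (y : (xQ X * xM X) * dir) v : arel (u, st, mu) (u, q, nu) ->
  is_node t u -> move t u y.2 = Some v ->
  arel (v, (runf (idx u) y).1.1, setm mu u (runf (idx u) y).1.2)
       (v, y.1.1, setm nu u y.1.2).
Proof.
move=> [_ Hmu _] nu' Hv; have nv := move_node nu' Hv.
have Hm w : is_node t w -> setm mu u (runf (idx u) y).1.2 w = ran (idx w) (setm nu u y.1.2 w).
  by move=> nw; rewrite /setm; case: eqP => [->//|]; exact: Hmu.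
split=> //; first by move=> w nw _; exact: Hm.
by have [a La] := (labP _ _).1 nv; exists a => //; rewrite (Hm v nv).
Qed.

Lemma arel_node C D : arel C D -> is_node t C.1.1.
Proof. by move: C D => [[u st] mu] [[v q] nu] [_ _ [a La _]]; apply/labP; exists a. Qed.

Lemma arel_step u st mu q nu tauK : arel (u, st, mu) (u, q, nu) ->
  step t ((u, st, mu) : config assembled) = Some tauK ->
  exists n a tau' T, [/\ lab t u = Some a, xexp n a (last 0 u) q (nu u) tau',
    (forall z, List.In z (leaves tau') -> exists w, move t u z.2 = Some w),
    srel (dinst t u nu) tau' T & srel arel tauK T].
Proof.
move=> HR; have [_ _ [a La Ed]] := HR; have nu' := arel_node HR.
move=> /stepP [a' [tau [La' E S]]]; move: La' E; rewrite La => -[<-] /=; rewrite Ed.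
move=> /runstep_spec [tau' [[n Hn] Wf] Et]; subst tau; rewrite idxE // in Hn.
have S' := srel_trans (runf_srel (idx u) Wf) S.
have Hm z : List.In z (leaves tau') -> exists w, move t u z.2 = Some w.
  move=> iz; have [C _ [z' [_ -> [w Hw _]]]] := srel_leaf_l S' iz.
  by exists w.
have [|T ST] := @srel_ex _ _ _ (dinst t u nu) tau' (out_wf_leaves Wf).
  move=> z /Hm [w Hw]; exists (w, z.1.1, setm nu u z.1.2); by exists w.
exists n, a, tau', T; split=> //.
apply: srel_imp_in (srel_comp S' ST) => C D _ _ [z [iz [z' [_ -> [w Hw ->]]] [w' Hw' ->]]].
move: Hw'; rewrite -[z.2]/((runf (idx u) z).2) Hw => -[<-].
exact: (arel_next (v := w) HR nu').
Qed.

Lemma arel_pos C D : arel C D -> C.1.1 = D.1.1.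
Proof. by move: C D => [[u st] mu] [[v q] nu] []. Qed.

Lemma arel_sem_l C D r : arel C D -> gy (step t) (Node (inr C) [::]) r ->
  gy (xstep t) (Node (inr D) [::]) r.
Proof.
apply: (@sim _ _ _ _ _ arel) => {r} {}C {}D n r HR Hg.
inversion Hg as [|? ? tauK ? E Hg']; subst; have Ep := arel_pos HR.
move: C D HR Hg E Ep => [[u st] mu] [[v q] nu] HR Hg E /= Ep; subst v.
have [n' [a [tau' [T [La Hx _ ST SA]]]]] := arel_step HR E.
by exists tauK, T; split=> // s'; exact: (exp_sound La Hx ST).
Qed.

Lemma arel_sem_r C D r : arel C D -> gy (xstep t) (Node (inr D) [::]) r ->
  gy (step t) (Node (inr C) [::]) r.
Proof.
apply: (@sim _ _ _ _ _ (fun D C => arel C D)) => {r} {}D {}C h r HR Hg.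
have Ep := arel_pos HR; have nu' := arel_node HR.
move: C D HR Hg Ep nu' => [[u st] mu] [[v q] nu] HR Hg /= Ep nu'; subst v.
have [_ _ [a La Ed]] := HR.
have [tau0 [T0 [H0 S0]]] := exp_ex La Hg.
have Hex : exists tau', exp_ok a (idx u) q (nu u) tau'.
  exists tau0; split; first by exists h.+1; rewrite idxE.
  apply/out_wfP; split; first exact: xexp_wf H0.
  move=> z iz; have [C _ [w Hw _]] := srel_leaf_l S0 iz.
  case: (z.2) Hw => [i|] // /move_down [->]; by rewrite (wf_child _ wft La).
have [tau' Hr [[n Hn] Wf]] : exists2 tau', runstep a (idx u) q (nu u) = Some (smap (runf (idx u)) tau')
    & exp_ok a (idx u) q (nu u) tau'.
  rewrite /runstep; case: pselect => [H|//]; exists (projT1 (cid H)) => //; by case: (cid H).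
rewrite idxE // in Hn.
have [T ST GT] := exp_complete La Hn Hg.
have SR := runf_srel (idx u) Wf.
have [|tauK SK] := @srel_ex _ _ _ (fun y (C : config assembled) => exists2 v, move t u y.2 = Some v &
     C = (v, y.1.1, setm mu u y.1.2)) _ (srel_wf_leaves (srel_sym SR)).
  move=> z iz; have [y iy ->] := srel_leaf_l (srel_sym SR) iz.
  have [C _ [w Hw _]] := srel_leaf_l ST iy.
  by exists (w, (runf (idx u) y).1.1, setm mu u (runf (idx u) y).1.2); exists w.
exists T, tauK; split=> //.
  move=> s'; apply: gy_conf; apply/stepP; exists a, (smap (runf (idx u)) tau'); split=> //=.
  by rewrite Ed.
apply: srel_imp_in (srel_comp ST (srel_trans SR SK)) =>
  D C _ _ [z [iz [w' Hw' ->] [z' [_ -> [w Hw ->]]]]].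
move: Hw; rewrite /= Hw' => -[<-].
exact: (arel_next (v := w') HR nu').
Qed.

Lemma arel_chain rest : forall C D, arel C D ->
  gchain (@step _ _ assembled t) C rest ->
  exists2 restX, gchain (xstep t) D restX & forall u : seq nat,
    count (fun C : config assembled => C.1.1 == u) (C :: rest) <=
    count (fun D : xconf X => D.1.1 == u) (D :: restX).
Proof.
elim: rest => [|C' rest IH] C D HR; have Ep := arel_pos HR.
  by exists [::] => // u /=; rewrite Ep.
case=> -[tauK [E iC]] Hch.
move: C D HR E Ep => [[u st] mu] [[v q] nu] HR E /= Ep; subst v.
have [n [a [tau' [T [La Hx Hm ST SA]]]]] := arel_step HR E.
have [D' iD HR'] := srel_leaf_l SA iC.
have [y iy [w Hw ED]] := srel_leaf_l (srel_sym ST) iD.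
have [rest1 Hr1] := exp_chain La Hx Hm iy Hw.
have [rest2 Hr2 Hcnt] := IH C' D' HR' Hch.
exists (rest1 ++ D' :: rest2).
  move: Hr1; rewrite -ED => {Hcnt ED iD HR' Hw Hx ST SA HR E}.
  elim: rest1 (u, q, nu) => [|d r IHr] c /=; first by case=> H _; split.
  by case=> H /IHr; split.
move=> w'; rewrite /= count_cat leq_add2l; apply: leq_trans (Hcnt w') (leq_addl _ _).
Qed.

Fixpoint spath (C : config assembled) (p : seq (config assembled)) : Prop :=
  if p is C' :: p' then step t C = Some (Node (inr C') [::]) /\ spath C' p' else True.

Lemma spath_cat C p p' : spath C (p ++ p') <-> spath C p /\ spath (last C p) p'.
Proof. by elim: p C => [|C' p IH] C /=; [tauto|rewrite IH; tauto]. Qed.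

Lemma spath_sem C p r : spath C p ->
  gy (step t) (Node (inr C) [::]) r <-> gy (step t) (Node (inr (last C p)) [::]) r.
Proof.
elim: p C => [|C' p IH] C //= [E /IH <-]; split; last exact: gy_conf.
case=> n Hn; inversion Hn as [|n' ? ? ? E' H]; subst.
by exists n'; move: E'; rewrite E => -[->].
Qed.

(** The steps on [p] have a single leaf, so every run from [C] follows [p] until one of them
    ends. *)
Lemma spath_chain C p rest : spath C p -> gchain (step t) C rest ->
  exists2 rest', gchain (step t) (last C p) rest' & forall f : pred (config assembled),
    count f (C :: rest) <= count f (belast C p) + count f (last C p :: rest').
Proof.
elim: p C rest => [|C' p IH] C rest; first by move=> _ H; exists rest.
case: rest => [_ _|C1 rest]; first by exists [::] => // f /=; lia.
move=> [E Hp] [[tau [E' iC]] Hch]; move: E' iC; rewrite E => -[<-] /= [EC|//]; subst C1.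
have [rest' H1 H2] := IH _ _ Hp Hch; exists rest' => // f.
by have := H2 f; rewrite /=; lia.
Qed.

Local Notation cnt u p := (count (fun C : config assembled => C.1.1 == u) p).

(** Covers the first entry into [u] and every return from a child alike, which allows an induction
    over the children still to be visited. *)
Definition ready u fs (C : config assembled) := forall a, lab t u = Some a ->
  C.1.1 = u /\ adelta C.1.2 a (C.2 u) = proceed a (idx u) fs.

Lemma silent u st mu a st' m' d v : lab t u = Some a ->
  adelta st a (mu u) = Some (Node (inr ((st', m'), d)) [::]) -> move t u d = Some v ->
  step t ((u, st, mu) : config assembled) =
    Some (Node (inr (v, st', setm mu u m')) [::]).
Proof.
move=> La E Hv; apply/stepP; exists a, (Node (inr ((st', m'), d)) [::]); split=> //.
by constructor; exists v.
Qed.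

(* [C] is about to visit the children of [u] after the first [j] ones. *)
Definition children_done u a ch (j : nat) (C : config assembled) :=
  exists p, let C' := last C p in
  [/\ spath C p, ready u (map phi ch) C',
    forall v, ~~ prefix u v -> C'.2 v = C.2 v,
    (forall i z, i <= j -> C'.2 (u ++ i :: z) = C.2 (u ++ i :: z)) /\
    (forall i z, j < i -> is_node t (u ++ i :: z) ->
       C'.2 (u ++ i :: z) = ran (idx (u ++ i :: z)) (xtop X)) &
    [/\ forall w, ~~ prefix u w -> cnt w (belast C p) = 0,
      cnt u (belast C p) <= ra_rank Sigma a - j &
      forall i z, cnt (u ++ i :: z) (belast C p) <= if j < i then R.+1 else 0]].

Definition visited x u c := forall mu, exists p mu',
  [/\ spath ((x, enter (idx x), mu) : config assembled) (rcons p (u, ret (phi c), mu')),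
    forall w, ~~ prefix x w -> mu' w = mu w,
    forall w, prefix x w -> is_node t w -> mu' w = ran (idx w) (xtop X) &
    forall w, cnt w ((x, enter (idx x), mu) :: p) <= if prefix x w then R.+1 else 0].

Lemma prefix_rcons_cat (u : seq nat) j i z : prefix (rcons u j) (u ++ i :: z) = (j == i).
Proof. by elim: u => [|k u IH] /=; [rewrite prefix0s andbT|rewrite eqxx]. Qed.

Lemma prefix_rcons_self (u : seq nat) j : prefix (rcons u j) u = false.
Proof. by elim: u => [|k u IH] //=; rewrite eqxx. Qed.

Lemma cat_cons_neq (u : seq nat) i z : (u == u ++ i :: z) = false.
Proof. by elim: u => [|k u IH] //=; rewrite eqseq_cons eqxx. Qed.

Lemma prefixN_neq (u w : seq nat) : ~~ prefix u w -> (u == w) = false.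
Proof. by apply: contraNF => /eqP ->; exact: prefix_refl. Qed.

Lemma prefixN_rcons (u w : seq nat) j : ~~ prefix u w -> ~~ prefix (rcons u j) w.
Proof.
apply: contraNN => /prefixP [z ->]; rewrite cat_rcons; exact: prefix_prefix.
Qed.

Lemma children_ok u a ch : subt t u = Some (Node a ch) ->
  (forall j c, List.nth_error ch j = Some c -> visited (rcons u j.+1) u c) ->
  forall m j C, m + j = size ch -> ready u (map phi (take j ch)) C -> children_done u a ch j C.
Proof.
move=> Es Hv; have La : lab t u = Some a by rewrite /lab Es.
have sz : size ch = ra_rank Sigma a by have /= /andP[/eqP] := wf_subt wft Es.
elim=> [|m IH] j C Hm Hr.
  rewrite add0n in Hm; rewrite Hm take_size in Hr.
  exists [::] => /=; split=> //; split=> // i z lt.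
  rewrite -cat_rcons /is_node subt_cat (subt_rcons _ Es).
  case: i lt => // i lt; case E: (List.nth_error ch i) => [c|] //.
  by have := nth_error_size ch i; rewrite E /= => /esym; move: lt; rewrite -Hm; lia.
have jlt : j < size ch by rewrite -Hm; lia.
have [c Ec] : exists c, List.nth_error ch j = Some c.
  have := nth_error_size ch j; rewrite jlt.
  by case: (List.nth_error ch j) => [c|] // _; exists c.
move: C Hr => [[u0 st] mu] Hr; have [/= Eu Ed] := Hr a La; subst u0.
pose fs := map phi (take j ch).
have szfs : size fs = j by rewrite size_map size_takel // ltnW.
have nx : is_node t (rcons u j.+1) by rewrite /is_node (subt_rcons _ Es) Ec.
move: Ed; rewrite -/fs /proceed szfs -sz jlt => Ed.
have E1 := silent La Ed ((move_down _ _ _ _).2 (conj erefl nx)).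
have [p1 [mu' [Hp1 Hout Hin Hcnt1]]] := Hv j c Ec (setm mu u (wait (idx u) fs)).
pose C1 : config assembled := (rcons u j.+1, enter (idx (rcons u j.+1)), setm mu u (wait (idx u) fs)).
pose C2 : config assembled := (u, ret (phi c), mu').
have Emu' : mu' u = wait (idx u) fs.
  by rewrite Hout ?setm_eq // prefix_rcons_self.
have szR : size fs <= R.
  by rewrite szfs; apply: leq_trans (ltnW jlt) _; rewrite sz; exact: rmax_le.
have Etake : rcons fs (phi c) = map phi (take j.+1 ch).
  rewrite /fs; elim: (ch) j Ec {Hm jlt IH Hr fs szfs nx Ed E1 Hcnt1 Hin Hout Hp1 C1 C2 Emu' szR} =>
    [|d l IHl] [|j] //=; first by case=> ->; rewrite take0.
  by move=> /IHl ->.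
have Hr2 : ready u (map phi (take j.+1 ch)) C2.
  move=> a2; rewrite La => -[<-]; split=> //.
  (* The list fits into [R] places, so [insub_bseq] returns it and not its default. *)
  by rewrite /= Emu' /insub_bseq /insubd insubT -Etake.
have [|p2 [Hp2 Hr3 Hout2 [Hlow Hhigh] [N1 N2 N3]]] := IH j.+1 C2 _ Hr2; first by rewrite -Hm; lia.
have EC1 : step t ((u, st, mu) : config assembled) = Some (Node (inr C1) [::]).
  by rewrite E1 /C1 {2}/idx last_rcons.
exists (C1 :: rcons p1 C2 ++ p2).
have -> : last ((u, st, mu) : config assembled) (C1 :: rcons p1 C2 ++ p2) = last C2 p2.
  by rewrite /= last_cat last_rcons.
have -> : belast ((u, st, mu) : config assembled) (C1 :: rcons p1 C2 ++ p2) =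
    (u, st, mu) :: (C1 :: p1) ++ belast C2 p2.
  by rewrite /= belast_cat belast_rcons last_rcons.
have Hneq v : v <> u -> setm mu u (wait (idx u) fs) v = mu v.
  by move=> ne; rewrite /setm; case: eqP.
split=> //.
- by split=> //; apply/spath_cat; rewrite last_rcons.
- move=> v Hpv; rewrite Hout2 //= Hout ?prefixN_rcons // Hneq //.
  by move=> Ev; move: Hpv; rewrite Ev prefix_refl.
- split=> i z Hi.
    rewrite Hlow ?leqW //= Hout; last by rewrite prefix_rcons_cat; apply/eqP; lia.
    by rewrite Hneq // => /esym /eqP; rewrite cat_cons_neq.
  move=> Hn; case: (ltngtP j.+1 i) => [lt|gt|Ei].
  + exact: Hhigh.
  + by move: gt; rewrite ltnNge Hi.
  + by rewrite Hlow ?Ei //= Hin // prefix_rcons_cat Ei.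
- split.
  + move=> w Hw; rewrite -(cat1s (u, st, mu)) !count_cat [count _ [:: _]]/= N1 // (prefixN_neq Hw) add0n addn0.
    by apply/eqP; rewrite -leqn0; have := Hcnt1 w; rewrite (negbTE (prefixN_rcons _ Hw)).
  + rewrite -(cat1s (u, st, mu)) !count_cat [count _ [:: _]]/= eqxx.
    have := Hcnt1 u; rewrite prefix_rcons_self leqn0 => /eqP ->.
    by rewrite add0n; apply: leq_trans (leq_add (leqnn 1) N2) _; rewrite -sz; lia.
  + move=> i z; rewrite -(cat1s (u, st, mu)) !count_cat [count _ [:: _]]/= cat_cons_neq add0n.
    have := Hcnt1 (u ++ i :: z); rewrite prefix_rcons_cat; have := N3 i z.
    rewrite -/C1; move: (count _ (C1 :: p1)) (count _ (belast C2 p2)) => A B.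
    by case: (ltngtP j.+1 i) => [lt|gt|Ei]; case: (ltnP j i) => Hji; lia.
Qed.

Lemma visited_ok c : forall u v, subt t (rcons u v) = Some c -> visited (rcons u v) u c.
Proof.
elim/tree_nested_ind: c => a ch IH u v Es mu; set x := rcons u v.
have La : lab t x = Some a by rewrite /lab Es.
have nx : is_node t x by rewrite /is_node Es.
have v0 : 0 < v.
  have [a' La'] := (labP _ _).1 (is_node_rcons nx).
  by move: nx; rewrite (wf_child _ wft La') => /andP[].
have sz : size ch = ra_rank Sigma a by have /= /andP[/eqP] := wf_subt wft Es.
have [||p [Hp Hr Hout [Hlow Hhigh] [N1 N2 N3]]] :=
  @children_ok x a ch Es _ (size ch) 0 (x, enter (idx x), mu) (addn0 _).
- move=> j c Ec; apply: (proj1 (List.Forall_forall _ _) IH c (List.nth_error_In _ _ Ec)).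
  by rewrite (subt_rcons _ Es).
- by move=> a'; rewrite take0.
move: Hp Hr Hout Hlow Hhigh N1 N2 N3.
set C0 : config assembled := (x, _, mu) => Hp Hr Hout Hlow Hhigh N1 N2 N3.
case El : (last C0 p) Hr Hout Hlow Hhigh => [[y st] nu] Hr Hout Hlow Hhigh.
rewrite /= in Hout Hlow Hhigh; have [] := Hr a La; rewrite [_.1.1]/= => Ey; subst y.
(* Children are numbered from 1, so [x] is not mistaken for the root. *)
rewrite /proceed size_map sz ltnn (_ : (idx x == ord0) = false); last first.
  by apply/eqP => /(congr1 (@nat_of_ord _)); rewrite idxE // last_rcons /=; lia.
rewrite -phiE => Ed; have Est := silent La Ed (move_up _ _ _).
exists p, (setm nu x (ran (idx x) (xtop X))); split.
- by rewrite -cats1; apply/spath_cat; split=> //; rewrite El.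
- move=> w Hw; rewrite /setm; case: eqP => [Ew|_]; last exact: Hout.
  by move: Hw; rewrite Ew prefix_refl.
- move=> w /prefixP [[|i z] ->] nw; rewrite /setm; first by rewrite cats0 eqxx.
  rewrite eq_sym cat_cons_neq; apply: Hhigh => //.
  case: i nw => // nw; move: nw; rewrite -cat_rcons /is_node subt_cat (subt_rcons _ Es) //.
- move=> w; rewrite lastI -cats1 count_cat El /= addn0.
  case: (boolP (prefix x w)) => [/prefixP [z ->]|Hw]; last first.
    by rewrite N1 // (prefixN_neq Hw).
  case: z => [|i z].
    rewrite cats0 eqxx addn1 ltnS; apply: leq_trans N2 _; rewrite subn0; exact: rmax_le.
  rewrite cat_cons_neq addn0; apply: leq_trans (N3 i z) _; by case: ifP.
Qed.

Lemma traversal : exists p, let C' := last (init_config assembled) p in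
  [/\ spath (init_config assembled) p,
    forall w : seq nat, cnt w (belast (init_config assembled) p) <= R.+1 &
    if acc (phi t) then arel C' (xini X) else step t C' = None].
Proof.
case Et : t => [a ch]; rewrite -Et.
have Es : subt t [::] = Some (Node a ch) by rewrite Et.
have La : lab t [::] = Some a by rewrite /lab Es.
have sz : size ch = ra_rank Sigma a by have /= /andP[/eqP] := wf_subt wft Es.
have i0 : idx [::] = ord0 by apply: val_inj; rewrite /= inordK.
have [||p [Hp Hr Hout [Hlow Hhigh] [N1 N2 N3]]] :=
  @children_ok [::] a ch Es _ (size ch) 0 (init_config assembled) (addn0 _).
- move=> j c Ec; apply: (@visited_ok c [::] j.+1).
  by rewrite (subt_rcons _ Es).
- by move=> a'; rewrite take0 i0.
exists p; split=> //.
  case=> [|i z]; last by apply: leq_trans (N3 i z) _; case: ifP.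
  by apply: leq_trans N2 _; rewrite subn0; apply: leqW; exact: rmax_le.
case: (last _ p) Hr Hhigh => [[y st] nu] Hr Hhigh.
have [/= Ey] := Hr a La; subst y.
rewrite /proceed size_map sz ltnn i0 eqxx -phiE -Et => Ed.
case: ifP Ed => _ Ed.
  split=> //; last by exists a; rewrite // i0.
  move=> [|i z] nw ne //; apply: Hhigh => //.
  by case: i nw {ne} => //; rewrite /is_node Et.
by rewrite /step La /= Ed.
Qed.

Lemma assembled_sem r : sem assembled t r <-> acc (phi t) /\ gy (xstep t) (Node (inr (xini X)) [::]) r.
Proof.
rewrite /sem yieldsP; have [p [Hp _ H]] := traversal.
rewrite (spath_sem _ Hp); case: ifP H => _ H; split.
- by move=> Hg; split=> //; exact: arel_sem_l H Hg.
- by case=> _ Hg; exact: arel_sem_r H Hg.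
- by case=> n Hn; inversion Hn; subst; congruence.
- by case.
Qed.

(** [R.+1] accounts for the traversal without its last configuration. The additional 1 covers that
    configuration when the input is rejected and no run of [X] accounts for it. *)
Lemma assembled_bounded b :
  (acc (phi t) -> forall rest, gchain (xstep t) (xini X) rest -> forall u : seq nat,
     count (fun D : xconf X => D.1.1 == u) (xini X :: rest) <= b) ->
  forall rest, gchain (step t) (init_config assembled) rest -> forall u : seq nat,
     cnt u (init_config assembled :: rest) <= R.+1 + b.+1.
Proof.
move=> Hb rest Hch u; have [p [Hp Hc H]] := traversal.
have [rest' Hch' Hcnt] := spath_chain Hp Hch.
apply: leq_trans (Hcnt _) _; apply: leq_add; first exact: Hc.
case: ifP H => Ha H.
  have [restX HX /(_ u) HcX] := arel_chain H Hch'.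
  by apply: leq_trans HcX _; apply: leqW; exact: Hb.
case: rest' Hch' {Hcnt} => [_|C' r [[tau [E _]] _]] /=; last by rewrite H in E.
by case: (_ == u).
Qed.

End Assembly.

Lemma assembly (Sigma Xi : ranked_alphabet) (X : xmachine Sigma Xi)
    (L : tree (ra_sym Sigma) -> Prop) (b : nat) : regular L ->
  (forall t, wf_tree (ra_rank Sigma) t -> L t -> forall rest,
     gchain (xstep t) (xini X) rest -> forall u : seq nat,
     count (fun D : xconf X => D.1.1 == u) (xini X :: rest) <= b) ->
  exists K : uTHM Sigma Xi, is_THM K /\ forall t, wf_tree (ra_rank Sigma) t -> forall r,
    sem K t r <-> L t /\ gy (xstep t) (Node (inr (xini X)) [::]) r.
Proof.
move=> [F [phi [alpha [acc [phiE HL]]]]] Hb.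
exists (assembled X alpha acc); split.
  exists ((rmax Sigma).+1 + b.+1) => t wft cs /is_runP [rest -> Hch] u.
  have := assembled_bounded phiE wft (b := b) _ Hch u.
  move=> H; apply: leq_trans (H _).
    by apply: eq_leq; apply: eq_count => C; rewrite inE.
  by move=> /(HL t wft) Lt; exact: Hb.
by move=> t wft r; rewrite (assembled_sem X acc phiE wft) (HL t wft).
Qed.

(** * Bounding the visits by antichains *)

Section Layers.
Variables (Sigma Gamma Xi : ranked_alphabet) (W : bsys Sigma (ra_sym Gamma)).
Variables (N : uTHM Gamma Xi) (t : tree (ra_sym Sigma)) (s : tree (ra_sym Gamma)).
Variables (b1 b2 : nat).
Hypothesis Hb1 : forall rest, bchain t (bini W) rest -> forall u : seq nat,
  count (fun c : bconf W => c.1.1 == u) (bini W :: rest) <= b1.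
Hypothesis Hb2 : forall rest, gchain (step s) (init_config N) rest ->
  forall S, uniq S -> antichain S -> all (is_node s) S ->
  visits (init_config N :: rest) S <= b2.

(** Turns the visit bound for branches into a statement about the ancestors of a single node of
    [s]. *)
Lemma path_chain x c : cf W t x = Some c -> exists rest,
  [/\ bchain t (bini W) rest, last (bini W) rest = c &
    forall v : seq nat, count (fun c : bconf W => c.1.1 == v) (bini W :: rest) =
      count (fun k => gpos W t (take k x) == Some v) (iota 0 (size x).+1)].
Proof.
elim/last_ind: x c => [|x i IH] c; first by case=> <-; exists [::].
rewrite /cf conf_at_rcons -/(cf W t x); case Ex: (cf W t x) => [c0|] //.
case Ec: (cstep t c0) => [[g cs]|] //; case: i => // i Hi.
have [rest [H1 H2 H3]] := IH _ Ex; exists (rcons rest c); split.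
- by apply/bchain_rcons; split=> //; exists g, cs; rewrite H2; split=> //; exact: List.nth_error_In Hi.
- by rewrite last_rcons.
- move=> v; rewrite -rcons_cons -cats1 count_cat H3 size_rcons -[(size x).+2]addn1 iotaD count_cat.
  congr (_ + _).
    apply: eq_in_count => k; rewrite mem_iota add0n ltnS => /andP[_ le].
    by rewrite -cats1 takel_cat.
  rewrite /= add0n !addn0 take_oversize ?size_rcons //.
  by rewrite /gpos /cf conf_at_rcons -/(cf W t x) Ex Ec Hi.
Qed.

Definition ancestors_at (v x : seq nat) :=
  count (fun k => gpos W t (take k x) == Some v) (iota 0 (size x)).

(** Strict, since [x] itself is one more visit to [v] on the branch that leads to it. *)
Lemma ancestors_at_lt v x : gpos W t x = Some v -> ancestors_at v x < b1.
Proof.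
move=> /[dup] Eg; rewrite {1}/gpos; case Ex: (cf W t x) => [c|] //= [Ev].
have [rest [H1 H2 H3]] := path_chain Ex.
apply: leq_trans (Hb1 H1 v); rewrite H3 -[(size x).+1]addn1 iotaD count_cat /= take_size.
by rewrite Eg eqxx addn1.
Qed.

Lemma ancestors_at_prefix v x y : prefix x y -> x != y -> gpos W t x = Some v ->
  ancestors_at v x < ancestors_at v y.
Proof.
move=> /prefixP [[|i z] ->]; first by rewrite cats0 eqxx.
move=> _ Ex; rewrite /ancestors_at size_cat /= addnS -addSn iotaD count_cat.
apply: leq_trans (leq_addr _ _); rewrite -[(size x).+1]addn1 iotaD count_cat.
rewrite -[(count _ _).+1]addn1; apply: leq_add.
  apply: eq_leq; apply: eq_in_count => k; rewrite mem_iota add0n => /andP[_ lt].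
  by rewrite takel_cat // ltnW.
by rewrite /= add0n take_size_cat // Ex eqxx.
Qed.

Lemma count_le_sum (T : Type) (I : finType) (p : pred T) (q : I -> pred T) l :
  (forall x, List.In x l -> p x -> exists j, q j x) ->
  count p l <= \sum_j count (q j) l.
Proof.
elim: l => [|x l IH] H /=; first by [].
rewrite big_split /=; apply: leq_add; last by apply: IH => y iy; apply: H; right.
case px: (p x) => //; have [j qj] := H x (or_introl erefl) px.
by rewrite (bigD1 j) //= qj.
Qed.

Lemma gchain_node rest C : gchain (step s) (init_config N) rest ->
  List.In C (init_config N :: rest) -> is_node s C.1.1.
Proof.
move=> Hc; have : is_node s (init_config N).1.1 by [].
elim: rest (init_config N) Hc => [|C1 rest IH] C0; first by move=> _ n0 [<-|].
case=> -[tau [E iC]] Hc n0 [<-//|iC']; apply: IH Hc _ iC'.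
move: C0 E n0 => [[u q] mu] /stepP [a [tau0 [_ _ S]]] n0.
by have [y _ [v Hv ->]] := srel_leaf_l (srel_sym S) iC; exact: move_node Hv.
Qed.

Lemma layered_bound rest : gchain (step s) (init_config N) rest -> forall v : seq nat,
  count (fun C : config N => gpos W t C.1.1 == Some v) (init_config N :: rest) <= b1 * b2.
Proof.
move=> Hc v; have [l ul Hl] := nodes_enum s.
pose S (j : 'I_b1) := [seq x <- l | (gpos W t x == Some v) && (ancestors_at v x == j)].
apply: leq_trans (_ : \sum_j count (fun C : config N => C.1.1 \in S j)
   (init_config N :: rest) <= _).
  apply: count_le_sum => C iC /eqP EC; exists (Ordinal (ancestors_at_lt EC)).
  by rewrite /= mem_filter EC !eqxx -Hl; exact: gchain_node iC.
have -> : b1 * b2 = \sum_(j < b1) b2 by rewrite sum_nat_const card_ord.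
apply: leq_sum => j _.
apply: (Hb2 Hc); first exact: filter_uniq.
- move=> x y; rewrite !mem_filter => /andP[/andP[/eqP Ex /eqP Ax] _] /andP[/andP[_ /eqP Ay] _] ne.
  by apply/negP => /ancestors_at_prefix /(_ ne Ex); rewrite Ax Ay ltnn.
- by apply/allP => x; rewrite mem_filter Hl => /andP[].
Qed.

End Layers.

(** * Composing the constructions *)

Theorem mainTheorem10 (Sigma Gamma Xi : ranked_alphabet)
    (H : uTHM Sigma Gamma) (N : uTHM Gamma Xi) :
  is_THM H ->
  narrow_visit_on N (sem_range H) ->
  exists K : uTHM Sigma Xi,
    is_THM K /\
    forall t, wf_tree (ra_rank Sigma) t ->
      forall r, sem K t r <-> exists s, sem H t s /\ sem N s r.
Proof.
move=> /norm_bounded [b Hb] /norm_narrow [c Hc].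
set H' := norm H in Hb; set N' := norm N in Hc.
have legH := norm_legal (M := H); have legN := norm_legal (M := N).
pose W : bsys Sigma (ra_sym (oalph Gamma)) := flat H'; pose N1 := walk N'.
(* A step of [H'] is spread over at most [(max_height H').+1] symbols. The walk passes each fibre of
   erased nodes at most twice per visit of [N'], hence [c.*2] on an antichain, and there are [b1]
   antichains for each node of [t]. *)
pose b1 := b * (max_height H').+1; pose cap := b1 * c.*2.
have Hb1 t : wf_tree (ra_rank Sigma) t -> forall rest, bchain t (bini W) rest ->
    forall u : seq nat, count (fun c : bconf W => c.1.1 == u) (bini W :: rest) <= b1.
  by move=> wft rest Hch u; apply: (flat_bounded legH wft _ _ Hch); exact: Hb.
have Hcap t (s1 : tree (ra_sym (oalph Gamma))) : wf_tree (ra_rank Sigma) t -> unf t (bini W) s1 ->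
    forall rest, gchain (step (H := N1) s1) (init_config N1) rest -> forall v : seq nat,
    count (fun C : config N1 => gpos (Gamma := oalph Gamma) W t C.1.1 == Some v)
      (init_config N1 :: rest) <= cap.
  move=> wft U; rewrite /cap.
  refine (@layered_bound Sigma (oalph Gamma) Xi W N1 t s1 b1 c.*2 (Hb1 t wft) _).
  move=> rest Hch S uS aS nS.
  have wfs := flat_wf U; have [s Es] := erases_total wfs.
  apply: (walk_narrow legN Es wfs uS aS nS Hch) => cs Hcs.
  (* Narrowness is available since [s] lies in the range of [H]; it is applied to the projected
     antichain. *)
  apply: (Hc s _ cs Hcs).
  - by exists t; split=> //; apply/norm_sem/flat_sem; exists s1.
  - exact (pr_antichain Es aS nS).
  - by apply/allP => _ /mapP [x ix ->]; apply: pr_node Es _; exact: (allP nS).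
have Hrk p a m (g : ra_sym (oalph Gamma)) ks :
    bact W p a m = Some (g, ks) -> size ks = ra_rank (oalph Gamma) g.
  exact: flat_rank.
pose X := @sim_machine Sigma (oalph Gamma) Xi W N1 cap.
(* The bound for [X] is obtained on the domain only, where the computation tree [s1] exists; the
   test performed by [K] makes this sufficient. *)
have [K [HK1 HK2]] := assembly (X := X) (domain_regular Hb1)
  (fun t wft '(ex_intro s1 U) rest Hch =>
     sim_machine_bounded Hrk wft U (Hcap t s1 wft U) Hch).
exists K; split=> // t wft r; rewrite HK2 //; split.
  case=> -[s1 U] Hg; have wfs := flat_wf U; have [s Es] := erases_total wfs.
  exists s; split; first by apply/norm_sem/flat_sem; exists s1.
  apply/norm_sem; apply/(walk_sem legN Es wfs).
  exact/(sim_machine_sem Hrk wft U (Hcap t s1 wft U)).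
case=> s [/norm_sem/flat_sem [s1 [U Es]] /norm_sem Hr].
have wfs := flat_wf U; split; first by exists s1.
apply/(sim_machine_sem Hrk wft U (Hcap t s1 wft U)).
exact/(walk_sem legN Es wfs).
Qed.
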